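(* Let $m,n\in\mathbb{N}\cup\{0,\infty\}$ with $n+m>0$, and let $u(x,t)$ be the global solution of $u_t=u_{xx}+f(u)$ on $\mathbb{R}\times(0,\infty)$ with initial datum $u(\cdot,0)=u_0(\cdot;m,n)$, where $u_0(\cdot;m,n)$ is the smoothened kink-antikink staircase with positions $\cdots<\xi_2^-<\xi_1^-<\xi_1^+<\xi_2^+<\cdots$ ($m$ positions $\xi_j^-$ and $n$ positions $\xi_j^+$) defined in the context. For $t\ge0$ let $$P(u(t))=\{\xi\in\mathbb{R}:\exists k\in\mathbb{Z}\text{ with }u(\xi,t)=(2k+1)\pi\}.$$ Then the following holds. For any $t\ge0$ the set $P(u(t))$ is discrete and, if $n+m<\infty$, consists of at most $n+m$ elements. There is $t_1>0$, with $t_1=\infty$ if $nm=0$, such that for $0\le t<t_1$ the set $P(u(t))$ consists of differentiable curves $$\xi_m^-(t)<\xi_{m-1}^-(t)<\dots<\xi_1^-(t)<\xi_1^+(t)<\xi_2^+(t)<\dots<\xi_n^+(t)$$ (with the obvious meaning if $m$ or $n$ is $0$ or $\infty$) that coincide at $t=0$ with the initial positions. Moreover, as long as any two such positions are defined, the number of elements of $P(u(t))$ between these cannot increase.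
   Context: Nonlinearity: $f(\theta)=\cos(\theta+\Theta_0)+f_0$ with $f_0\in(0,1)$ and $\Theta_0\in(0,\pi)$ the unique number such that $f(0)=0$. Well-posedness: with $\omega(x)=C^{-1}e^{-C|x|}$ for some $C>0$ and $X_\omega=\{v\in C(\mathbb{R}):\omega v\in L^\infty(\mathbb{R})\}$, the initial value problem has a unique global solution, smooth for $t>0$, for every initial datum in $X_\omega$ (unique among solutions of the Duhamel integral equation that are locally bounded in time with values in $X_\omega$). Initial data: let $H^-(x)=2\pi$ for $x<0$, $\pi$ for $x=0$, $0$ for $x>0$, and $H^+(x)=H^-(-x)$. Given positions $\xi_m^-<\dots<\xi_1^-<\xi_1^+<\dots<\xi_n^+$, each step is smoothened by a mollifier, $H^\pm_{j,\varepsilon}:=\rho_{\varepsilon}*H^\pm(\cdot-\xi^\pm_{j+1})$, where $\rho_\varepsilon$ is smooth, symmetric, supported on $[-\varepsilon,\varepsilon]$, positive in the interior of its support, with integral $1$, and $\varepsilon=\varepsilon_j^\pm>0$ is smaller than half the distance of $\xi_{j+1}^\pm$ to each neighbouring position. Then $$u_0(x;m,n)=\sum_{j=0}^{m-1}H^-_{j,\varepsilon_j^-}(x)+\sum_{j=0}^{n-1}H^+_{j,\varepsilon_j^+}(x).$$ Thus $u_0$ decreases by $2\pi$ near each $\xi_j^-$ (kink) and increases by $2\pi$ near each $\xi_j^+$ (antikink), and $P(u_0)$ is exactly the set of prescribed positions. If $m=\infty$ or $n=\infty$, the positions are such that the sums are locally finite and $u_0\in X_\omega$. *)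

(* Defs.v *)
From HB Require Import structures.
From mathcomp Require Import all_boot all_order all_algebra.
From mathcomp Require Import all_classical all_reals all_analysis.

Set Implicit Arguments.
Unset Strict Implicit.
Unset Printing Implicit Defensive.

Import Order.TTheory GRing.Theory Num.Theory.
Import numFieldNormedType.Exports.

Local Open Scope classical_set_scope.
Local Open Scope ring_scope.

(* The numbers m, n of steps, in {0, 1, 2, ...} with infinity added.          *)
Variant enat := Fin of nat | Infty.

(* Steps are numbered from 0: xm j and xp j stand for the positions usually   *)
(* written xi^-_(j+1) and xi^+_(j+1), and only j \in steps m, resp.           *)
(* j \in steps n, are meaningful.                                             *)
Definition steps (m : enat) : set nat :=
  match m with Fin k => [set j | (j < k)%N] | Infty => setT end.

Section Defs.
Context {R : realType}.

Local Notation mu := (@lebesgue_measure R).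

Definition nonlinearity (f0 Theta0 : R) (theta : R) : R :=
  cos (theta + Theta0) + f0.

(* The integral is 0 by convention when it does not make sense, but all the   *)
(* convolutions taken below converge absolutely.                              *)
Definition convolution (g h : R -> R) (x : R) : R :=
  (\int[mu]_y (g y * h (x - y)))%R.

Definition heat_kernel (t x : R) : R :=
  (Num.sqrt (4 * pi * t))^-1 * expR (- (x ^+ 2) / (4 * t)).

Definition omega (C x : R) : R := C^-1 * expR (- C * `|x|).

Definition X_omega (C : R) (v : R -> R) : Prop :=
  continuous v /\ exists M : R, forall x : R, `|omega C x * v x| <= M.

(* C^oo on R x (0, +oo): D i j is the partial derivative of u of order i in x *)
(* and j in t.                                                                *)
Definition smooth_for_positive_times (u : R -> R -> R) : Prop :=
  exists D : nat -> nat -> R -> R -> R,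
    (forall x t : R, 0 < t -> D 0%N 0%N x t = u x t) /\
    forall (i j : nat) (x t : R), 0 < t ->
      [/\ is_derive x (1 : R) (fun y : R => D i j y t) (D i.+1 j x t),
          is_derive t (1 : R) (fun s => D i j x s) (D i j.+1 x t) &
          {for (x, t), continuous (fun p : R * R => D i j p.1 p.2)}].

(* u x t is the value at position x and time t; only t >= 0 matters.          *)
Definition global_solution (C : R) (f : R -> R) (u0 : R -> R)
    (u : R -> R -> R) : Prop :=
  [/\ forall t : R, 0 <= t -> X_omega C (u ^~ t),
      forall T : R, exists M : R, forall t x : R, 0 <= t <= T ->
        `|omega C x * u x t| <= M,
      (forall x, u x 0 = u0 x) /\
      (forall x t : R, 0 < t ->
        u x t = convolution (heat_kernel t) u0 x +
          (\int[mu]_(s in `]0, t[)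
             convolution (heat_kernel (t - s)) (fun y => f (u y s)) x)%R),
      smooth_for_positive_times u &
      forall x t : R, 0 < t ->
        derive1 (u x) t = derive1n 2 (u ^~ t) x + f (u x t)].

Definition mollifier (eps : R) (rho : R -> R) : Prop :=
  [/\ forall (k : nat) (x : R), derivable (derive1n k rho) x (1 : R),
      forall x, rho (- x) = rho x,
      forall x, eps < `|x| -> rho x = 0,
      forall x, `|x| < eps -> 0 < rho x &
      (\int[mu]_x rho x)%R = 1].

Definition Hminus (x : R) : R :=
  if x < 0 then 2 * pi else if x == 0 then pi else 0.

Definition Hplus (x : R) : R := Hminus (- x).

Definition smooth_kink (rho : R -> R -> R) (eps xi : R) : R -> R :=
  convolution (rho eps) (fun x => Hminus (x - xi)).

Definition smooth_antikink (rho : R -> R -> R) (eps xi : R) : R -> R :=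
  convolution (rho eps) (fun x => Hplus (x - xi)).

(* ... < xm 1 < xm 0 < xp 0 < xp 1 < ...                                      *)
Definition ordered (m n : enat) (xm xp : nat -> R) : Prop :=
  [/\ forall j, steps m j.+1 -> xm j.+1 < xm j,
      forall j, steps n j.+1 -> xp j < xp j.+1 &
      steps m 0%N -> steps n 0%N -> xm 0%N < xp 0%N].

Definition positions (m n : enat) (xm xp : nat -> R) : set R :=
  xm @` steps m `|` xp @` steps n.

(* Each width is positive and smaller than half the distance from its         *)
(* position to either neighbour.                                              *)
Definition admissible_widths (m n : enat) (xm xp em ep : nat -> R) : Prop :=
  [/\ (forall j, steps m j -> 0 < em j) /\ (forall j, steps n j -> 0 < ep j),
      forall j, steps m j.+1 ->
        em j < `|xm j - xm j.+1| / 2 /\ em j.+1 < `|xm j - xm j.+1| / 2,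
      forall j, steps n j.+1 ->
        ep j < `|xp j - xp j.+1| / 2 /\ ep j.+1 < `|xp j - xp j.+1| / 2 &
      steps m 0%N -> steps n 0%N ->
        em 0%N < `|xm 0%N - xp 0%N| / 2 /\ ep 0%N < `|xm 0%N - xp 0%N| / 2].

Definition locally_finite_sum (A : set nat) (F : nat -> R -> R) : Prop :=
  forall x : R, exists2 V, nbhs x V &
    finite_set [set j | A j /\ exists2 y, V y & F j y != 0].

(* The sums are finitely supported ones: when the family is locally finite,   *)
(* only finitely many terms are nonzero at any given x.                       *)
Definition staircase (rho : R -> R -> R) (m n : enat)
    (xm xp em ep : nat -> R) (x : R) : R :=
  \sum_(j \in steps m) smooth_kink rho (em j) (xm j) x +
  \sum_(j \in steps n) smooth_antikink rho (ep j) (xp j) x.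

Definition P (v : R -> R) : set R :=
  [set xi | exists k : int, v xi = (2 * k + 1)%:~R * pi].

Definition discrete_set (A : set R) : Prop := A `<=` isolated A.

(* Differentiability relative to A, hence one-sided at an endpoint of A.      *)
Definition derivable_in (A : set R) (g : R -> R) : Prop :=
  forall t : R, A t ->
    cvg ((fun s => (g s - g t) / (s - t)) @ within A t^').

(* A position followed continuously in time on [0, T]; it starts at a point   *)
(* of P(u(0)), i.e. at one of the prescribed positions.                       *)
Definition position_curve (u : R -> R -> R) (T : R) (a : R -> R) : Prop :=
  {within `[0, T], continuous a} /\
  forall t : R, 0 <= t <= T -> P (u ^~ t) (a t).

End Defs.

(* Main.v *)
Require Import Defs.
From HB Require Import structures.
From mathcomp Require Import all_boot all_order all_algebra.
From mathcomp Require Import all_classical all_reals all_analysis.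
From mathcomp Require Import measurable_realfun.
From mathcomp Require Import zify ring lra.

(** The odd multiples of [pi] are levels at which the nonlinearity is positive,
    while its zeros include the even multiples of [pi].  The proof follows the
    shape of the slices [u(., t)], which descend from the left to a valley and
    ascend from there to the right, and shows that on every odd level this
    shape is strict: the level is met at most once on the descending side and at
    most once on the ascending side, or else only at the minimum.  Below, [w]
    denotes the space derivative of [u].

    The shape.  A difference [u(x + delta, t) - u(x, t)] solves a linear
    equation and is at first negative on the left and positive on the right.  A
    single sign change is preserved in time; instead of appealing to the zero
    number this is proved with a maximum principle for a product of two values
    at ordered points ([two_point_principle], [sign_pattern_line]).  Letting
    [delta] tend to [0], [w] has the same sign pattern, so that each slice is
    quasiconvex ([slope_sign_pattern], [slice_quasiconvex]).

    Strictness.  Near an end of the line the slice stays close to its initial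
    limit, an even multiple of [pi] or infinity ([left_end_of_initial]), hence it
    is not constantly at an odd level there.  Then [w < 0] at a point on the
    descending side that has an odd level, because negativity of [w] spreads
    along thin tubes in space-time ([positivity_propagates],
    [slope_neg_at_odd_level]).  If the minimum is at an odd level, it is attained
    once only, since [w] changes sign at one point: otherwise two Gaussian tails
    entering from the two sides could be added to [w] so as to break the sign
    pattern ([sign_change_at_one_point], [slice_strict_min]).

    Positions.  Thus a position is determined by its level and its side, and the
    limits at the ends of the line allow as many levels on a side as there are
    steps: this gives discreteness and the bound on the number of positions.
    At a minimum with an odd level the source lifts the solution off that level
    at once ([above_odd_level]), so that the valley once lost is never regained.
    Up to the time [t1] at which the valley rises to the level [pi], all steps keep
    their positions, and these are differentiable by the implicit function
    theorem.  The valley persists forever if one of the sides has no step.  A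
    curve of positions keeps its level and its side ([right_side_before]), and
    sending a position to the one of the same level and side at an earlier time
    is an injection that respects the order ([points_between_nonincreasing]).

    The initial time.  The slices at time [0] have the same strictness by
    construction, since each smoothened step is strictly monotone in its own
    window ([left_data_staircase]).  Continuity of the solution up to time [0] is read
    off the integral equation ([heat_flow_near], [solution_near_initial]), and a
    barrier built from a caloric polynomial of degree four shows that [u] has a
    time derivative at time [0] near each position ([initial_rate_of_jet]), so
    that the curves are differentiable there, too. *)

Set Implicit Arguments.
Unset Strict Implicit.
Unset Printing Implicit Defensive.

Import Order.TTheory GRing.Theory Num.Theory.
Import numFieldNormedType.Exports.

Local Open Scope classical_set_scope.
Local Open Scope ring_scope.

(** * Calculus and maximum principles *)

Section Calculus.
Context {R : realType}.
Implicit Types (g dg : R -> R) (d : R -> R -> R) (x y t s a b p q r : R).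

Lemma is_derive_congr g x a b : is_derive x 1 g a -> a = b -> is_derive x 1 g b.
Proof. by move=> h <-. Qed.

Lemma is_derive_quotient g t a : is_derive t 1 g a ->
  forall e, 0 < e -> exists2 r : R, 0 < r & forall s, s != t -> `|s - t| < r ->
    `|(g s - g t) / (s - t) - a| < e.
Proof.
move=> [dg <-] e e0.
have := dg; rewrite /derivable => /cvgrPdist_lt /(_ e e0).
rewrite near_withinE => -[r /= r0 h]; exists r => // s st str.
have := h (s - t); rewrite /= sub0r normrN subr_eq0 => /(_ str st).
rewrite [_%:A]mulr1 subrK /derive distrC [_ *: _]mulrC; exact.
Qed.

Lemma derive_gt0_increases g t a : is_derive t 1 g a -> 0 < a ->
  exists2 r : R, 0 < r & (forall s, t < s -> s < t + r -> g t < g s) /\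
                     (forall s, t - r < s -> s < t -> g s < g t).
Proof.
move=> h a0; have [r r0 hr] := is_derive_quotient h a0; exists r => //.
have key s : s != t -> `|s - t| < r -> 0 < (g s - g t) / (s - t).
  by move=> st sr; have := hr s st sr; rewrite ltr_norml; lra.
split=> s s1 s2.
  have st : 0 < s - t by lra.
  have := key s; rewrite gt_eqF// => /(_ isT); rewrite gtr0_norm// pmulr_lgt0 ?invr_gt0//.
  by lra.
have st : s - t < 0 by lra.
have := key s; rewrite lt_eqF// => /(_ isT); rewrite ltr0_norm// nmulr_lgt0 ?invr_lt0//.
by lra.
Qed.

Lemma is_derive_pos_near g t a : is_derive t 1 g a -> 0 < g t ->
  exists2 r : R, 0 < r & forall s, `|s - t| < r -> 0 < g s.
Proof.
move=> [dg _] gt0.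
have cg : {for t, continuous g} by exact/differentiable_continuous/derivable1_diffP.
have /cvgrPdist_lt/(_ _ gt0) := cg.
case=> r /= r0 hr; exists r => // s st.
have := hr s; rewrite /= distrC => /(_ st); rewrite ltr_norml; lra.
Qed.

Lemma derive_ge0_of_past_max g t a r : is_derive t 1 g a -> 0 < r ->
  (forall s, t - r < s -> s <= t -> g s <= g t) -> 0 <= a.
Proof.
move=> h r0 hm; rewrite leNgt; apply/negP => a0.
have hN : is_derive t 1 (- g) (- a) by exact: is_deriveN.
have [|q q0 [_ hq]] := derive_gt0_increases hN; first by lra.
pose s := t - Num.min r q / 2.
have m0 : 0 < Num.min r q by rewrite lt_min r0 q0.
have mr : Num.min r q <= r by rewrite ge_min lexx.
have mq : Num.min r q <= q by rewrite ge_min lexx orbT.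
have := hq s; rewrite /s !fctE; have := hm s; rewrite /s; lra.
Qed.

Lemma derivative_tests_at_max g dg x a r : (forall y : R, is_derive y 1 g (dg y)) ->
  is_derive x 1 dg a -> 0 < r -> (forall y, `|y - x| < r -> g y <= g x) ->
  dg x = 0 /\ a <= 0.
Proof.
move=> hg hdg r0 hm.
have dg0 : dg x = 0.
  have h := hg x.
  have [] := @derive1_at_max _ g (x - r) (x + r) x.
  - lra.
  - by move=> t _; have [] := hg t.
  - by rewrite in_itv/=; lra.
  - by move=> t; rewrite in_itv/= => /andP[? ?]; apply: hm; rewrite ltr_norml; lra.
  - by move=> _; rewrite derive_val.
split=> //; rewrite leNgt; apply/negP => a0.
have [q q0 [hq _]] := derive_gt0_increases hdg a0.
pose s := x + Num.min r q / 2.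
have m0 : 0 < Num.min r q by rewrite lt_min r0 q0.
have mr : Num.min r q <= r by rewrite ge_min lexx.
have mq : Num.min r q <= q by rewrite ge_min lexx orbT.
have xs : x < s by rewrite /s; lra.
have [|c] := @MVT _ g dg x s xs.
- by apply: derivable_within_continuous => y _; have [] := hg y.
- rewrite in_itv/= => /andP[c1 c2] e.
  have := hq c c1; rewrite dg0 => /(_ _) H.
  have H' : 0 < dg c by apply: H; rewrite /s in c2; lra.
  have : 0 < dg c * (s - x) by rewrite mulr_gt0//; lra.
  rewrite -e subr_gt0; apply/negP; rewrite -leNgt; apply: hm.
  by rewrite gtr0_norm /s; lra.
Qed.

Lemma derivative_tests_at_min g dg x a r : (forall y : R, is_derive y 1 g (dg y)) ->
  is_derive x 1 dg a -> 0 < r -> (forall y, `|y - x| < r -> g x <= g y) ->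
  dg x = 0 /\ 0 <= a.
Proof.
move=> hg hdg r0 hm.
suff [e le] : (- dg) x = 0 /\ - a <= 0.
  by split; [apply/eqP; rewrite -oppr_eq0; apply/eqP|rewrite -oppr_le0].
apply: (@derivative_tests_at_max (- g) _ _ _ r) => //.
by move=> y yx; rewrite !fctE lerN2; exact: hm.
Qed.

Lemma MVT_derive g dg a b : (forall y : R, is_derive y 1 g (dg y)) -> a < b ->
  exists2 c, a < c < b & g b - g a = dg c * (b - a).
Proof.
move=> hg ab; have [|c] := @MVT _ g dg a b ab.
- by apply: derivable_within_continuous => y _; have [] := hg y.
- by rewrite in_itv/= => cab e; exists c.
Qed.


(** Only the derivatives at one point are recorded: the barriers below are
    smooth where they are used but not everywhere.  The first space derivative
    has to exist on the whole line for the second one to make sense. *)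
Definition heat_jet (d : R -> R -> R) (x t dt dxx : R) : Prop :=
  is_derive t 1 (d x) dt /\ exists dx : R -> R, (forall y : R, is_derive y 1 (d ^~ t) (dx y)) /\ is_derive x 1 dx dxx.

Lemma heat_jetD d1 d2 x t a1 b1 a2 b2 :
  heat_jet d1 x t a1 b1 -> heat_jet d2 x t a2 b2 ->
  heat_jet (fun x t => d1 x t + d2 x t) x t (a1 + a2) (b1 + b2).
Proof.
move=> [h1 [e1 [g1 k1]]] [h2 [e2 [g2 k2]]]; split; first exact: is_deriveD.
exists (e1 + e2); split; last exact: is_deriveD.
by move=> y; exact: (is_deriveD (g1 y) (g2 y)).
Qed.

Lemma heat_jetMt (h : R -> R) d x t h' a b :
  is_derive t 1 h h' -> heat_jet d x t a b ->
  heat_jet (fun x t => h t * d x t) x t (h' * d x t + h t * a) (h t * b).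
Proof.
move=> hh [h1 [e1 [g1 k1]]]; split.
  by apply: is_derive_eq; rewrite /GRing.scale/= addrC mulrC [X in _ + X]mulrC.
exists (fun y => h t * e1 y); split; last exact: (is_deriveZ (h t) k1).
by move=> y; exact: (is_deriveZ (h t) (g1 y)).
Qed.

Lemma heat_jetZ (k : R) d x t a b : heat_jet d x t a b ->
  heat_jet (fun x t => k * d x t) x t (k * a) (k * b).
Proof.
move=> h; have := heat_jetMt (is_derive_cst k t 1) h.
by rewrite mul0r add0r.
Qed.

Lemma heat_jetN d x t a b : heat_jet d x t a b ->
  heat_jet (fun x t => - d x t) x t (- a) (- b).
Proof.
move=> /(heat_jetZ (-1)); rewrite !mulN1r.
by under eq_fun do under eq_fun do rewrite mulN1r.
Qed.

Lemma heat_jetB d1 d2 x t a1 b1 a2 b2 :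
  heat_jet d1 x t a1 b1 -> heat_jet d2 x t a2 b2 ->
  heat_jet (fun x t => d1 x t - d2 x t) x t (a1 - a2) (b1 - b2).
Proof. by move=> h1 h2; apply: heat_jetD h1 _; exact: heat_jetN. Qed.

Lemma heat_jet_cst (k x t : R) : heat_jet (fun _ _ => k) x t 0 0.
Proof.
split; first exact: is_derive_cst.
by exists (fun=> 0); split=> [y|]; exact: is_derive_cst.
Qed.

Lemma heat_jet_shift d x t p a b : heat_jet d (x + p) t a b ->
  heat_jet (fun x t => d (x + p) t) x t a b.
Proof.
have sh (g : R -> R) (y c : R) : is_derive (y + p) 1 g c ->
    is_derive y 1 (fun z => g (z + p)) c.
  move=> h; have h2 : is_derive y 1 (fun z : R => z + p) (1 + 0).
    exact: (is_deriveD (is_derive_id y 1) (is_derive_cst p y 1)).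
  by have := @is_derive1_comp R g (fun z : R => z + p) y c _ h h2; rewrite addr0 mulr1.
move=> [h [e [g k]]]; split => //.
exists (fun y => e (y + p)); split; last exact: sh.
by move=> y; exact: (sh (d ^~ t)).
Qed.

Lemma heat_jet_opp d x t a b : heat_jet d (- x) t a b ->
  heat_jet (fun x t => d (- x) t) x t a b.
Proof.
have sh (g : R -> R) (y c : R) : is_derive (- y) 1 g c ->
    is_derive y 1 (fun z => g (- z)) (- c).
  move=> h; have h2 : is_derive y 1 (fun z : R => - z) (- 1) by exact: is_deriveNid.
  by have := @is_derive1_comp R g (fun z : R => - z) y c _ h h2; rewrite mulrN1.
move=> [h [e [g k]]]; split => //.
exists (fun y => - e (- y)); split.
  by move=> y; exact: (sh (d ^~ t)).
by rewrite -[b]opprK; apply: is_deriveN; exact: sh.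
Qed.

Lemma continuous_fst_comp (T S U : topologicalType) (f : U -> T * S) :
  continuous f -> continuous (fun z => (f z).1).
Proof. by move=> cf z; apply: (continuous_comp (cf z)); exact: cvg_fst. Qed.

Lemma continuous_snd_comp (T S U : topologicalType) (f : U -> T * S) :
  continuous f -> continuous (fun z => (f z).2).
Proof. by move=> cf z; apply: (continuous_comp (cf z)); exact: cvg_snd. Qed.

Lemma continuous_pair (T S U : topologicalType) (f : U -> T) (g : U -> S) :
  continuous f -> continuous g -> continuous (fun z => (f z, g z)).
Proof. by move=> cf cg z; apply: cvg_pair; [exact: cf|exact: cg]. Qed.

Lemma within_precomp_continuous (T S : topologicalType) (A : set T) (B : set S)
    (f : S -> R) (phi : T -> S) :
  continuous phi -> (forall z, A z -> B (phi z)) ->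
  {within B, continuous f} -> {within A, continuous (f \o phi)}.
Proof.
move=> cphi AB /subspace_continuousP cf; apply/subspace_continuousP => x Ax.
move=> U /(cf _ (AB _ Ax)) BU.
have {}BU : nbhs (phi x) [set y | B y -> U (f y)] by exact: BU.
change (nbhs x [set z | A z -> U (f (phi z))]).
apply: (@filterS _ (nbhs x) _ _ _ _ (cphi x _ BU)) => z hz Az.
exact: hz (AB _ Az).
Qed.

Lemma within_continuousM (T : topologicalType) (A : set T) (f g : T -> R) :
  {within A, continuous f} -> {within A, continuous g} ->
  {within A, continuous (fun z => f z * g z)}.
Proof. by move=> cf cg x; apply: cvgM; [exact: cf|exact: cg]. Qed.

Lemma within_continuousD (T : topologicalType) (A : set T) (f g : T -> R) :
  {within A, continuous f} -> {within A, continuous g} ->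
  {within A, continuous (fun z => f z + g z)}.
Proof. by move=> cf cg x; apply: cvgD; [exact: cf|exact: cg]. Qed.

Lemma within_continuousN (T : topologicalType) (A : set T) (f : T -> R) :
  {within A, continuous f} -> {within A, continuous (fun z => - f z)}.
Proof. by move=> cf x; apply: cvgN; exact: cf. Qed.

Lemma within_continuous_max0 (T : topologicalType) (A : set T) (f : T -> R) :
  {within A, continuous f} ->
  {within A, continuous (fun z => Num.max (f z) 0)}.
Proof.
move=> cf x; apply: (@continuous_max _ (subspace A) f (fun=> 0)).
  exact: cf.
exact: cst_continuous.
Qed.

(** Two-sided in space but one-sided in time, so that points of the final time
    slice are admitted, as is customary for parabolic boundaries. *)
Definition past_interior (A : set (R * R)) x t : Prop :=
  exists2 r : R, 0 < r & (forall y, `|y - x| < r -> A (y, t)) /\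
                     (forall s, t - r < s -> s <= t -> A (x, s)).

Lemma continuous_expRM_snd (T : topologicalType) (K : R) :
  continuous (fun z : T * R => expR (K * z.2)).
Proof.
move=> z; apply: (continuous_comp (f := fun z : T * R => K * z.2)).
  by apply: cvgM; [exact: cvg_cst|exact: cvg_snd].
exact: continuous_expR.
Qed.

Lemma is_derive_expRM (K t : R) :
  is_derive t 1 (fun t => expR (K * t)) (K * expR (K * t)).
Proof.
have h : is_derive t 1 (fun t : R => K * t) (K * 1) by exact: is_deriveZ.
have := @is_derive1_comp R expR (fun t => K * t) t _ _ (is_derive_expR _) h.
by rewrite mulr1 mulrC.
Qed.

(** At a negative minimum over [A] of [d] discounted by [expR (- K * t)] the
    second space derivative is nonnegative and the discounted function has not
    increased in time, which contradicts the strict inequality assumed there. *)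
Lemma max_principle (A : set (R * R)) d (K : R) :
  compact A -> {within A, continuous (fun z => d z.1 z.2)} ->
  (forall x t, A (x, t) -> d x t < 0 -> past_interior A x t /\
     exists a b, heat_jet d x t a b /\ K * d x t < a - b) ->
  forall x t, A (x, t) -> 0 <= d x t.
Proof.
move=> cA cd hd x0 t0 A0; rewrite leNgt; apply/negP => d0.
pose m x t := expR (- K * t) * d x t.
have cm : {within A, continuous (fun z => m z.1 z.2)}.
  apply: within_continuousM => //.
  exact/continuous_subspaceT/continuous_expRM_snd.
have [|[x t] /set_mem Axt hmin] := compact_EVT_min _ cA cm.
  by exists (x0, t0).
have {}hmin y s : A (y, s) -> m x t <= m y s.
  by move=> Ays; apply: (hmin (y, s)); exact/mem_set.
have e0 : 0 < expR (- K * t) by exact: expR_gt0.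
have dxt : d x t < 0.
  rewrite -(pmulr_rlt0 _ e0); apply: (le_lt_trans (hmin _ _ A0)).
  by rewrite pmulr_rlt0 ?expR_gt0.
have [[r r0 [hx ht]] [a [b [hj hK]]]] := hd _ _ Axt dxt.
have [mt [mx [hmx hmxx]]] := heat_jetMt (is_derive_expRM (- K) t) hj.
have [_ b0] := derivative_tests_at_min hmx hmxx r0 (fun y yx => hmin _ _ (hx y yx)).
have : 0 <= - (- K * expR (- K * t) * d x t + expR (- K * t) * a).
  apply: (derive_ge0_of_past_max (is_deriveN mt) r0) => s s1 s2.
  by rewrite !fctE lerN2; exact: hmin (ht s s1 s2).
rewrite (_ : - (_ + _) = expR (- K * t) * (K * d x t - a)); last by ring.
by move: b0; rewrite !pmulr_rge0//; lra.
Qed.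

(** A substitute for the theory of the zero number when there is a single sign
    change, from negative to positive.  If the pattern were broken, the product
    of the positive parts of [W1] at [a] and of [- W2] at [b], with [a <= b] and
    discounted by [expR (- (2 * K) * t)], would have a positive maximum.  There
    the logarithmic time derivative of the first factor is less than [K] up to
    a second space derivative of the right sign, and so is that of the second
    factor, so that the discounted product would decrease in time.  The order
    [W1 <= W2] keeps the maximum away from [a = b]. *)
Lemma two_point_principle (p q t0 t1 K : R) (W1 W2 : R -> R -> R) :
  {within `[p, q] `*` `[t0, t1], continuous (fun z => W1 z.1 z.2)} ->
  {within `[p, q] `*` `[t0, t1], continuous (fun z => W2 z.1 z.2)} ->
  (forall x t, p <= x <= q -> t0 <= t <= t1 -> W1 x t <= W2 x t) ->
  (forall x t, p < x < q -> t0 < t <= t1 -> 0 < W1 x t ->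
     exists a b, heat_jet W1 x t a b /\ a - b < K * W1 x t) ->
  (forall x t, p < x < q -> t0 < t <= t1 -> W2 x t < 0 ->
     exists a b, heat_jet W2 x t a b /\ K * W2 x t < a - b) ->
  (forall t, t0 <= t <= t1 -> W1 p t <= 0) ->
  (forall t, t0 <= t <= t1 -> 0 <= W2 q t) ->
  (forall a b, p <= a -> a <= b -> b <= q -> 0 < W1 a t0 -> 0 <= W2 b t0) ->
  forall t a b, t0 <= t <= t1 -> p <= a -> a <= b -> b <= q ->
    0 < W1 a t -> 0 <= W2 b t.
Proof.
move=> c1 c2 W12 j1 j2 hp hq h0 t' a' b' t't1 pa' ab' bq' W1a'.
rewrite leNgt; apply/negP => W2b'.
pose A : set (R * R * R) := [set z | z.1.1 <= z.1.2] `&`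
  ((`[p, q] `*` `[p, q]) `*` `[t0, t1]).
have c1' : continuous (fun z : R * R * R => z.1).
  by move=> z; exact: cvg_fst.
have c11 := continuous_fst_comp c1'; have c12 := continuous_snd_comp c1'.
have ct : continuous (fun z : R * R * R => z.2).
  by move=> z; exact: cvg_snd.
have cA : compact A.
  rewrite /A setIC; apply: compact_closedI.
    by do 2?apply: compact_setX; exact: segment_compact.
  have cf : continuous (fun z : R * R * R => z.1.2 - z.1.1).
    move=> z; apply: cvgB; [exact: c12|exact: c11].
  have := closed_comp (fun z _ => cf z) (@closed_ge R 0).
  by congr closed; apply/seteqP; split=> z /=; rewrite subr_ge0.
pose F (z : R * R * R) := expR (- (2 * K) * z.2) *
  (Num.max (W1 z.1.1 z.2) 0 * Num.max (- W2 z.1.2 z.2) 0).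
have cF : {within A, continuous F}.
  apply: within_continuousM.
    exact/continuous_subspaceT/continuous_expRM_snd.
  apply: within_continuousM; apply: within_continuous_max0.
    apply: (within_precomp_continuous (phi := fun z : R * R * R => (z.1.1, z.2)) _ _ c1).
      exact: continuous_pair.
    by move=> z [_ [[]]].
  apply: within_continuousN.
  apply: (within_precomp_continuous (phi := fun z : R * R * R => (z.1.2, z.2)) _ _ c2).
    exact: continuous_pair.
  by move=> z [_ [[]]].
have A' : A (a', b', t').
  by rewrite /A/=; split=> //=; rewrite !in_itv/=; split=> //; split; lra.
have [|[[a b] t] /set_mem Aabt hmax] := compact_EVT_max _ cA cF.
  by exists (a', b', t').
have {}hmax z : A z -> F z <= F (a, b, t).
  by move=> Az; apply: hmax; exact/mem_set.
have F0 : 0 < F (a, b, t).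
  apply: lt_le_trans (hmax _ A'); rewrite /F/= mulr_gt0 ?expR_gt0//.
  by rewrite mulr_gt0// lt_max ?W1a' ?oppr_gt0 ?W2b'.
have [W1a W2b] : 0 < W1 a t /\ W2 b t < 0.
  move: F0; rewrite /F/= pmulr_rgt0 ?expR_gt0//.
  case: (ltP 0 (W1 a t)) => [W1a|W1a]; last by rewrite mul0r ltxx.
  case: (ltP 0 (- W2 b t)) => [W2b|W2b]; last by rewrite mulr0 ltxx.
  by rewrite oppr_gt0 in W2b.
move: Aabt => [/= ab [[]]]; rewrite !in_itv/= => pq1 pq2 tt.
have pa : p < a.
  rewrite lt_neqAle; apply/andP; split; last by lra.
  by apply/eqP => pa; have := hp t tt; rewrite pa; lra.
have bq : b < q.
  rewrite lt_neqAle; apply/andP; split; last by lra.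
  by apply/eqP => bq; have := hq t tt; rewrite -bq; lra.
have {}ab : a < b.
  rewrite lt_neqAle ab andbT; apply/eqP => e; subst b.
  by have := W12 a t pq1 tt; lra.
have t0t : t0 < t.
  rewrite lt_neqAle; apply/andP; split; last by lra.
  apply/eqP => e; subst t; have := h0 a b; clear -pq1 pq2 ab W1a W2b; lra.
have tt0 : t0 < t <= t1 by clear -t0t tt; lra.
have pq1' : p < a < q by clear -pa ab bq; lra.
have pq2' : p < b < q by clear -pa ab bq; lra.
have [a1 [b1 [J1 K1]]] := j1 a t pq1' tt0 W1a.
have [a2 [b2 [J2 K2]]] := j2 b t pq2' tt0 W2b.
have e0 : 0 < expR (- (2 * K) * t) by exact: expR_gt0.
have FE y z s : 0 <= W1 y s -> W2 z s <= 0 ->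
    F (y, z, s) = expR (- (2 * K) * s) * (W1 y s * - W2 z s).
  by move=> w1 w2; rewrite /F/= !max_l// oppr_ge0.
have F1 : F (a, b, t) = expR (- (2 * K) * t) * (W1 a t * - W2 b t).
  by rewrite FE ?ltW.

have A0 y z s : p < y < q -> p < z < q -> y <= z -> t0 <= s <= t1 -> A (y, z, s).
  by rewrite /A/= !in_itv/= => /andP[/ltW-> /ltW->] /andP[/ltW-> /ltW->] -> ->.
clear - hmax F1 FE J1 J2 K1 K2 W1a W2b e0 pq1' pq2' ab tt0 A0.
have [w1 [hw1 hw1x]] := J1.2; have [w2 [hw2 hw2x]] := J2.2.
have [|y ya|_ b1le] := derivative_tests_at_max (r := Num.min (a - p) (b - a)) hw1 hw1x.
- by rewrite lt_min; lra.
- move: ya; rewrite lt_min !ltr_norml => ya.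
  have [Wy|Wy] := leP (W1 y t) 0; first by lra.
  have := hmax (y, b, t); rewrite F1 (FE _ _ _ (ltW Wy) (ltW W2b)) ler_pM2l// ler_pM2r ?oppr_gt0//.
  by apply; apply: A0; clear -ya pq1' pq2' ab tt0; lra.
have [|y yb|_ b2ge] := derivative_tests_at_min (r := Num.min (b - a) (q - b)) hw2 hw2x.
- by rewrite lt_min; lra.
- move: yb; rewrite lt_min !ltr_norml => yb.
  have [Wy|Wy] := leP 0 (W2 y t); first by lra.
  have := hmax (a, y, t); rewrite F1 (FE _ _ _ (ltW W1a) (ltW Wy)) ler_pM2l// ler_pM2l// lerN2.
  by apply; apply: A0; clear -yb pq1' pq2' ab tt0; lra.
have [r1 r10 hr1] := is_derive_pos_near J1.1 W1a.
have [|r2 r20 hr2] := is_derive_pos_near (is_deriveN J2.1).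
  by rewrite fctE oppr_gt0.
have D := is_deriveM (is_derive_expRM (- (2 * K)) t)
  (is_deriveM J1.1 (is_deriveN J2.1)).
have H := @derive_ge0_of_past_max _ _ _ (Num.min (t - t0) (Num.min r1 r2)) D.
have : 0 <= expR (- (2 * K) * t) * (a1 * - W2 b t + W1 a t * - a2 -
    2 * K * (W1 a t * - W2 b t)).
  rewrite (_ : _ * _ = expR (- (2 * K) * t) *: (W1 a t *: - a2 + (- W2 b) t *: a1) +
    (W1 a t * - W2 b t) *: (- (2 * K) * expR (- (2 * K) * t))); last first.
    by rewrite /GRing.scale/= !fctE; ring.
  apply: H; first by rewrite !lt_min; lra.
  move=> s; rewrite !fctE => s1 s2.
  have := s1; rewrite ltrBlDr -ltrBlDl !lt_min => s3.
  have [W1s W2s] : 0 < W1 a s /\ W2 b s < 0.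
    split; first by apply: hr1; clear -s2 s3; rewrite ltr_norml; lra.
    by rewrite -oppr_gt0; apply: hr2; clear -s2 s3; rewrite ltr_norml; lra.
  rewrite -F1 -(FE _ _ _ (ltW W1s) (ltW W2s)); apply: hmax.
  by apply: A0; clear -s2 s3 pq1' pq2' ab tt0; lra.
(* both differential inequalities, weighted by the other factor, add up to a contradiction *)
rewrite pmulr_rge0//; clear -K1 K2 W1a W2b b1le b2ge.
have : W1 a t * (- W2 b t * K) + (- W2 b t) * (W1 a t * K) =
  2 * K * (W1 a t * - W2 b t) by ring.
have : (a1 - b1 - K * W1 a t) * - W2 b t < 0 by rewrite nmulr_rlt0; lra.
have : b1 * - W2 b t <= 0 by rewrite mulr_le0_ge0//; lra.
have : 0 < W1 a t * (a2 - b2 - K * W2 b t) by rewrite mulr_gt0//; lra.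
have : 0 <= W1 a t * b2 by rewrite mulr_ge0//; lra.
by lra.
Qed.

End Calculus.

(** * Comparison on the line *)

Section Line.
Context {R : realType}.
Implicit Types (d : R -> R -> R) (x y t s a b p q r C M eps l : R).

(** Satisfied by the solutions of linear equations [d_t = d_xx + c * d] with
    [`|c| <= 1], whatever the coefficient [c]: this is all that is used of the
    linearized equation and of the equation for differences of solutions. *)
Definition almost_caloric d x t : Prop :=
  exists a b, heat_jet d x t a b /\ `|a - b| <= `|d x t|.

Lemma past_interior_box p q t0 t1 x t : p < x < q -> t0 < t <= t1 ->
  past_interior (`[p, q] `*` `[t0, t1]) x t.
Proof.
move=> px tt; exists (Num.min (Num.min (x - p) (q - x)) (t - t0)).
  by rewrite !lt_min; lra.
split=> [y|s]; rewrite /= !in_itv/=.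
  rewrite !lt_min => /andP[/andP[+ +] _]; rewrite !ltr_norml; lra.
by rewrite ltrBlDr -ltrBlDl !lt_min => /andP[_ ?] ?; split; lra.
Qed.

(** The rate exceeds the square [4 * C ^+ 2] of the exponent by [1], which
    makes the weight a supersolution of [d_t = d_xx + d], while the exponent
    [2 * C] beats the growth allowed to solutions. *)
Definition growth_weight C x t : R :=
  expR ((4 * C ^+ 2 + 1) * t) * (expR (2 * C * x) + expR (- (2 * C) * x)).

Lemma growth_weight_gt0 C x t : 0 < growth_weight C x t.
Proof. by rewrite mulr_gt0 ?addr_gt0 ?expR_gt0. Qed.

Lemma heat_jet_growth_weight C x t :
  heat_jet (growth_weight C) x t ((4 * C ^+ 2 + 1) * growth_weight C x t)
    (4 * C ^+ 2 * growth_weight C x t).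
Proof.
split.
  have h := is_derive_expRM (4 * C ^+ 2 + 1) t.
  apply: (is_derive_congr (is_deriveM h
    (is_derive_cst (expR (2 * C * x) + expR (- (2 * C) * x)) t 1))).
  by rewrite /growth_weight /GRing.scale/= mulr0 add0r mulrC mulrA.
pose E := expR ((4 * C ^+ 2 + 1) * t).
exists (fun y => E * (2 * C * expR (2 * C * y) + - (2 * C) * expR (- (2 * C) * y))).
split=> [y|].
  have h := is_deriveD (is_derive_expRM (2 * C) y) (is_derive_expRM (- (2 * C)) y).
  exact: (is_deriveZ E h).
have h1 := is_deriveZ (2 * C) (is_derive_expRM (2 * C) x).
have h2 := is_deriveZ (- (2 * C)) (is_derive_expRM (- (2 * C)) x).
apply: (is_derive_congr (is_deriveZ E (is_deriveD h1 h2))).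
by rewrite /growth_weight /E /GRing.scale/=; ring.
Qed.

Lemma continuous_growth_weight C :
  continuous (fun z : R * R => growth_weight C z.1 z.2).
Proof.
have e (K : R) : continuous (fun z : R * R => expR (K * z.1)).
  move=> z; apply: (continuous_comp (f := fun z : R * R => K * z.1)).
    by apply: cvgM; [exact: cvg_cst|exact: cvg_fst].
  exact: continuous_expR.
move=> z; apply: cvgM; first exact: continuous_expRM_snd.
by apply: cvgD; exact: e.
Qed.

Lemma growth_weight_dominates C M eps l : 0 < C -> 0 < eps ->
  exists2 L : R, l < L & forall x t, `|x| = L -> 0 <= t ->
    M * expR (C * `|x|) <= eps * growth_weight C x t.
Proof.
move=> C0 e0; pose L := `|l| + 1 + `|M| / (eps * C).
have k0 : 0 <= `|M| / (eps * C) by rewrite divr_ge0// mulr_ge0// ltW.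
exists L; first by rewrite /L; have := ler_norm l; lra.
move=> x t xL t0.
have L0 : 0 <= L by rewrite -xL.
apply: (@le_trans _ _ (eps * expR (2 * C * L))).
  rewrite xL (_ : 2 * C * L = C * L + C * L); last by ring.
  rewrite expRD mulrA ler_pM2r ?expR_gt0//.
  apply: (le_trans (ler_norm M)).
  apply: (@le_trans _ _ (eps * (1 + C * L))); last first.
    by rewrite ler_pM2l// expR_ge1Dx.
  have -> : `|M| = eps * (C * (`|M| / (eps * C))) by field; lra.
  rewrite ler_pM2l//; apply: (@le_trans _ _ (C * L)); last by lra.
  by rewrite ler_pM2l// /L; have := normr_ge0 l; lra.
rewrite ler_pM2l//.
apply: (@le_trans _ _ (expR (2 * C * x) + expR (- (2 * C) * x))).
  rewrite -xL; have [x0|x0] := ger0P x; first by rewrite lerDl expR_ge0.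
  by rewrite mulrN -mulNr lerDr expR_ge0.
rewrite ler_peMl ?addr_ge0 ?expR_ge0// -[leLHS]expR0 ler_expR.
by rewrite mulr_ge0//; have := sqr_ge0 C; lra.
Qed.

Section Strip.
Variables (C M t0 t1 : R) (d : R -> R -> R).
Hypothesis C0 : 0 < C.
Hypothesis t00 : 0 <= t0.
Hypothesis cd : {within [set z : R * R | t0 <= z.2 <= t1],
  continuous (fun z => d z.1 z.2)}.
Hypothesis growth : forall x t, t0 <= t <= t1 -> `|d x t| <= M * expR (C * `|x|).

Let box_sub L : `[- L, L] `*` `[t0, t1] `<=` [set z : R * R | t0 <= z.2 <= t1].
Proof. by move=> z [_]; rewrite /= in_itv. Qed.

(** The weight dominates the growth of [d] at infinity, so that adding a small
    multiple of it reduces the comparison to a bounded box. *)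
Lemma comparison_line :
  (forall x, 0 <= d x t0) ->
  (forall x t, t0 < t <= t1 -> d x t < 0 ->
     exists a b, heat_jet d x t a b /\ d x t <= a - b) ->
  forall x t, t0 <= t <= t1 -> 0 <= d x t.
Proof.
move=> d0 hd x t tt.
have key (eps : R) : 0 < eps -> 0 <= d x t + eps * growth_weight C x t.
  move=> e0; have [L xL hL] := growth_weight_dominates M `|x| C0 e0.
  pose A := `[- L, L] `*` `[t0, t1] : set (R * R).
  apply: (@max_principle _ A (fun x t => d x t + eps * growth_weight C x t) 2).
  - by apply: compact_setX; exact: segment_compact.
  - apply: within_continuousD; first exact: continuous_subspaceW (@box_sub L) cd.
    apply: continuous_subspaceT => z; apply: cvgM; first exact: cvg_cst.
    exact: continuous_growth_weight.
  - move=> y s []; rewrite /= !in_itv/= => yL ss /= dneg.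
    have phi0 : 0 < eps * growth_weight C y s by rewrite mulr_gt0// growth_weight_gt0.
    have yL' : - L < y < L.
      suff : `|y| != L by rewrite -ltr_norml lt_neqAle => ->; rewrite ler_norml.
      apply/eqP => yL'; have s0 : 0 <= s by move: t00; lra.
      have := hL y s yL' s0; have := growth y ss.
      by rewrite ler_norml; lra.
    have t0s : t0 < s <= t1.
      suff : t0 != s by rewrite lt_neqAle => ->.
      by apply/eqP => e; subst s; have := d0 y; lra.
    split; first exact: past_interior_box.
    have [|a [b [J h]]] := hd y s t0s; first by lra.
    have J' := heat_jetD J (heat_jetZ eps (heat_jet_growth_weight C y s)).
    by do 2 eexists; split; first exact: J'; lra.
  - by rewrite /A/= !in_itv/= -ler_norml; split=> //; exact: ltW.
rewrite leNgt; apply/negP => dneg.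
have w0 := growth_weight_gt0 C x t.
have e0 : 0 < - d x t / (2 * growth_weight C x t) by rewrite divr_gt0//; lra.
have := key _ e0.
have -> : - d x t / (2 * growth_weight C x t) * growth_weight C x t = - d x t / 2.
  by field; lra.
by lra.
Qed.

(** Subtracting and adding a small multiple of the weight gives two functions
    with the boundary signs that the two-point principle requires on a large
    box. *)
Lemma sign_pattern_line :
  (forall a b, a <= b -> 0 < d a t0 -> 0 <= d b t0) ->
  (forall x t, t0 < t <= t1 -> almost_caloric d x t) ->
  forall t a b, t0 <= t <= t1 -> a <= b -> 0 < d a t -> 0 <= d b t.
Proof.
move=> d0 hd t a b tt ab da; rewrite leNgt; apply/negP => db.
pose Q := growth_weight C a t + growth_weight C b t.
have wa := growth_weight_gt0 C a t; have wb := growth_weight_gt0 C b t.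
pose eps := Num.min (d a t) (- d b t) / (2 * Q).
have m0 : 0 < Num.min (d a t) (- d b t) by rewrite lt_min; lra.
have ma : Num.min (d a t) (- d b t) <= d a t by rewrite ge_min lexx.
have mb : Num.min (d a t) (- d b t) <= - d b t by rewrite ge_min lexx orbT.
have e0 : 0 < eps by rewrite divr_gt0// mulr_gt0// /Q; lra.
have eQ : eps * Q = Num.min (d a t) (- d b t) / 2.
  by rewrite /eps; field; rewrite /Q; lra.
have ea : 0 < eps * growth_weight C a t by rewrite mulr_gt0.
have eb : 0 < eps * growth_weight C b t by rewrite mulr_gt0.
rewrite /Q mulrDr in eQ.
have [L abL hL] := growth_weight_dominates M (Num.max `|a| `|b|) C0 e0.
move: abL; rewrite gt_max => /andP[aL bL].
pose W1 x t := d x t - eps * growth_weight C x t.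
pose W2 x t := d x t + eps * growth_weight C x t.
have cE : {within `[- L, L] `*` `[t0, t1],
    continuous (fun z => eps * growth_weight C z.1 z.2)}.
  apply: continuous_subspaceT => z; apply: cvgM; first exact: cvg_cst.
  exact: continuous_growth_weight.
have cD := continuous_subspaceW (@box_sub L) cd.
have pos y s : 0 < eps * growth_weight C y s.
  by rewrite mulr_gt0 ?growth_weight_gt0.
have L0 : 0 < L by apply: le_lt_trans aL.
suff : 0 <= W2 b t by rewrite /W2; lra.
apply: (@two_point_principle _ (- L) L t0 t1 2 W1 W2 _ _ _ _ _ _ _ _ t a b) => //.
- by apply: within_continuousD => //; exact: within_continuousN.
- exact: within_continuousD.
- by move=> y s _ _; have := pos y s; rewrite /W1 /W2; lra.
- move=> y s _ ss; rewrite /W1 => W0; have ps := pos y s.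
  have [a1 [b1 [J]]] := hd y s ss; rewrite [X in _ <= X]gtr0_norm; last by lra.
  rewrite ler_norml => h.
  have J' := heat_jetB J (heat_jetZ eps (heat_jet_growth_weight C y s)).
  by do 2 eexists; split; first exact: J'; lra.
- move=> y s _ ss; rewrite /W2 => W0; have ps := pos y s.
  have [a1 [b1 [J]]] := hd y s ss; rewrite [X in _ <= X]ltr0_norm; last by lra.
  rewrite ler_norml => h.
  have J' := heat_jetD J (heat_jetZ eps (heat_jet_growth_weight C y s)).
  by do 2 eexists; split; first exact: J'; lra.
- move=> s ss; have := growth (- L) ss; rewrite ler_norml /W1.
  have := hL (- L) s; rewrite normrN gtr0_norm// => /(_ erefl) h.
  have s0 : 0 <= s by move: t00; lra.
  by have := h s0; lra.
- move=> s ss; have := growth L ss; rewrite ler_norml /W2.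
  have := hL L s; rewrite gtr0_norm// => /(_ erefl) h.
  have s0 : 0 <= s by move: t00; lra.
  by have := h s0; lra.
- rewrite /W1 /W2 => y1 y2 _ y12 _; have := d0 _ _ y12; have := pos y1 t0; have := pos y2 t0.
  move=> p1 p2 h h'; have : 0 <= d y2 t0 by apply: h; lra.
  by lra.
- by move: aL; rewrite ltr_norml; lra.
- by move: bL; rewrite ltr_norml; lra.
- by rewrite /W1; lra.
Qed.

End Strip.

End Line.

(** * Propagation of positivity *)

Section Tube.
Context {R : realType}.
Implicit Types (d z : R -> R -> R) (x y t s a b p q r v C M K eps l : R).

(** The axis is slanted so that a tube can join any two points of different
    times. *)
Definition tube p v r t0 t1 : set (R * R) :=
  [set z | `|z.1 - (p + v * z.2)| <= r /\ t0 <= z.2 <= t1].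

Lemma continuous_affine p v : continuous (fun z : R * R => z.1 - (p + v * z.2)).
Proof.
move=> z; apply: cvgB; first exact: cvg_fst.
apply: cvgD; first exact: cvg_cst.
by apply: cvgM; [exact: cvg_cst|exact: cvg_snd].
Qed.

Lemma compact_tube p v r t0 t1 : compact (tube p v r t0 t1).
Proof.
pose l := `|p| + `|v| * (`|t0| + `|t1|) + r.
have -> : tube p v r t0 t1 = (`[- l, l] `*` `[t0, t1]) `&`
    ([set z : R * R | 0 <= r + (z.1 - (p + v * z.2))] `&`
     [set z : R * R | 0 <= r - (z.1 - (p + v * z.2))]).
  apply/seteqP; split=> -[x t]; rewrite /tube/= !in_itv/=.
    rewrite ler_norml => -[h tt]; split; last by split; lra.
    split=> //; have h1 : `|v * t| <= `|v| * (`|t0| + `|t1|).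
      rewrite normrM ler_wpM2l// ler_norml.
      by have := ler_norm t1; have := ler_norm (- t0);
        have := normr_ge0 t0; have := normr_ge0 t1; rewrite normrN; lra.
    have := ler_norm p; have := ler_norm (- p); rewrite normrN /l.
    by move: h1; rewrite ler_norml; lra.
  by move=> [[_ tt] [h1 h2]]; split=> //; rewrite ler_norml; lra.
have cl (f : R * R -> R) : continuous f -> closed [set z | 0 <= f z].
  move=> cf; apply: (@closed_comp _ _ f _ _ (@closed_ge R 0)) => z _; exact: cf.
apply: compact_closedI; first by apply: compact_setX; exact: segment_compact.
by apply: closedI; apply: cl => z; [apply: cvgD|apply: cvgB];
  (exact: cvg_cst || exact: continuous_affine).
Qed.

Lemma past_interior_tube p v r t0 t1 x t :
  `|x - (p + v * t)| < r -> t0 < t <= t1 -> past_interior (tube p v r t0 t1) x t.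
Proof.
move=> xr tt; set xi := x - (p + v * t) in xr.
have v0 : 0 <= `|v| by [].
pose k := (r - `|xi|) / (1 + `|v|).
have k0 : 0 < k by rewrite divr_gt0//; lra.
have kv : k + k * `|v| = r - `|xi| by rewrite /k; field; lra.
have kv0 : 0 <= k * `|v| by rewrite mulr_ge0// ltW.
exists (Num.min k (t - t0)); first by rewrite lt_min; lra.
split=> [y|s]; rewrite /tube/=.
  rewrite lt_min => /andP[yk _]; split; last by lra.
  rewrite (_ : _ - _ = (y - x) + xi); last by rewrite /xi; ring.
  by apply: (le_trans (ler_normD _ _)); lra.
rewrite ltrBlDr -ltrBlDl lt_min => /andP[sk st] s2; split; last by lra.
rewrite (_ : _ - _ = v * (t - s) + xi); last by rewrite /xi; ring.
apply: (le_trans (ler_normD _ _)); rewrite normrM mulrC.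
rewrite [`|t - s|]ger0_norm; last by lra.
have : (t - s) * `|v| <= k * `|v| by rewrite ler_wpM2r// ltW.
by lra.
Qed.

Definition tube_barrier p v r K x t : R :=
  expR (- K * t) * ((r ^+ 2 - (x - (p + v * t)) ^+ 2) ^+ 2).

Lemma heat_jet_tube_barrier p v r K x t : let xi := x - (p + v * t) in
  let h := r ^+ 2 - xi ^+ 2 in
  heat_jet (tube_barrier p v r K) x t
    (expR (- K * t) * (4 * v * xi * h - K * h ^+ 2))
    (expR (- K * t) * (8 * xi ^+ 2 - 4 * h)).
Proof.
move=> xi h; split.
  have D1 : is_derive t 1 (fun t : R => x - (p + v * t)) (- v).
    by apply: (is_derive_congr (is_deriveB (is_derive_cst x t 1)
      (is_deriveD (is_derive_cst p t 1) (is_deriveZ v (is_derive_id t 1)))));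
      rewrite /GRing.scale/=; ring.
  have D2 := is_deriveX 2 (is_deriveB (is_derive_cst (r ^+ 2) t 1) (is_deriveX 2 D1)).
  apply: (is_derive_congr (is_deriveM (is_derive_expRM (- K) t) D2)).
  by rewrite /GRing.scale/= !fctE /= /h /xi; ring.
pose E := expR (- K * t); pose X y := y - (p + v * t).
have D1 y : is_derive y 1 X 1.
  by apply: (is_derive_congr (is_deriveB (is_derive_id y 1)
    (is_derive_cst (p + v * t) y 1))); rewrite subr0.
have D2 y := is_deriveB (is_derive_cst (r ^+ 2) y 1) (is_deriveX 2 (D1 y)).
exists (fun y => E * (- 4 * X y * (r ^+ 2 - X y ^+ 2))); split=> [y|].
  apply: (is_derive_congr (is_deriveZ E (is_deriveX 2 (D2 y)))).
  by rewrite /GRing.scale/= !fctE /=; ring.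
have D3 : is_derive x 1 (fun y => - 4 * X y) (- 4).
  by apply: (is_derive_congr (is_deriveZ (- 4) (D1 x))); rewrite /GRing.scale/= mulr1.
apply: (is_derive_congr (is_deriveZ E (is_deriveM D3 (D2 x)))).
by rewrite /GRing.scale/= !fctE /h /xi /X /E; ring.
Qed.

(** With [K] large the barrier is a subsolution of the equation with an
    absorption term: where it is small compared with [r ^+ 4] its second
    derivative is positive, and elsewhere the exponential decay wins. *)
Lemma positivity_propagates z x0 x1 r t0 t1 : 0 < r -> t0 < t1 ->
  let v := (x1 - x0) / (t1 - t0) in
  let A := tube (x0 - v * t0) v r t0 t1 in
  {within A, continuous (fun c : R * R => z c.1 c.2)} ->
  (forall x t, A (x, t) -> 0 <= z x t) ->
  (forall x t, A (x, t) -> t0 < t ->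
    exists a b, heat_jet z x t a b /\ - z x t <= a - b) ->
  (forall x, `|x - x0| <= r -> 0 < z x t0) -> 0 < z x1 t1.
Proof.
move=> r0 t01 v A cz z0 jz zt0.
pose p := x0 - v * t0.
have pt0 x : x - (p + v * t0) = x - x0 by rewrite /p; ring.
have r20 : 0 < r ^+ 2 by rewrite exprn_gt0.
have [m m0 hm] : exists2 m : R, 0 < m & forall x, `|x - x0| <= r -> m <= z x t0.
  have [||c] := @EVT_min _ (fun x => z x t0) (x0 - r) (x0 + r).
  - lra.
  - apply: (within_precomp_continuous (phi := fun x => (x, t0)) _ _ cz).
      by apply: continuous_pair => y; [exact: cvg_id|exact: cvg_cst].
    move=> x; rewrite /= in_itv/= => hx; rewrite /A /tube/=; split; last by lra.
    by rewrite -/p pt0 ler_norml; lra.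
  - rewrite in_itv/= => hc hmin; exists (z c t0).
      by apply: zt0; rewrite ler_norml; lra.
    by move=> x; rewrite ler_norml => hx; apply: hmin; rewrite in_itv/=; lra.
(* [B] bounds the first order terms in [h], and [K] is chosen to make the
   quadratic polynomial [hK] in [h] a square *)
pose B := 12 + 4 * (r * `|v|).
pose K := 1 + B ^+ 2 / (32 * r ^+ 2).
have hK h : (K - 1) * h ^+ 2 - B * h + 8 * r ^+ 2 = (B * h - 16 * r ^+ 2) ^+ 2 / (32 * r ^+ 2).
  by rewrite /K; field; lra.
pose eps := m / (r ^+ 4 * expR (- K * t0)).
have E0 t : 0 < expR (- K * t) by exact: expR_gt0.
have r40 : 0 < r ^+ 4 by rewrite exprn_gt0.
have e0 : 0 < eps by rewrite divr_gt0// mulr_gt0.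
have em : eps * (expR (- K * t0) * r ^+ 4) = m.
  by rewrite /eps; field; rewrite !gt_eqF.
pose psi := tube_barrier p v r K.
have hd : 0 <= z x1 t1 - eps * psi x1 t1.
  apply: (@max_principle _ A (fun x t => z x t - eps * psi x t) 1).
  - exact: compact_tube.
  - apply: within_continuousD => //; apply: within_continuousN.
    apply: continuous_subspaceT => y; apply: cvgM; first exact: cvg_cst.
    apply: cvgM; first exact: continuous_expRM_snd.
    have c : {for y, continuous (fun y : R * R => r ^+ 2 - (y.1 - (p + v * y.2)) ^+ 2)}.
      apply: cvgB; first exact: cvg_cst.
      by rewrite expr2; under eq_fun do rewrite expr2; apply: cvgM; exact: continuous_affine.
    by rewrite expr2; under eq_fun do rewrite expr2; apply: cvgM; exact: c.
  - move=> x t Axt dneg; have [xr tt] := Axt; rewrite /= -/p in xr tt.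
    have zx := z0 _ _ Axt.
    set xi := x - (p + v * t) in xr.
    pose h := r ^+ 2 - xi ^+ 2.
    have psiE : psi x t = expR (- K * t) * h ^+ 2 by [].
    have xr' : `|xi| < r.
      rewrite lt_neqAle xr andbT; apply/eqP => xir; move: dneg.
      by rewrite psiE /h -xir real_normK ?num_real// subrr expr0n/= !mulr0; lra.
    have h0 : 0 < h by rewrite /h subr_gt0 -[xi ^+ 2]real_normK ?num_real// ltr_pXn2r// nnegrE ltW.
    have t0t : t0 < t <= t1.
      suff : t0 != t by rewrite lt_neqAle => ->.
      apply/eqP => e; subst t; move: dneg; rewrite psiE.
      have zm : m <= z x t0 by apply: hm; rewrite -pt0.
      have : eps * (expR (- K * t0) * h ^+ 2) <= m.
        rewrite -em ler_pM2l// ler_pM2l// (_ : r ^+ 4 = (r ^+ 2) ^+ 2); last by rewrite -exprM.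
        rewrite ler_pXn2r// ?nnegrE; [|exact: ltW|exact: ltW].
        by rewrite /h; have := sqr_ge0 xi; lra.
      by lra.
    split; first exact: past_interior_tube.
    have /andP[t0t' _] := t0t.
    have [a [b [J hab]]] := jz _ _ Axt t0t'.
    have J' := heat_jetB J (heat_jetZ eps (heat_jet_tube_barrier p v r K x t)).
    do 2 eexists; split; first exact: J'.
    rewrite -/xi -/h.
    have le : 4 * v * xi * h - K * h ^+ 2 - (8 * xi ^+ 2 - 4 * h) <= - h ^+ 2.
      have := hK h; have : 0 <= (B * h - 16 * r ^+ 2) ^+ 2 / (32 * r ^+ 2).
        by rewrite divr_ge0 ?sqr_ge0// ltW// mulr_gt0.
      have : v * xi * h <= r * `|v| * h.
        rewrite ler_pM2r//; apply: (le_trans (ler_norm _)); rewrite normrM mulrC.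
        by rewrite ler_wpM2r.
      rewrite /B (_ : xi ^+ 2 = r ^+ 2 - h); last by rewrite /h; ring.
      by lra.
    have : eps * (expR (- K * t) * (4 * v * xi * h - K * h ^+ 2 - (8 * xi ^+ 2 - 4 * h)))
        <= eps * (expR (- K * t) * - h ^+ 2) by rewrite ler_pM2l// ler_pM2l.
    by move: dneg; rewrite psiE; lra.
  - rewrite /A /tube/=; split; last by lra.
    rewrite (_ : x1 - _ = 0) ?normr0 ?ltW//.
    by rewrite /v; field; lra.
apply: (@lt_le_trans _ _ (eps * psi x1 t1)); last by rewrite -subr_ge0.
have -> : psi x1 t1 = expR (- K * t1) * (r ^+ 2 - 0 ^+ 2) ^+ 2.
  congr (_ * (_ - _ ^+ 2) ^+ 2); rewrite /p /v; field; lra.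
by rewrite expr0n/= subr0 mulr_gt0// mulr_gt0// exprn_gt0.
Qed.

End Tube.

(** * Uniqueness of a sign change *)

Section GaussTails.
Context {R : realType}.
Implicit Types (d w : R -> R -> R) (x y t s a b p q r v C M K k eps l : R).

(** Up to a power of the time, the heat kernel for [k = 1 / 4]; away from its
    centre it vanishes continuously at the initial time. *)
Definition gauss_tail k y x s : R :=
  if s <= 0 then 0 else expR (- (k / s) * (x - y) ^+ 2).

Lemma gauss_tail_gt0E k y x s : 0 < s ->
  gauss_tail k y x s = expR (- (k / s) * (x - y) ^+ 2).
Proof. by rewrite /gauss_tail leNgt => ->. Qed.

Lemma gauss_tail_ge0 k y x s : 0 <= gauss_tail k y x s.
Proof. by rewrite /gauss_tail; case: ifP => // _; rewrite expR_ge0. Qed.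

Lemma gauss_tail_le1 k y x s : 0 <= k -> gauss_tail k y x s <= 1.
Proof.
move=> k0; rewrite /gauss_tail; case: (leP s 0) => // s0.
rewrite -expR0 ler_expR mulNr oppr_le0 mulr_ge0 ?sqr_ge0 ?divr_ge0 ?(ltW s0)//.
Qed.

Lemma sqr_dist_ge1 x y : 1 <= `|x - y| -> 1 <= (x - y) ^+ 2.
Proof. by move=> h; rewrite -[_ ^+ 2]real_normK ?num_real// expr_ge1. Qed.

Lemma gauss_tail_le_time k y x s : 0 < k -> 1 <= `|x - y| -> 0 <= s ->
  gauss_tail k y x s <= s / k.
Proof.
move=> k0 xy s0; rewrite /gauss_tail; case: (leP s 0) => s1; first by rewrite divr_ge0// ltW.
have ks : 0 < k / s by rewrite divr_gt0.
apply: (@le_trans _ _ (expR (- (k / s)))).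
  by rewrite ler_expR !mulNr lerN2 ler_peMr ?(ltW ks)// sqr_dist_ge1.
rewrite expRN -[leRHS]invf_div lef_pV2 ?posrE ?expR_gt0//.
by apply: le_trans (expR_ge1Dx _); lra.
Qed.

Lemma gauss_tail_anti k l y x s : k <= l -> gauss_tail l y x s <= gauss_tail k y x s.
Proof.
move=> kl; rewrite /gauss_tail; case: (leP s 0) => // s0.
by rewrite ler_expR !mulNr lerN2 ler_wpM2r ?sqr_ge0// ler_pM2r ?invr_gt0.
Qed.

Lemma heat_jet_gauss_tail k y x s : 0 < s ->
  heat_jet (gauss_tail k y) x s
   (gauss_tail k y x s * (k * (x - y) ^+ 2 / s ^+ 2))
   (gauss_tail k y x s * (4 * k ^+ 2 * (x - y) ^+ 2 / s ^+ 2 - 2 * k / s)).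
Proof.
move=> s0; split.
  apply: (@near_eq_is_derive _ _ _ (fun s => expR (- (k / s) * (x - y) ^+ 2))).
    near=> r; rewrite gauss_tail_gt0E//.
    by near: r; exact: lt_nbhsr.
  have h1 : is_derive s 1 (fun s : R => s^-1) (- s ^- 2).
    apply: (is_derive_congr (is_deriveV _ (is_derive_id s 1))).
      by rewrite gt_eqF.
    by rewrite /GRing.scale/= mulr1.
  have h2 : is_derive s 1 (fun s : R => - (k / s) * (x - y) ^+ 2) (k * (x - y) ^+ 2 / s ^+ 2).
    have -> : (fun s : R => - (k / s) * (x - y) ^+ 2) = (fun s => (- k * (x - y) ^+ 2) * s^-1).
      by apply/funext => r; ring.
    by apply: (is_derive_congr (is_deriveZ (- k * (x - y) ^+ 2) h1)); rewrite /GRing.scale/=; ring.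
  apply: (is_derive_congr (@is_derive1_comp R expR _ s _ _ (is_derive_expR _) h2)).
  by rewrite gauss_tail_gt0E.
pose X z := z - y.
have D1 (z : R) : is_derive z 1 X 1.
  by apply: (is_derive_congr (is_deriveB (is_derive_id z 1)
    (is_derive_cst y z 1))); rewrite subr0.
have D2 (z : R) : is_derive z 1 (fun z => - (k / s) * X z ^+ 2) (- (2 * k / s) * X z).
  apply: (is_derive_congr (is_deriveZ (- (k / s)) (is_deriveX 2 (D1 z)))).
  by rewrite /GRing.scale/=; ring.
have D3 (z : R) : is_derive z 1 (gauss_tail k y ^~ s) (- (2 * k / s) * X z * gauss_tail k y z s).
  have -> : gauss_tail k y ^~ s = (fun z => expR (- (k / s) * X z ^+ 2)).
    by apply/funext => r; rewrite gauss_tail_gt0E.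
  apply: (is_derive_congr (@is_derive1_comp R expR _ z _ _ (is_derive_expR _) (D2 z))).
  by rewrite gauss_tail_gt0E// mulrC.
exists (fun z => (- (2 * k / s) * X z) * gauss_tail k y z s); split=> //.
have D4 : is_derive x 1 (fun z => - (2 * k / s) * X z) (- (2 * k / s)).
  by apply: (is_derive_congr (is_deriveZ (- (2 * k / s)) (D1 x))); rewrite /GRing.scale/= mulr1.
apply: (is_derive_congr (is_deriveM D4 (D3 x))).
by rewrite /GRing.scale/= /X; field; lra.
Unshelve. all: by end_near. Qed.

Lemma within_continuous_gauss_tail k y p q t0 t1 : 0 < k ->
  (forall x, p <= x <= q -> 1 <= `|x - y|) ->
  {within `[p, q] `*` `[t0, t1], continuous (fun z => gauss_tail k y z.1 (z.2 - t0))}.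
Proof.
move=> k0 hx; apply/subspace_continuousP => -[x t] [] /=.
rewrite !in_itv/= => xpq tt.
have [tt0|tt0] := leP t t0; last first.
  apply: cvg_within_filter.
  have c : {for (x, t), continuous
      (fun z : R * R => expR (- (k / (z.2 - t0)) * (z.1 - y) ^+ 2))}.
    have ct : {for (x, t), continuous (fun z : R * R => z.2 - t0)}.
      by apply: cvgB; [exact: cvg_snd|exact: cvg_cst].
    have cx : {for (x, t), continuous (fun z : R * R => z.1 - y)}.
      by apply: cvgB; [exact: cvg_fst|exact: cvg_cst].
    apply: (continuous_comp (f := fun z : R * R => - (k / (z.2 - t0)) * (z.1 - y) ^+ 2)).
      apply: cvgM; last by rewrite expr2; under eq_fun do rewrite expr2; exact: cvgM.
      apply: cvgN; apply: cvgM; first exact: cvg_cst.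
      by apply: cvgV => //=; rewrite gt_eqF// subr_gt0.
    exact: continuous_expR.
  have E : expR (- (k / ((x, t).2 - t0)) * ((x, t).1 - y) ^+ 2) =
      gauss_tail k y (x, t).1 ((x, t).2 - t0) by rewrite gauss_tail_gt0E// subr_gt0.
  move: c; rewrite /prop_for/continuous_at E => c; apply: cvg_trans c; apply: near_eq_cvg; near=> z.
  rewrite /from_subspace gauss_tail_gt0E// subr_gt0.
  near: z; have : \forall s \near t, t0 < s by exact: lt_nbhsr.
  by move/(cvg_snd (FF := nbhs_filter x)).
have {}tt0 : t = t0 by apply/eqP; rewrite eq_le tt0; lra.
subst t; have E0 : gauss_tail k y x (t0 - t0) = 0 by rewrite /gauss_tail subrr lexx.
apply/cvgrPdist_lt => e e0; rewrite near_withinE.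
have ek : 0 < e * k by rewrite mulr_gt0.
have : \forall s \near t0, `|s - t0| < e * k.
  by exists (e * k) => //= s; rewrite distrC.
move=> /(cvg_snd (FF := nbhs_filter x)) H.
near=> z => -[]; rewrite /= !in_itv/= => zx zt.
rewrite /from_subspace/= E0 sub0r normrN ger0_norm ?gauss_tail_ge0//.
apply: (le_lt_trans (gauss_tail_le_time k0 (hx _ zx) _)); first by lra.
rewrite ltr_pdivrMr//; apply: (le_lt_trans (ler_norm _)).
by near: z; exact: H.
Unshelve. all: by end_near. Qed.

Lemma heat_jet_delay d x t T a b : heat_jet d x (t - T) a b ->
  heat_jet (fun x t => d x (t - T)) x t a b.
Proof.
move=> [h j]; split=> //.
have h2 : is_derive t 1 (fun s : R => s - T) 1.
  by apply: (is_derive_congr (is_deriveB (is_derive_id t 1) (is_derive_cst T t 1))); rewrite subr0.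
by have := @is_derive1_comp R (d x) (fun s => s - T) t _ _ h h2; rewrite mulr1.
Qed.

(** The missing power of the time is worth [2 * k / s], which for small [s] is
    less than the gain [(4 * k - 1) * k * (x - y) ^+ 2 / s ^+ 2] due to a narrower
    profile than that of the heat kernel. *)
Lemma gauss_tail_subcaloric k y x s : 1 / 4 < k -> k <= 1 / 2 ->
  0 < s -> s <= (k - 1 / 4) / 2 -> 1 <= `|x - y| ->
  exists a b, heat_jet (gauss_tail k y) x s a b /\ a - b <= - gauss_tail k y x s.
Proof.
move=> k1 k2 s0 sk xy; do 2 eexists; split; first exact: heat_jet_gauss_tail.
rewrite -mulrBr -[leRHS]mulr1 mulNr -mulrN.
apply: ler_wpM2l; first exact: gauss_tail_ge0.
have X1 := sqr_dist_ge1 xy; set X := (x - y) ^+ 2 in X1 *.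
have -> : k * X / s ^+ 2 - (4 * k ^+ 2 * X / s ^+ 2 - 2 * k / s) =
   (2 * k * s - (4 * k - 1) * k * X) / s ^+ 2 by field; lra.
rewrite ler_pdivrMr ?exprn_gt0//.
have : (4 * k - 1) * k * 1 <= (4 * k - 1) * k * X.
  by rewrite ler_wpM2l// mulr_ge0; lra.
have : s * s <= s * 1 by rewrite ler_pM2l//; lra.
have : 2 * k * s <= 1 * s by rewrite ler_pM2r//; lra.
have : (4 * k - 1) * (1 / 4) <= (4 * k - 1) * k by rewrite ler_wpM2l//; lra.
by rewrite expr2; lra.
Qed.

Lemma gauss_tail_supercaloric y x s : 0 < s -> s <= 1 / 2 ->
  exists a b, heat_jet (gauss_tail (1 / 4) y) x s a b /\
    gauss_tail (1 / 4) y x s <= a - b.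
Proof.
move=> s0 s2; do 2 eexists; split; first exact: heat_jet_gauss_tail.
rewrite -mulrBr -[leLHS]mulr1.
apply: ler_wpM2l; first exact: gauss_tail_ge0.
have -> : 1 / 4 * (x - y) ^+ 2 / s ^+ 2 -
  (4 * (1 / 4) ^+ 2 * (x - y) ^+ 2 / s ^+ 2 - 2 * (1 / 4) / s) = (1 / 2) / s by field; lra.
by rewrite ler_pdivlMr//; lra.
Qed.

(** Of the two functions that are compared, one is [w] plus a subsolution minus
    a supersolution, the other is [w] plus a supersolution minus a subsolution;
    they are ordered because the parameter [1 / 4] gives the larger tail. *)
Lemma perturbed_sign_pattern w k l1 l2 y2 y1 T t1 :
  1 / 4 < k -> k <= 1 / 2 -> T <= t1 -> t1 - T <= (k - 1 / 4) / 2 -> 0 < l1 -> 0 < l2 ->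
  {within `[y2, y1] `*` `[T, t1], continuous (fun z => w z.1 z.2)} ->
  (forall x t, T < t <= t1 -> almost_caloric w x t) ->
  (forall t, T <= t <= t1 -> w y2 t <= - (l1 + l2) /\ l1 + l2 <= w y1 t) ->
  (forall a b, a <= b -> 0 < w a T -> 0 <= w b T) ->
  forall p q, y2 <= p -> p <= q -> q <= y1 ->
  0 < w p t1 + l2 * gauss_tail k (y2 - 1) p (t1 - T) -
      l1 * gauss_tail (1 / 4) (y1 + 1) p (t1 - T) ->
  0 <= w q t1 + l2 * gauss_tail (1 / 4) (y2 - 1) q (t1 - T) -
      l1 * gauss_tail k (y1 + 1) q (t1 - T).
Proof.
move=> k14 k12 Tt1 tk l10 l20 cw jw hm pattern p q y2p pq qy1.
pose gs c x t := gauss_tail k c x (t - T).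
pose gp c x t := gauss_tail (1 / 4) c x (t - T).
set y := y2 - 1; set y' := y1 + 1.
pose W1 x t := w x t + l2 * gs y x t - l1 * gp y' x t.
pose W2 x t := w x t + l2 * gp y x t - l1 * gs y' x t.
have gsp c x t : gs c x t <= gp c x t by apply: gauss_tail_anti; lra.
have gs0 c x t : 0 <= gs c x t by exact: gauss_tail_ge0.
have gp0 c x t : 0 <= gp c x t by exact: gauss_tail_ge0.
have gs1 c x t : gs c x t <= 1 by apply: gauss_tail_le1; lra.
have gp1 c x t : gp c x t <= 1 by apply: gauss_tail_le1; lra.
have far x : y2 <= x <= y1 -> 1 <= `|x - y|.
  by move=> hx; rewrite ger0_norm /y; lra.
have far' x : y2 <= x <= y1 -> 1 <= `|x - y'|.
  by move=> hx; rewrite ler0_norm /y'; lra.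
have cgs c : (forall x, y2 <= x <= y1 -> 1 <= `|x - c|) ->
    {within `[y2, y1] `*` `[T, t1], continuous (fun z => gs c z.1 z.2)}.
  by apply: within_continuous_gauss_tail; lra.
have cgp c : (forall x, y2 <= x <= y1 -> 1 <= `|x - c|) ->
    {within `[y2, y1] `*` `[T, t1], continuous (fun z => gp c z.1 z.2)}.
  by apply: within_continuous_gauss_tail; lra.
have cZ (l0 : R) g : {within `[y2, y1] `*` `[T, t1], continuous (fun z => g z.1 z.2)} ->
    {within `[y2, y1] `*` `[T, t1], continuous (fun z => l0 * g z.1 z.2)}.
  by move=> cg; apply: within_continuousM => // z; exact: cst_continuous.
have jsub c x t : T < t <= t1 -> 1 <= `|x - c| ->
    exists a b, heat_jet (gs c) x t a b /\ a - b <= - gs c x t.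
  move=> tT xc; have tT0 : 0 < t - T by lra.
  have sk : t - T <= (k - 1 / 4) / 2 by lra.
  have [a [b [J h]]] := gauss_tail_subcaloric k14 k12 tT0 sk xc.
  by exists a, b; split=> //; exact: heat_jet_delay.
have jsup c x t : T < t <= t1 ->
    exists a b, heat_jet (gp c) x t a b /\ gp c x t <= a - b.
  move=> tT; have tT0 : 0 < t - T by lra.
  have sh : t - T <= 1 / 2 by lra.
  have [a [b [J h]]] := gauss_tail_supercaloric c x tT0 sh.
  by exists a, b; split=> //; exact: heat_jet_delay.
have le1 (l0 g : R) : 0 < l0 -> 0 <= g -> g <= 1 -> 0 <= l0 * g <= l0.
  by move=> h0 h1 h2; rewrite mulr_ge0 ?(ltW h0)//= ler_piMr// ltW.
have sub0 c x : gs c x T = 0 by rewrite /gs /gauss_tail subrr lexx.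
have sup0 c x : gp c x T = 0 by rewrite /gp /gauss_tail subrr lexx.
change (0 < W1 p t1 -> 0 <= W2 q t1).
clearbody gs gp.
apply: (@two_point_principle _ y2 y1 T t1 2 W1 W2 _ _ _ _ _ _ _ _ t1 p q).
- apply: within_continuousD; last by apply: within_continuousN; exact/cZ/cgp.
  by apply: within_continuousD => //; exact/cZ/cgs.
- apply: within_continuousD; last by apply: within_continuousN; exact/cZ/cgs.
  by apply: within_continuousD => //; exact/cZ/cgp.
- move=> x t _ _; rewrite /W1 /W2.
  have : l2 * gs y x t <= l2 * gp y x t by rewrite ler_pM2l.
  have : l1 * gs y' x t <= l1 * gp y' x t by rewrite ler_pM2l.
  by lra.
- move=> x t hx ht; rewrite /W1 => W0.
  have [a1 [b1 [J1 h1]]] := jw x t ht.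
  have fx : 1 <= `|x - y| by apply: far; clear -hx; lra.
  have [a2 [b2 [J2 h2]]] := jsub y x t ht fx.
  have [a3 [b3 [J3 h3]]] := jsup y' x t ht.
  clear - J1 J2 J3 h1 h2 h3 W0 le1 l20 l10 gs0 gs1 gp0 gp1.
  have J := heat_jetB (heat_jetD J1 (heat_jetZ l2 J2)) (heat_jetZ l1 J3).
  do 2 eexists; split; first exact: J.
  have : l2 * (a2 - b2) <= l2 * - gs y x t by rewrite ler_pM2l.
  have : l1 * gp y' x t <= l1 * (a3 - b3) by rewrite ler_pM2l.
  have := le1 _ _ l20 (gs0 y x t) (gs1 y x t); have := le1 _ _ l10 (gp0 y' x t) (gp1 y' x t).
  by move: h1; rewrite ler_norml; have [] := ger0P (w x t); lra.
- move=> x t hx ht; rewrite /W2 => W0.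
  have [a1 [b1 [J1 h1]]] := jw x t ht.
  have fx : 1 <= `|x - y'| by apply: far'; clear -hx; lra.
  have [a2 [b2 [J2 h2]]] := jsub y' x t ht fx.
  have [a3 [b3 [J3 h3]]] := jsup y x t ht.
  clear - J1 J2 J3 h1 h2 h3 W0 le1 l20 l10 gs0 gs1 gp0 gp1.
  have J := heat_jetB (heat_jetD J1 (heat_jetZ l2 J3)) (heat_jetZ l1 J2).
  do 2 eexists; split; first exact: J.
  have : l1 * (a2 - b2) <= l1 * - gs y' x t by rewrite ler_pM2l.
  have : l2 * gp y x t <= l2 * (a3 - b3) by rewrite ler_pM2l.
  have := le1 _ _ l20 (gp0 y x t) (gp1 y x t); have := le1 _ _ l10 (gs0 y' x t) (gs1 y' x t).
  by move: h1; rewrite ler_norml; have [] := ger0P (w x t); lra.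
- move=> t ht; have [h1 _] := hm t ht; rewrite /W1.
  have := le1 _ _ l20 (gs0 y y2 t) (gs1 y y2 t); have := le1 _ _ l10 (gp0 y' y2 t) (gp1 y' y2 t).
  by lra.
- move=> t ht; have [_ h1] := hm t ht; rewrite /W2.
  have := le1 _ _ l20 (gp0 y y1 t) (gp1 y y1 t); have := le1 _ _ l10 (gs0 y' y1 t) (gs1 y' y1 t).
  by lra.
- move=> a b _ ab _; rewrite /W1 /W2 !sub0 !sup0 !mulr0 !addr0 !subr0.
  by exact: pattern.
- by lra.
- by lra.
- by lra.
- by lra.
Qed.

(** If [w] were nonnegative at [p] and nonpositive at [q], then pushing it up by
    a tail coming from the left and down by one coming from the right would make
    it positive at [p] and negative at [q]: after a short time the left tail is
    much larger at [p] than at [q] in comparison with the right one.  Yet the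
    perturbed functions start with the sign pattern of [w]. *)
Lemma sign_change_at_one_point w y2 p q y1 s0 t1 :
  y2 < p -> p < q -> q < y1 -> s0 < t1 ->
  {within `[y2, y1] `*` `[s0, t1], continuous (fun z => w z.1 z.2)} ->
  (forall x t, s0 < t <= t1 -> almost_caloric w x t) ->
  (forall t, s0 <= t <= t1 -> w y2 t < 0 < w y1 t) ->
  (forall t a b, s0 <= t <= t1 -> a <= b -> 0 < w a t -> 0 <= w b t) ->
  0 <= w p t1 -> w q t1 <= 0 -> False.
Proof.
move=> y2p pq qy1 s01 cw jw hy pattern wp wq.
have slice z : y2 <= z <= y1 -> {within `[s0, t1], continuous (w z)}.
  move=> hz; apply: (within_precomp_continuous (phi := fun t : R => (z, t)) _ _ cw).
    by apply: continuous_pair => r; [exact: cvg_cst|exact: cvg_id].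
  by move=> t; rewrite /= !in_itv/=.
have [m m0 hm] : exists2 m : R, 0 < m &
    forall t, s0 <= t <= t1 -> w y2 t <= - m /\ m <= w y1 t.
  have y2in : y2 <= y2 <= y1 by lra.
  have y1in : y2 <= y1 <= y1 by lra.
  have [c1] := EVT_max (ltW s01) (slice y2 y2in); rewrite in_itv/= => hc1 max1.
  have [c2] := EVT_min (ltW s01) (slice y1 y1in); rewrite in_itv/= => hc2 min2.
  have h1 := hy _ hc1; have h2 := hy _ hc2.
  exists (Num.min (- w y2 c1) (w y1 c2)); first by rewrite lt_min; lra.
  move=> t ht; have := max1 t; have := min2 t; rewrite in_itv/= => /(_ ht) k2 /(_ ht) k1.
  have u1 : Num.min (- w y2 c1) (w y1 c2) <= - w y2 c1 by rewrite ge_min lexx.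
  have u2 : Num.min (- w y2 c1) (w y1 c2) <= w y1 c2 by rewrite ge_min lexx orbT.
  by lra.
pose y := y2 - 1; pose y' := y1 + 1.
pose S := (q - y') ^+ 2 + (p - y) ^+ 2; pose D := (q - p) * (y' - y).
have D0 : 0 < D by rewrite mulr_gt0// /y /y'; lra.
have S0 : 0 < S by rewrite addr_gt0// exprn_even_gt0//= /y /y' ?subr_eq0 ?subr_gt0; lra.
(* the exponents of the tails compare strictly for [k = 1 / 4], with gap [D / 2];
   [eta] is so small that they still do for [k = 1 / 4 + eta] *)
pose eta := Num.min (1 / 4) (D / (4 * S)).
have eta0 : 0 < eta.
  by rewrite lt_min; apply/andP; split; [lra|rewrite divr_gt0// mulr_gt0].
have S8 : 4 * S != 0 by rewrite mulf_neq0// gt_eqF.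
have eta4 : eta <= 1 / 4 by rewrite ge_min lexx.
have etaS : eta * S <= D / 4.
  have -> : D / 4 = D / (4 * S) * S by field; lra.
  by rewrite ler_pM2r// ge_min lexx orbT.
pose k := 1 / 4 + eta.
have k14 : 1 / 4 < k by rewrite /k; lra.
have k12 : k <= 1 / 2 by rewrite /k; lra.
pose lo := k * (q - y') ^+ 2 - 1 / 4 * (q - y) ^+ 2.
pose hi := 1 / 4 * (p - y') ^+ 2 - k * (p - y) ^+ 2.
have lohi : hi - lo = D / 2 - eta * S by rewrite /hi /lo /D /S /k; field.
(* the ratio [l1 / l2] of the two perturbations lies strictly between the ratios
   of the left tail to the right one at [q] and at [p] *)
pose theta := (lo + hi) / 2.
have th1 : lo < theta by rewrite /theta; lra.
have th2 : theta < hi by rewrite /theta; lra.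
pose tau := Num.min (t1 - s0) (eta / 2).
have tau0 : 0 < tau by rewrite lt_min; lra.
have tau1 : tau <= t1 - s0 by rewrite ge_min lexx.
have tau2 : tau <= eta / 2 by rewrite ge_min lexx orbT.
pose T := t1 - tau.
pose E := expR (theta / tau).
have E0 : 0 < E by exact: expR_gt0.
pose l2 := m / (1 + E); pose l1 := l2 * E.
have l20 : 0 < l2 by rewrite divr_gt0// addr_gt0.
have l10 : 0 < l1 by rewrite mulr_gt0.
have l12 : l1 + l2 = m by rewrite /l1 /l2; clear -E0; field; lra.
have Wp : 0 < w p t1 + l2 * gauss_tail k y p (t1 - T) - l1 * gauss_tail (1 / 4) y' p (t1 - T).
  have : 0 < l2 * (gauss_tail k y p (t1 - T) - E * gauss_tail (1 / 4) y' p (t1 - T)).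
    rewrite mulr_gt0// subr_gt0 /E.
    have -> : t1 - T = tau by rewrite /T; ring.
    rewrite !gauss_tail_gt0E// -expRD ltr_expR.
    have -> : theta / tau + - (1 / 4 / tau) * (p - y') ^+ 2 =
      (theta - 1 / 4 * (p - y') ^+ 2) / tau by clear -tau0; field; lra.
    have -> : - (k / tau) * (p - y) ^+ 2 = (- (k * (p - y) ^+ 2)) / tau by clear -tau0; field; lra.
    by rewrite ltr_pM2r ?invr_gt0//; clear -th2; rewrite /hi in th2; lra.
  by move: wp; clear; rewrite /l1; lra.
have Wq : w q t1 + l2 * gauss_tail (1 / 4) y q (t1 - T) - l1 * gauss_tail k y' q (t1 - T) < 0.
  have : l2 * (gauss_tail (1 / 4) y q (t1 - T) - E * gauss_tail k y' q (t1 - T)) < 0.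
    rewrite pmulr_rlt0// subr_lt0 /E.
    have -> : t1 - T = tau by rewrite /T; ring.
    rewrite !gauss_tail_gt0E// -expRD ltr_expR.
    have -> : theta / tau + - (k / tau) * (q - y') ^+ 2 =
      (theta - k * (q - y') ^+ 2) / tau by clear -tau0; field; lra.
    have -> : - (1 / 4 / tau) * (q - y) ^+ 2 = (- (1 / 4 * (q - y) ^+ 2)) / tau by clear -tau0; field; lra.
    by rewrite ltr_pM2r ?invr_gt0//; clear -th1; rewrite /lo in th1; lra.
  by move: wq; clear; rewrite /l1; lra.
move: Wq; apply/negP; rewrite -leNgt.
have sT t : T <= t <= t1 -> s0 <= t <= t1 by clear -tau1; rewrite /T; lra.
apply: (perturbed_sign_pattern _ _ _ _ _ _ _ _ _ _ _ _ _ Wp) => //.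
- by rewrite /T; lra.
- by rewrite /T /k; lra.
- apply: continuous_subspaceW cw => -[x t]; rewrite /= !in_itv/= => -[h1 h2].
  by split=> //; exact: sT.
- by move=> x t ht; apply: jw; move: ht; clear -tau1; rewrite /T; lra.
- by move=> t ht; rewrite l12; apply: hm; exact: sT.
- by move=> a b; apply: pattern; apply: sT; rewrite /T; lra.
- exact: ltW.
- exact: ltW.
- exact: ltW.
Qed.

End GaussTails.

(** * Shape of the slices of a solution *)

Section Flow.
Context {R : realType}.
Implicit Types (g : R -> R -> R) (x y t s a b c p q r v M K k eps l delta : R).

Definition odd_level (c : R) : Prop := exists k : int, c = (2 * k + 1)%:~R * pi.

Lemma continuous_near_lt g x t c :
  {for (x, t), continuous (fun z : R * R => g z.1 z.2)} -> g x t < c ->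
  exists2 r : R, 0 < r & forall y s, `|y - x| < r -> `|s - t| < r -> g y s < c.
Proof.
move=> cg gc; have e0 : 0 < c - g x t by rewrite subr_gt0.
have /cvgrPdist_lt/(_ _ e0) [[A B] /= [[r1 /= r10 h1] [r2 /= r20 h2]] AB] := cg.
exists (Num.min r1 r2); first by rewrite lt_min r10.
move=> y s; rewrite !lt_min => /andP[yr _] /andP[_ sr].
have := AB (y, s); rewrite /= distrC ltr_norml => /(_ _)/wrap[|]; last by lra.
by split; [apply: h1; rewrite /= distrC|apply: h2; rewrite /= distrC].
Qed.

Lemma continuous_near_gt g x t c :
  {for (x, t), continuous (fun z : R * R => g z.1 z.2)} -> c < g x t ->
  exists2 r : R, 0 < r & forall y s, `|y - x| < r -> `|s - t| < r -> c < g y s.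
Proof.
move=> cg gc; have [||r r0 h] := @continuous_near_lt (fun x t => - g x t) x t (- c).
- exact: continuousN.
- by rewrite ltrN2.
- by exists r => // y s yr sr; have := h y s yr sr; rewrite ltrN2.
Qed.

Lemma derive_lt0_decreases (h : R -> R) t a : is_derive t 1 h a -> a < 0 ->
  exists2 r : R, 0 < r & (forall s, t < s -> s < t + r -> h s < h t) /\
                         (forall s, t - r < s -> s < t -> h t < h s).
Proof.
move=> hd a0; have aN : 0 < - a by lra.
have [r r0 [h1 h2]] := derive_gt0_increases (is_deriveN hd) aN.
by exists r => //; split=> s s1 s2;
  [have := h1 s s1 s2|have := h2 s s1 s2]; rewrite !fctE ltrN2.
Qed.

(** A solution [u] together with its slope [w].  Of the nonlinearity only the
    Lipschitz bound and its positivity at the odd multiples of [pi] matter here;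
    the equation of the slope is weakened to an inequality. *)
Record flow (C : R) (f : R -> R) (u w : R -> R -> R) : Prop := Flow {
  flow_growth_gt0 : 0 < C ;
  flow_lipschitz : forall a b, `|f a - f b| <= `|a - b| ;
  flow_odd_gt0 : forall c, odd_level c -> 0 < f c ;
  flow_continuous : {within [set z : R * R | 0 <= z.2],
    continuous (fun z => u z.1 z.2)} ;
  flow_growth : forall T : R, exists M : R, forall x t, 0 <= t <= T ->
    `|u x t| <= M * expR (C * `|x|) ;
  flow_slope : forall x t, 0 < t -> is_derive x 1 (u ^~ t) (w x t) ;
  flow_slope_continuous : forall x t, 0 < t ->
    {for (x, t), continuous (fun z : R * R => w z.1 z.2)} ;
  flow_equation : forall x t, 0 < t ->
    exists a b, heat_jet u x t a b /\ a = b + f (u x t) ;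
  flow_slope_caloric : forall x t, 0 < t -> almost_caloric w x t }.

Section Slices.
Variables (C : R) (f : R -> R) (u w : R -> R -> R).
Hypothesis fl : flow C f u w.

Lemma flow_slope_MVT t a b : 0 < t -> a < b ->
  exists2 c : R, a < c < b & u b t - u a t = w c t * (b - a).
Proof.
by move=> t0 ab; apply: (MVT_derive (fun y => flow_slope fl y t0) ab).
Qed.

Lemma flow_rise t a b : 0 < t -> a < b -> u a t < u b t ->
  exists2 c : R, a < c < b & 0 < w c t.
Proof.
move=> t0 ab uab; have [c cab e] := flow_slope_MVT t0 ab; exists c => //.
by rewrite -(@pmulr_lgt0 _ (b - a)) -?e; lra.
Qed.

Lemma flow_fall t a b : 0 < t -> a < b -> u b t < u a t ->
  exists2 c : R, a < c < b & w c t < 0.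
Proof.
move=> t0 ab uab; have [c cab e] := flow_slope_MVT t0 ab; exists c => //.
by rewrite -(@pmulr_llt0 _ (b - a)) -?e; lra.
Qed.

Lemma flow_near x t eps : 0 <= t -> 0 < eps ->
  exists2 r : R, 0 < r & forall y s, 0 <= s -> `|y - x| < r -> `|s - t| < r ->
    `|u y s - u x t| < eps.
Proof.
move=> t0 e0; have /subspace_continuousP/(_ (x, t) t0) cu := flow_continuous fl.
have /cvgrPdist_lt/(_ _ e0) := cu.
rewrite near_withinE => -[[A B] /= [[r1 /= r10 h1] [r2 /= r20 h2]] AB].
exists (Num.min r1 r2); first by rewrite lt_min r10.
move=> y s s0; rewrite !lt_min => /andP[yr _] /andP[_ sr].
have ABs : (A `*` B) (y, s).
  by split; [apply: h1; rewrite /= distrC|apply: h2; rewrite /= distrC].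
by have := AB _ ABs s0; rewrite /from_subspace/= distrC.
Qed.

Lemma flow_near_lt x t c : 0 <= t -> u x t < c ->
  exists2 r : R, 0 < r & forall y s, 0 <= s -> `|y - x| < r -> `|s - t| < r ->
    u y s < c.
Proof.
move=> t0 uc; have e0 : 0 < c - u x t by rewrite subr_gt0.
have [r r0 h] := flow_near x t0 e0; exists r => // y s s0 yr sr.
by have := h y s s0 yr sr; rewrite ltr_norml; lra.
Qed.

Lemma flow_near_gt x t c : 0 <= t -> c < u x t ->
  exists2 r : R, 0 < r & forall y s, 0 <= s -> `|y - x| < r -> `|s - t| < r ->
    c < u y s.
Proof.
move=> t0 uc; have e0 : 0 < u x t - c by rewrite subr_gt0.
have [r r0 h] := flow_near x t0 e0; exists r => // y s s0 yr sr.
by have := h y s s0 yr sr; rewrite ltr_norml; lra.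
Qed.

Lemma strip_sub s t : 0 <= s ->
  [set z : R * R | s <= z.2 <= t] `<=` [set z : R * R | 0 <= z.2].
Proof. by move=> s0 z /= ?; lra. Qed.

(** A solution that lies above an odd level stays there by comparison with the
    constant, and at a contact the source would make it increase, so that it
    would have been below just before. *)
Lemma above_odd_level c s t : 0 <= s -> s < t -> odd_level c ->
  (forall x, c <= u x s) -> forall x, c < u x t.
Proof.
move=> s0 st oc hs; have fc := flow_odd_gt0 fl oc.
have [M hM] := flow_growth fl t.
have ge x r : s <= r <= t -> c <= u x r.
  move=> rst; rewrite -subr_ge0.
  apply: (@comparison_line _ C (M + `|c|) s t (fun x t => u x t - c)) => //.
  - exact: flow_growth_gt0 fl.
  - apply: within_continuousD.
      exact: (continuous_subspaceW (strip_sub s0)) (flow_continuous fl).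
    by move=> z; exact: cst_continuous.
  - move=> y q qst; apply: (le_trans (ler_normB _ _)); rewrite mulrDl lerD//.
      by apply: hM; lra.
    rewrite ler_peMr// -expR0 ler_expR mulr_ge0//.
    exact: ltW (flow_growth_gt0 fl).
  - by move=> y; rewrite subr_ge0.
  - move=> y q /andP[sq qt] neg; have q0 : 0 < q by lra.
    have [a [b [J e]]] := flow_equation fl y q0.
    exists (a - 0), (b - 0); split; first exact: heat_jetB J (heat_jet_cst c y q).
    have := flow_lipschitz fl (u y q) c; rewrite [X in _ <= X]ltr0_norm// ler_norml.
    by lra.
move=> x; rewrite lt_neqAle ge ?andbT; last by lra.
apply/eqP => uc; have t0 : 0 < t by lra.
have [a [b [[ut [ux [hux huxx]]] e]]] := flow_equation fl x t0.
have [|y _|_ b0] := derivative_tests_at_min (r := 1) hux huxx; first by [].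
  by rewrite -uc; apply: ge; lra.
have [|r r0 [_ h]] := derive_gt0_increases ut; first by rewrite e -uc; lra.
pose q := t - Num.min r (t - s) / 2.
have m0 : 0 < Num.min r (t - s) by rewrite lt_min; lra.
have m1 : Num.min r (t - s) <= r by rewrite ge_min lexx.
have m2 : Num.min r (t - s) <= t - s by rewrite ge_min lexx orbT.
have := ge x q; have := h q; rewrite -uc /q => h1 h2.
have : c <= u x q by apply: h2; lra.
by rewrite leNgt => /negP; apply; apply: h1; lra.
Qed.

Hypothesis unimodal0 : exists xs : R,
  (forall x y, x <= y -> y <= xs -> u y 0 <= u x 0) /\
  (forall x y, xs <= x -> x <= y -> u x 0 <= u y 0).

(** Differences of two translates of a solution are almost caloric because
    the nonlinearity is Lipschitz; for a unimodal initial slice their initial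
    sign pattern is immediate. *)
Lemma increment_sign_pattern delta t a b : 0 < delta -> 0 <= t -> a <= b ->
  0 < u (a + delta) t - u a t -> 0 <= u (b + delta) t - u b t.
Proof.
move=> d0 t0 ab; have [M hM] := flow_growth fl t; have C0 := flow_growth_gt0 fl.
have M0 : 0 <= M.
  have h00 : (0 : R) <= 0 <= t by rewrite lexx.
  by have := hM 0 0 h00; rewrite normr0 mulr0 expR0 mulr1; apply: le_trans.
pose d x t := u (x + delta) t - u x t.
apply: (@sign_pattern_line _ C (M * (expR (C * delta) + 1)) 0 t d) => //.
- apply: within_continuousD.
    apply: (within_precomp_continuous (phi := fun z : R * R => (z.1 + delta, z.2)) _ _
      (flow_continuous fl)).
      apply: continuous_pair => z; last exact: cvg_snd.
      by apply: cvgD; [exact: cvg_fst|exact: cvg_cst].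
    by move=> z /= /andP[].
  apply: within_continuousN; exact: (continuous_subspaceW (strip_sub (lexx 0))) (flow_continuous fl).
- move=> x s st; apply: (le_trans (ler_normB _ _)).
  rewrite mulrDr mulr1 mulrDl lerD ?hM//.
  apply: (le_trans (hM _ _ st)); rewrite -mulrA ler_wpM2l// -expRD ler_expR -mulrDr.
  rewrite ler_pM2l//; apply: (le_trans (ler_normD _ _)).
  by rewrite [`|delta|]gtr0_norm; lra.
- move=> x y xy; rewrite /d; have [xs [dec inc]] := unimodal0.
  have [xl|xl] := leP (x + delta) xs.
    by have := dec x (x + delta); lra.
  have [yl|yl] := leP xs y; first by have := inc y (y + delta); lra.
  have k1 : u y 0 <= u x 0 by apply: dec; lra.
  have k2 : u (x + delta) 0 <= u (y + delta) 0 by apply: inc; lra.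
  by lra.
- move=> x s /andP[s0 _].
  have [a1 [b1 [J1 e1]]] := flow_equation fl (x + delta) s0.
  have [a2 [b2 [J2 e2]]] := flow_equation fl x s0.
  exists (a1 - a2), (b1 - b2); split; first exact: heat_jetB (heat_jet_shift J1) J2.
  rewrite (_ : _ - _ = f (u (x + delta) s) - f (u x s)); last by rewrite e1 e2; ring.
  exact: (flow_lipschitz fl).
- by rewrite lexx andbT.
Qed.

(** A slope with the wrong pattern would give increments with the wrong
    pattern. *)
Lemma slope_sign_pattern t a b : 0 < t -> a <= b -> 0 < w a t -> 0 <= w b t.
Proof.
move=> t0 ab wa; rewrite leNgt; apply/negP => wb.
have [r1 r10 [h1 _]] := derive_gt0_increases (flow_slope fl a t0) wa.
have [r2 r20 [h2 _]] := derive_lt0_decreases (flow_slope fl b t0) wb.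
pose delta := Num.min r1 r2 / 2.
have m0 : 0 < Num.min r1 r2 by rewrite lt_min; lra.
have m1 : Num.min r1 r2 <= r1 by rewrite ge_min lexx.
have m2 : Num.min r1 r2 <= r2 by rewrite ge_min lexx orbT.
have d0 : 0 < delta by rewrite /delta; lra.
have k1 : u a t < u (a + delta) t by apply: h1; rewrite /delta; lra.
have k2 : u (b + delta) t < u b t by apply: h2; rewrite /delta; lra.
have := increment_sign_pattern d0 (ltW t0) ab; lra.
Qed.

Lemma slice_quasiconvex t x y q : 0 <= t -> x < y -> y < q ->
  u x t < u y t -> u y t <= u q t.
Proof.
rewrite le_eqVlt => /predU1P[<-|t0] xy yq uxy.
  have [xs [dec inc]] := unimodal0.
  have [yl|yl] := leP y xs; last by apply: inc; lra.
  by have := dec x y; lra.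
rewrite leNgt; apply/negP => uyq.
have [c1 /andP[? ?] w1] := flow_rise t0 xy uxy.
have [c2 /andP[? ?] w2] := flow_fall t0 yq uyq.
by have := @slope_sign_pattern t c1 c2 t0 _ w1; lra.
Qed.

Lemma slice_descends t x y a b : 0 <= t -> x < y -> u y t < u x t ->
  a <= b -> b <= x -> u b t <= u a t.
Proof.
move=> t0 xy uyx; rewrite le_eqVlt => /predU1P[->//|ab] bx.
rewrite leNgt; apply/negP => uab.
have uby : u b t <= u y t by apply: (@slice_quasiconvex t a b y) => //; lra.
have {}bx : b < x.
  by rewrite lt_neqAle bx andbT; apply/eqP => e; rewrite e in uby; lra.
have : u x t <= u y t by apply: (@slice_quasiconvex t b x y) => //; lra.
by lra.
Qed.

End Slices.
End Flow.

(** * Reflection, and strictness at odd levels *)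

Section Reflection.
Context {R : realType}.
Implicit Types (g u w : R -> R -> R) (x y t s a b c p q r M K k eps l delta : R).

(** Reflecting space exchanges kinks and antikinks: only the
    left half of a slice has to be studied. *)
Definition mirror g x t : R := g (- x) t.

Definition left_decided u : Prop := forall c t, odd_level c -> 0 <= t ->
  (exists X : R, forall x, x <= X -> c < u x t) \/
  (exists X : R, forall x, x <= X -> u x t < c).

Definition unimodal (v : R -> R) : Prop := exists xs : R,
  (forall x y, x <= y -> y <= xs -> v y <= v x) /\
  (forall x y, xs <= x -> x <= y -> v x <= v y).

Lemma unimodal_mirror v : unimodal v -> unimodal (fun x => v (- x)).
Proof.
move=> [xs [h1 h2]]; exists (- xs); split=> x y xy ys.
  by apply: h2; lra.
by apply: h1; lra.
Qed.

Lemma flow_mirror C f u w :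
  flow C f u w -> flow C f (mirror u) (fun x t => - w (- x) t).
Proof.
move=> fl.
have cN : continuous (fun z : R * R => (- z.1, z.2)).
  apply: continuous_pair => z; last exact: cvg_snd.
  by apply: cvgN; exact: cvg_fst.
split.
- exact: flow_growth_gt0 fl.
- exact: flow_lipschitz fl.
- exact: flow_odd_gt0 fl.
- exact: (within_precomp_continuous cN _ (flow_continuous fl)).
- move=> T; have [M hM] := flow_growth fl T; exists M => x t tT.
  by rewrite -[`|x|]normrN; exact: hM.
- move=> x t t0; have h2 : is_derive x 1 (fun z : R => - z) (- 1).
    exact: is_deriveNid.
  have := @is_derive1_comp R (u ^~ t) (fun z => - z) x _ _ (flow_slope fl (- x) t0) h2.
  by rewrite mulrN1.
- move=> x t t0; apply: continuousN.
  apply: (continuous_comp (f := fun z : R * R => (- z.1, z.2))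
    (g := fun z : R * R => w z.1 z.2)); first exact: cN.
  exact: (flow_slope_continuous fl).
- move=> x t t0; have [a [b [J e]]] := flow_equation fl (- x) t0.
  by exists a, b; split=> //; exact: heat_jet_opp.
- move=> x t t0; have [a [b [J e]]] := flow_slope_caloric fl (- x) t0.
  exists (- a), (- b); split; first exact/heat_jetN/heat_jet_opp.
  by rewrite -opprD !normrN.
Qed.

Section Strict.
Variables (C : R) (f : R -> R) (u w : R -> R -> R).
Hypothesis fl : flow C f u w.
Hypothesis um : unimodal (u ^~ 0).
Hypothesis ld : left_decided u.

Lemma slope_continuous_within (A : set (R * R)) :
  (forall z, A z -> 0 < z.2) -> {within A, continuous (fun z : R * R => w z.1 z.2)}.
Proof.
move=> hA; apply: continuous_in_subspaceT => -[x t]; rewrite inE => /hA t0.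
exact: (flow_slope_continuous fl).
Qed.

(** The slice descends from higher values on the far left to the odd level and
    further down on the right of it.  By the sign pattern the slope is
    nonpositive up to a point [y0] on the right of [x], at all nearby times.  It
    is negative somewhere on the left, slightly earlier, and this strict sign
    is carried to [x] along a tube. *)
Lemma slope_neg_at_odd_level x y t : 0 < t -> odd_level (u x t) -> x < y ->
  u y t < u x t -> w x t < 0.
Proof.
move=> t0 ox xy uyx; have t0' := ltW t0.
have [y0 /andP[xy0 y0y] wy0] := flow_fall fl t0 xy uyx.
have [r1 r10 hr1] := continuous_near_lt (flow_slope_continuous fl (x := y0) t0) wy0.
have nonpos x' s : 0 < s -> `|s - t| < r1 -> x' <= y0 -> w x' s <= 0.
  move=> s0 st xy'; rewrite leNgt; apply/negP => wx.
  have := slope_sign_pattern fl um s0 xy' wx.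
  by have := hr1 y0 s; rewrite subrr normr0 => /(_ r10 st); lra.
have [X Xx uX] : exists2 X : R, X < x & u x t < u X t.
  have m1 (X : R) : Num.min X (x - 1) <= X by rewrite ge_min lexx.
  have m2 (X : R) : Num.min X (x - 1) <= x - 1 by rewrite ge_min lexx orbT.
  have [[X hX]|[X hX]] := ld ox t0'; have := hX (Num.min X (x - 1)) (m1 X) => h.
    by exists (Num.min X (x - 1)) => //; have := m2 X; lra.
  have := @slice_descends _ _ _ _ _ fl um t x y (Num.min X (x - 1)) x t0' xy uyx.
  by have := m2 X => m3 m4; have : u x t <= u (Num.min X (x - 1)) t;
    [apply: m4; lra|lra].
(* [c] separates the values at [x] and at [X] also at the earlier time [s1] *)
pose c := (u x t + u X t) / 2.
have c1 : u x t < c by rewrite /c; lra.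
have c2 : c < u X t by rewrite /c; lra.
have [r2 r20 hr2] := flow_near_lt fl t0' c1.
have [r3 r30 hr3] := flow_near_gt fl t0' c2.
pose rho := Num.min (Num.min r1 t) (Num.min r2 r3).
have rho0 : 0 < rho by rewrite !lt_min r10 t0 r20 r30.
have [q1 [q2 [q3 q4]]] : rho <= r1 /\ rho <= t /\ rho <= r2 /\ rho <= r3.
  by rewrite /rho !ge_min !lexx !orbT.
pose s1 := t - rho / 2.
have s10 : 0 < s1 by clear -q2 rho0 t0; rewrite /s1; lra.
have s1t : `|s1 - t| < rho by clear -rho0; rewrite ler0_norm /s1; lra.
have [z /andP[Xz zx] wz] : exists2 z : R, X < z < x & w z s1 < 0.
  apply: (flow_fall fl s10 Xx); apply: (@lt_trans _ _ c).
    by apply: hr2; rewrite ?subrr ?normr0//; clear -s10 s1t q3; lra.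
  by apply: hr3; rewrite ?subrr ?normr0//; clear -s10 s1t q4; lra.
have [r4 r40 hr4] := continuous_near_lt (flow_slope_continuous fl (x := z) s10) wz.
pose r := Num.min (y0 - x) (r4 / 2).
have r0 : 0 < r by clear -r40 xy0; rewrite lt_min; lra.
have ry : r <= y0 - x by rewrite ge_min lexx.
have rr4 : r <= r4 / 2 by rewrite ge_min lexx orbT.
have s1t' : s1 < t by clear -rho0; rewrite /s1; lra.
pose v := (x - z) / (t - s1).
clear - fl um nonpos s10 s1t s1t' s1 Xz zx wz r4 r40 hr4 r r0 ry rr4 v q1 r10 rho0.
have v0 : 0 < v by clear -zx s1t'; rewrite divr_gt0//; lra.
have vt : v * (t - s1) = x - z by clear -s1t'; rewrite /v; field; lra.
have inA x' s : tube (z - v * s1) v r s1 t (x', s) ->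
    [/\ 0 < s, `|s - t| < r1, s <= t & x' <= y0].
  rewrite /tube/= => -[]; rewrite ler_norml => /andP[h1 h2] /andP[h3 h4].
  split=> //; first by lra.
    by rewrite ler0_norm; rewrite /s1 in h3; lra.
  have : v * (s - s1) <= v * (t - s1) by rewrite ler_pM2l//; lra.
  by lra.
suff : 0 < - w x t by lra.
apply: (@positivity_propagates _ (fun x t => - w x t) z x r s1 t) => //.
- apply: within_continuousN; apply: slope_continuous_within => -[x' s] /inA.
  by case.
- by move=> x' s /inA [? ? ? ?]; rewrite oppr_ge0; exact: nonpos.
- move=> x' s /inA [sp st _ xy'] _.
  have [a [b [J h]]] := flow_slope_caloric fl x' sp.
  exists (- a), (- b); split; first exact: heat_jetN.
  have wn : w x' s <= 0 by exact: nonpos.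
  by move: h; rewrite [X in _ <= X]ler0_norm// ler_norml; lra.
- move=> x' hx'; rewrite oppr_gt0; apply: hr4; last by rewrite subrr normr0.
  by lra.
Qed.

Lemma slice_strict_left x y z t : 0 < t -> odd_level (u x t) -> x < y ->
  u y t < u x t -> z < x -> u x t < u z t.
Proof.
move=> t0 ox xy uyx zx; have wx := slope_neg_at_odd_level t0 ox xy uyx.
have [r r0 [_ h]] := derive_lt0_decreases (flow_slope fl x t0) wx.
pose z' := Num.max z (x - r / 2).
have z1 : z <= z' by rewrite le_max lexx.
have z2 : x - r / 2 <= z' by rewrite le_max lexx orbT.
have z3 : z' < x by rewrite gt_max; lra.
have : u x t < u z' t by apply: h; lra.
have : u z' t <= u z t by apply: (slice_descends fl um (ltW t0) xy uyx) => //; exact: ltW.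
by lra.
Qed.

Lemma slope_at_min x t : 0 < t -> (forall y, u x t <= u y t) -> w x t = 0.
Proof.
move=> t0 hm; apply/eqP; rewrite eq_le !leNgt; apply/andP; split; apply/negP => wx.
  have [r r0 [_ h]] := derive_gt0_increases (flow_slope fl x t0) wx.
  by have := hm (x - r / 2); have := h (x - r / 2); lra.
have [r r0 [h _]] := derive_lt0_decreases (flow_slope fl x t0) wx.
by have := hm (x + r / 2); have := h (x + r / 2); lra.
Qed.

Hypothesis rd : left_decided (mirror u).

(** The slope vanishes at two minima, whereas it changes sign only at one point
    at positive times.  The sides of the minima are fenced by points with strictly
    negative and strictly positive slope because the slice is higher near both
    ends. *)
Lemma slice_strict_min x y t : 0 < t -> odd_level (u x t) ->
  (forall z, u x t <= u z t) -> y != x -> u x t < u y t.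
Proof.
move=> t0 ox hm yx; rewrite lt_neqAle hm andbT; apply/eqP => uyx.
have hmy z : u y t <= u z t by rewrite -uyx.
have wx := slope_at_min t0 hm; have wy := slope_at_min t0 hmy.
have [X hX] : exists X : R, forall z, z <= X -> u x t < u z t.
  have [//|[X hX]] := ld ox (ltW t0); exists X => z zX.
  by have := hX z zX; have := hm z; lra.
have [Y hY] : exists Y : R, forall z, Y <= z -> u x t < u z t.
  have [[Y hY]|[Y hY]] := rd ox (ltW t0); exists (- Y) => z zY.
    by have := hY (- z); rewrite /mirror opprK; apply; lra.
  by have := hY (- z); rewrite /mirror opprK; have := hm z; lra.
wlog xy : x y ox hm yx uyx hmy wx wy hX hY / x < y.
  move=> H; have [xy|yx'|xy] := ltgtP x y; first exact: (H x y).
    have ox' : odd_level (u y t) by rewrite -uyx.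
    have xy' : x != y by rewrite eq_sym.
    have hX' z : z <= X -> u y t < u z t by rewrite -uyx; exact: hX.
    have hY' z : Y <= z -> u y t < u z t by rewrite -uyx; exact: hY.
    exact: (H y x ox' hmy xy' (esym uyx) hm wy wx hX' hY' yx').
  by rewrite xy eqxx in yx.
pose X' := Num.min X (x - 1); pose Y' := Num.max Y (y + 1).
have X1 : X' <= X by rewrite ge_min lexx.
have X2 : X' < x.
  by apply: (@le_lt_trans _ _ (x - 1)); [rewrite ge_min lexx orbT|lra].
have Y1 : Y <= Y' by rewrite le_max lexx.
have Y2 : y < Y'.
  by apply: (@lt_le_trans _ _ (y + 1)); [lra|rewrite le_max lexx orbT].
have [y2 /andP[_ y2x] wy2] := flow_fall fl t0 X2 (hX _ X1).
have uYy : u y t < u Y' t by rewrite -uyx; exact: hY.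
have [y1 /andP[yy1 _] wy1] := flow_rise fl t0 Y2 uYy.
have [r1 r10 h1] := continuous_near_lt (flow_slope_continuous fl (x := y2) t0) wy2.
have [r2 r20 h2] := continuous_near_gt (flow_slope_continuous fl (x := y1) t0) wy1.
pose rho := Num.min t (Num.min r1 r2).
have rho0 : 0 < rho by rewrite !lt_min t0 r10.
have [q1 [q2 q3]] : rho <= t /\ rho <= r1 /\ rho <= r2.
  by rewrite /rho !ge_min !lexx !orbT.
pose s0 := t - rho / 2.
have s00 : 0 < s0 by rewrite /s0; lra.
have pos s : s0 <= s <= t -> 0 < s by lra.
apply: (@sign_change_at_one_point _ w y2 x y y1 s0 t) => //.
- by rewrite /s0; lra.
- apply: slope_continuous_within => -[z s] [_]; rewrite /= in_itv/= => /pos.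
  by [].
- by move=> z s hs; apply: (flow_slope_caloric fl); lra.
- move=> s hs; have st : `|s - t| < rho by rewrite ler0_norm; rewrite /s0 in hs; lra.
  by apply/andP; split; [apply: h1|apply: h2]; rewrite ?subrr ?normr0//; lra.
- by move=> s a b /pos sp ab; exact: (slope_sign_pattern fl um sp ab).
- by rewrite wx.
- by rewrite wy.
Qed.

End Strict.
End Reflection.

(** * The slices near infinity *)

Section Ends.
Context {R : realType}.
Implicit Types (g u w : R -> R -> R) (x y t s a b c p q r A B M K k eps l : R) (j : nat).

Lemma expRM_small C B c : 0 < C -> 0 < c ->
  exists X : R, forall x, x <= X -> B * expR (C * x) < c.
Proof.
move=> C0 c0; exists (- (`|B| / c / C)) => x xX.
have k0 : 0 <= `|B| / c by rewrite divr_ge0// ltW.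
have y0 : `|B| / c <= - (C * x).
  by rewrite -mulrN [C * _]mulrC -ler_pdivrMr// lerNr.
apply: (@le_lt_trans _ _ (`|B| * expR (C * x))).
  by rewrite ler_wpM2r ?expR_ge0// ler_norm.
rewrite -[C * x]opprK expRN.
rewrite ltr_pdivrMr ?expR_gt0//.
apply: (@lt_le_trans _ _ (c * (1 + - (C * x)))); last by rewrite ler_pM2l ?expR_ge1Dx.
by rewrite -ltr_pdivrMl// mulrC; lra.
Qed.

(** It decays to the left, and the rate leaves a surplus of [1] over the square
    of the exponent. *)
Definition end_weight C x t : R := expR ((C ^+ 2 + 1) * t) * expR (C * x).

Lemma heat_jet_end_weight C x t :
  heat_jet (end_weight C) x t ((C ^+ 2 + 1) * end_weight C x t) (C ^+ 2 * end_weight C x t).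
Proof.
split.
  apply: (is_derive_congr (is_deriveM (is_derive_expRM (C ^+ 2 + 1) t)
    (is_derive_cst (expR (C * x)) t 1))).
  by rewrite /end_weight /GRing.scale/=; ring.
pose E := expR ((C ^+ 2 + 1) * t).
exists (fun y => E * (C * expR (C * y))); split=> [y|].
  exact: (is_deriveZ E (is_derive_expRM C y)).
apply: (is_derive_congr (is_deriveZ E (is_deriveZ C (is_derive_expRM C x)))).
by rewrite /end_weight /E /GRing.scale/=; ring.
Qed.

Section Barrier.
Variables (C : R) (f : R -> R) (u w : R -> R -> R).
Hypothesis fl : flow C f u w.

(** Zeros of the nonlinearity are equilibria.  By the Lipschitz bound a
    one-sided deviation from one of them is controlled by the weight for all
    times if it is so initially; the sign [sigma] treats both sides at once. *)
Lemma end_barrier (sigma a B : R) : `|sigma| = 1 -> f a = 0 -> 0 <= B ->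
  (forall x, 0 <= sigma * (u x 0 - a) + B * expR (C * x)) ->
  forall x t, 0 <= t -> 0 <= sigma * (u x t - a) + B * end_weight C x t.
Proof.
move=> sigma1 fa B0 init x0 t0 t00; have C0 := flow_growth_gt0 fl.
have [M hM] := flow_growth fl t0.
pose d x t := sigma * (u x t - a) + B * end_weight C x t.
have E0 x t : 0 <= B * end_weight C x t by rewrite !mulr_ge0 ?expR_ge0.
have E1 x : 1 <= expR (C * `|x|) by rewrite -expR0 ler_expR mulr_ge0// ltW.
apply: (@comparison_line _ C (M + `|a| + B * expR ((C ^+ 2 + 1) * t0)) 0 t0 d) => //.
- apply: within_continuousD.
    apply: within_continuousM; first by move=> z; exact: cst_continuous.
    apply: within_continuousD; last by move=> z; exact: cst_continuous.
    exact: (continuous_subspaceW (strip_sub (lexx 0))) (flow_continuous fl).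
  apply: continuous_subspaceT => z; apply: cvgM; first exact: cvg_cst.
  apply: cvgM; first exact: continuous_expRM_snd.
  apply: (continuous_comp (f := fun z : R * R => C * z.1)).
    by apply: cvgM; [exact: cvg_cst|exact: cvg_fst].
  exact: continuous_expR.
- move=> x t tt; rewrite /d; apply: (le_trans (ler_normD _ _)).
  rewrite [X in _ + X]ger0_norm// normrM sigma1 mul1r.
  have h1 := hM x t tt; have h2 := ler_normB (u x t) a.
  have h3 : `|a| <= `|a| * expR (C * `|x|) by rewrite ler_peMr.
  have h4 : B * end_weight C x t <= B * expR ((C ^+ 2 + 1) * t0) * expR (C * `|x|).
    rewrite -mulrA ler_wpM2l// ler_pM ?expR_ge0 ?ler_expR//.
      rewrite ler_wpM2l//; first by have := sqr_ge0 C; lra.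
      by lra.
    by rewrite ler_pM2l// ler_norm.
  by lra.
- by move=> x; rewrite /d /end_weight mulr0 expR0 mul1r.
- move=> x t /andP[tp _] dneg.
  have [b1 [b2 [J e]]] := flow_equation fl x tp.
  have J' := heat_jetD (heat_jetZ sigma (heat_jetB J (heat_jet_cst a x t)))
    (heat_jetZ B (heat_jet_end_weight C x t)).
  do 2 eexists; split; first exact: J'.
  have := flow_lipschitz fl (u x t) a; rewrite fa subr0 => h.
  have : `|sigma * f (u x t)| <= `|sigma * (u x t - a)| by rewrite !normrM sigma1 !mul1r.
  rewrite [X in _ <= X]ltr0_norm; last by have := E0 x t; rewrite /d in dneg; lra.
  by rewrite ler_norml /d e; lra.
- by rewrite t00 lexx.
Qed.

Lemma flow_nonneg : f 0 = 0 -> (forall x, 0 <= u x 0) -> forall x t, 0 <= t -> 0 <= u x t.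
Proof.
move=> f0 u0 x t t0; have := @end_barrier 1 0 0 (normr1 R) f0 (lexx 0) _ x t t0.
rewrite subr0 mul0r mul1r addr0; apply=> y.
by rewrite subr0 mul0r mul1r addr0.
Qed.

Lemma lower_end a X0 c t : f a = 0 -> 0 <= a -> (forall x, 0 <= u x 0) ->
  (forall x, x <= X0 -> a <= u x 0) -> 0 <= t -> c < a ->
  exists X : R, forall x, x <= X -> c < u x t.
Proof.
move=> fa a0 u0 uX t0 ca; have C0 := flow_growth_gt0 fl.
pose B := a * expR (- (C * X0)).
have B0 : 0 <= B by rewrite mulr_ge0// expR_ge0.
have [|X hX] := @expRM_small C (B * expR ((C ^+ 2 + 1) * t)) (a - c) C0; first by lra.
exists X => x xX.
have := @end_barrier 1 a B (normr1 R) fa B0 _ x t t0; rewrite mul1r => h.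
have := hX x xX; rewrite -mulrA -/(end_weight C x t).
suff : 0 <= u x t - a + B * end_weight C x t by lra.
have BE y : 0 <= B * expR (C * y) by rewrite mulr_ge0// expR_ge0.
apply: h => y; rewrite mul1r.
have [yX|yX] := leP y X0.
  by have := uX y yX; have := BE y; lra.
have : a <= B * expR (C * y).
  rewrite /B -mulrA -expRD ler_peMr// -expR0 ler_expR.
  by rewrite addrC -mulrBr mulr_ge0; lra.
by have := u0 y; lra.
Qed.

Lemma upper_end a X0 c t : f a = 0 -> 0 <= a ->
  (forall x, x <= X0 -> u x 0 <= a) -> 0 <= t -> a < c ->
  exists X : R, forall x, x <= X -> u x t < c.
Proof.
move=> fa a0 uX t0 ac; have C0 := flow_growth_gt0 fl.
have [M hM] := flow_growth fl 0.
have h00 : 0 <= (0 : R) <= 0 by rewrite !lexx.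
have M0 : 0 <= M.
  by have := hM 0 0 h00; rewrite normr0 mulr0 expR0 mulr1; apply: le_trans.
pose B := M * expR (C * (2 * `|X0|)).
have B0 : 0 <= B by rewrite mulr_ge0// expR_ge0.
have [|X hX] := @expRM_small C (B * expR ((C ^+ 2 + 1) * t)) (c - a) C0; first by lra.
exists X => x xX.
have s1 : `|-1 : R| = 1 by rewrite normrN1.
have := @end_barrier (-1) a B s1 fa B0 _ x t t0; rewrite mulN1r => h.
have := hX x xX; rewrite -mulrA -/(end_weight C x t).
suff : 0 <= - (u x t - a) + B * end_weight C x t by lra.
have BE y : 0 <= B * expR (C * y) by rewrite mulr_ge0// expR_ge0.
apply: h => y; rewrite mulN1r.
have [yX|yX] := leP y X0.
  by have := uX y yX; have := BE y; lra.
have : M * expR (C * `|y|) <= B * expR (C * y).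
  rewrite /B -mulrA -expRD ler_wpM2l// ler_expR -mulrDr ler_pM2l//.
  have n1 := ler_norm X0; have n2 := ler_norm (- X0); rewrite normrN in n2.
  by have [] := ger0P y; lra.
by have := hM y 0 h00; rewrite ler_norml; lra.
Qed.

End Barrier.

(** The odd multiples of [pi] that a nonnegative function can reach, numbered
    like the steps. *)
Definition level j : R := (2 * j + 1)%:R * pi.

Lemma odd_level_level j : odd_level (level j).
Proof. by exists j; rewrite /level -pmulrn. Qed.

Lemma odd_level_ge0 c : odd_level c -> 0 <= c -> exists j, c = level j.
Proof.
move=> [[j|j] ->]; first by exists j; rewrite /level -pmulrn.
rewrite pmulr_lge0 ?pi_gt0// ler0z NegzE.
lia.
Qed.

Lemma level_le i j : (level i <= level j) = (i <= j)%N.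
Proof. by rewrite /level ler_pM2r ?pi_gt0// ler_nat leq_add2r leq_pmul2l. Qed.

Lemma level_lt i j : (level i < level j) = (i < j)%N.
Proof. by rewrite !ltNge level_le ltnNge. Qed.

(** On the far left the slice stays close to [2 * pi] times the number of steps;
    only its position relative to the odd levels is kept. *)
Definition left_end (u : R -> R -> R) (m : enat) : Prop := forall t j, 0 <= t ->
  (steps m j -> exists X : R, forall x, x <= X -> level j < u x t) /\
  (~ steps m j -> exists X : R, forall x, x <= X -> u x t < level j).

Lemma left_end_decided u m : (forall x t, 0 <= t -> 0 <= u x t) ->
  left_end u m -> left_decided u.
Proof.
move=> u0 le c t oc t0; have [c0|c0] := leP 0 c; last first.
  by left; exists 0 => x _; apply: lt_le_trans c0 _; exact: u0.
have [j ->] := odd_level_ge0 oc c0.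
have [h1 h2] := le t j t0.
by have [/h1|/h2] := EM (steps m j); [left|right].
Qed.

(** The value at minus infinity is an equilibrium, an even multiple of [pi];
    with infinitely many steps all of them act as lower barriers. *)
Lemma left_end_of_initial C f u w m : flow C f u w ->
  (forall j, f ((2 * j)%:R * pi) = 0) -> (forall x, 0 <= u x 0) ->
  (forall j, steps m j -> exists X : R, forall x, x <= X -> (2 * j + 2)%:R * pi <= u x 0) ->
  (forall j, ~ steps m j -> exists X : R, forall x, x <= X -> u x 0 <= (2 * j)%:R * pi) ->
  left_end u m.
Proof.
move=> fl f2 u0 h1 h2 t j t0; have pi0 := pi_gt0 R; split=> [/h1|/h2] [X hX].
  apply: (lower_end fl _ _ u0 hX t0).
  - by rewrite (_ : (2 * j + 2 = 2 * j.+1)%N) ?f2//; lia.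
  - by rewrite mulr_ge0// ltW.
  - by rewrite /level ltr_pM2r// ltr_nat; lia.
apply: (upper_end fl _ _ hX t0).
- exact: f2.
- by rewrite mulr_ge0// ltW.
- by rewrite /level ltr_pM2r// ltr_nat; lia.
Qed.

End Ends.

(** * The two sides of the staircase *)

Section Sides.
Context {R : realType}.
Implicit Types (u w : R -> R -> R) (x y z t s a b c e p q r T : R) (j : nat).

(** The slices at time [0] are only assumed to have the properties that a
    solution acquires by itself at positive times. *)
Record stair_flow (C : R) (f : R -> R) (u w : R -> R -> R) (m n : enat) : Prop := StairFlow {
  sf_flow : flow C f u w ;
  sf_unimodal : unimodal (u ^~ 0) ;
  sf_nonneg : forall x t, 0 <= t -> 0 <= u x t ;
  sf_left_end : left_end u m ;
  sf_right_end : left_end (mirror u) n ;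
  sf_left0 : forall x y z, odd_level (u x 0) -> x < y -> u y 0 < u x 0 ->
    z < x -> u x 0 < u z 0 ;
  sf_right0 : forall x y z, odd_level (u x 0) -> y < x -> u y 0 < u x 0 ->
    x < z -> u x 0 < u z 0 ;
  sf_min0 : forall x y, odd_level (u x 0) -> (forall z, u x 0 <= u z 0) ->
    y != x -> u x 0 < u y 0 }.

Lemma mirrorK u : mirror (mirror u) = u.
Proof. by apply/funext => x; apply/funext => t; rewrite /mirror opprK. Qed.

Lemma mirror_nonneg u : (forall x t, 0 <= t -> 0 <= u x t) ->
  forall x t, 0 <= t -> 0 <= mirror u x t.
Proof. by move=> h x t; exact: h. Qed.

Lemma stair_flow_mirror C f u w m n : stair_flow C f u w m n ->
  stair_flow C f (mirror u) (fun x t => - w (- x) t) n m.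
Proof.
case=> fl um u0 le re sl sr sm; split.
- exact: flow_mirror fl.
- exact: (unimodal_mirror um).
- exact: mirror_nonneg.
- exact: re.
- by rewrite mirrorK.
- by move=> x y z ox xy uxy zx; apply: (sr _ (- y)) => //; rewrite ?ltrN2.
- by move=> x y z ox xy uxy zx; apply: (sl _ (- y)) => //; rewrite ?ltrN2.
- move=> x y ox hm yx; apply: sm => //; last by rewrite eqr_opp.
  by move=> z; rewrite -[z]opprK; exact: hm.
Qed.

(** A point on the left side is a kink, one on the right side an antikink: the
    slice takes lower values beyond it, towards the valley.  By quasiconvexity
    no point is both, and a point that is neither is a minimum. *)
Definition left_side u t x : Prop := exists2 y : R, x < y & u y t < u x t.
Definition right_side u t x : Prop := exists2 y : R, y < x & u y t < u x t.

Lemma left_side_mirror u t x : left_side (mirror u) t x <-> right_side u t (- x).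
Proof.
split=> -[y xy uyx]; exists (- y) => //; rewrite /mirror ?opprK//.
  by rewrite ltrN2.
by rewrite ltrNr.
Qed.

Section Geometry.
Variables (C : R) (f : R -> R) (u w : R -> R -> R) (m n : enat).
Hypothesis sf : stair_flow C f u w m n.

Let fl := sf_flow sf.
Let um := sf_unimodal sf.
Let ld := left_end_decided (sf_nonneg sf) (sf_left_end sf).
Let rd := left_end_decided (mirror_nonneg (sf_nonneg sf)) (sf_right_end sf).

Lemma left_side_strict x z t : 0 <= t -> odd_level (u x t) -> left_side u t x ->
  z < x -> u x t < u z t.
Proof.
rewrite le_eqVlt => /predU1P[<-|t0] ox [y xy uyx] zx.
  exact: (sf_left0 sf ox xy uyx zx).
exact: (slice_strict_left fl um ld t0 ox xy uyx zx).
Qed.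

Lemma left_side_slope x t : 0 < t -> odd_level (u x t) -> left_side u t x -> w x t < 0.
Proof. by move=> t0 ox [y xy uyx]; exact: (slope_neg_at_odd_level fl um ld t0 ox xy uyx). Qed.

Lemma sides_exclusive x t : 0 <= t -> left_side u t x -> right_side u t x -> False.
Proof.
move=> t0 [y xy uyx] [z zx uzx].
by have := slice_quasiconvex fl um t0 zx xy uzx; lra.
Qed.

Lemma min_of_no_side x t : ~ left_side u t x -> ~ right_side u t x ->
  forall y, u x t <= u y t.
Proof.
move=> nl nr y; rewrite leNgt; apply/negP => uyx.
have [xy|yx|xy] := ltgtP x y; first by apply: nl; exists y.
  by apply: nr; exists y.
by rewrite xy ltxx in uyx.
Qed.

Lemma min_strict x y t : 0 <= t -> odd_level (u x t) ->
  (forall z, u x t <= u z t) -> y != x -> u x t < u y t.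
Proof.
rewrite le_eqVlt => /predU1P[<-|t0] ox hm yx; first exact: (sf_min0 sf).
exact: (slice_strict_min fl um ld rd).
Qed.

Lemma left_side_ends_below x y z t : 0 <= t -> odd_level (u x t) -> x < y -> u y t < u x t ->
  x < z -> z < y -> u z t < u x t.
Proof.
move=> t0 ox xy uyx xz zy; rewrite ltNge le_eqVlt; apply/negP => /predU1P[e|uxz].
  have oz : odd_level (u z t) by rewrite -e.
  have lz : left_side u t z by exists y => //; rewrite -e.
  by have := left_side_strict t0 oz lz xz; rewrite e ltxx.
by have := slice_quasiconvex fl um t0 xz zy uxz; lra.
Qed.

Lemma not_right_strict x z t : 0 <= t -> odd_level (u x t) -> ~ right_side u t x ->
  z < x -> u x t < u z t.
Proof.
move=> t0 ox nr zx; have [l|nl] := EM (left_side u t x).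
  exact: left_side_strict.
by apply: (min_strict t0 ox (min_of_no_side nl nr)); rewrite lt_eqF.
Qed.

(** Valleys are only lost in the course of time, never gained. *)
Lemma earlier_below x c s t : 0 <= s -> s < t -> odd_level c -> u x t <= c ->
  exists e, u e s < c.
Proof.
move=> s0 st oc uxc; apply: contrapT => ne.
have h y : c <= u y s by rewrite leNgt; apply/negP => uy; apply: ne; exists y.
by have := above_odd_level fl s0 st oc h x; lra.
Qed.

Lemma slice_continuous t : 0 <= t -> continuous (u ^~ t).
Proof.
move=> t0 x; apply/cvgrPdist_lt => eps e0.
have [r r0 h] := flow_near fl x t0 e0; exists r => //= y xy.
by rewrite distrC; apply: h => //; rewrite ?subrr ?normr0// distrC.
Qed.

(** The leftmost values exceed the level and those in the valley do not reach
    it. *)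
Lemma left_point_exists t j e : 0 <= t -> steps m j -> u e t < level j ->
  exists x, [/\ x < e, u x t = level j & left_side u t x].
Proof.
move=> t0 mj ue; have [X hX] := (sf_left_end sf j t0).1 mj.
pose X' := Num.min X e.
have uX' : level j < u X' t by apply: hX; rewrite ge_min lexx.
have X'e : X' <= e by rewrite ge_min lexx orbT.
have [||x] := @IVT _ (u ^~ t) X' e (level j) X'e.
- exact/continuous_subspaceT/slice_continuous.
- by rewrite ge_min le_max (ltW ue) (ltW uX') orbT.
- rewrite in_itv/= => /andP[_ xe] ux; exists x.
  have {}xe : x < e by rewrite lt_neqAle xe andbT; apply/eqP => E; rewrite E in ux; lra.
  by split=> //; exists e => //; rewrite ux.
Qed.

(** On the left of such a point the slice is above the level, so that the
    value at minus infinity is. *)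
Lemma left_point_steps x t j : 0 <= t -> u x t = level j -> ~ right_side u t x -> steps m j.
Proof.
move=> t0 ux nr; apply: contrapT => mj.
have [X hX] := (sf_left_end sf j t0).2 mj.
pose X' := Num.min X (x - 1).
have X'x : X' < x by apply: (@le_lt_trans _ _ (x - 1)); [rewrite ge_min lexx orbT|lra].
have h1 : u X' t < level j by apply: hX; rewrite ge_min lexx.
have := @not_right_strict x X' t t0; rewrite ux => /(_ (@odd_level_level R j) nr X'x).
by lra.
Qed.

End Geometry.

Section TwoSided.
Variables (C : R) (f : R -> R) (u w : R -> R -> R) (m n : enat).
Hypothesis sf : stair_flow C f u w m n.

Lemma right_side_slope x t : 0 < t -> odd_level (u x t) -> right_side u t x -> 0 < w x t.
Proof.
move=> t0 ox rx; have := @left_side_slope _ _ _ _ _ _ (stair_flow_mirror sf) (- x) t t0.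
rewrite /mirror opprK oppr_lt0; apply=> //.
by apply/left_side_mirror; rewrite opprK.
Qed.

Lemma not_left_strict x z t : 0 <= t -> odd_level (u x t) -> ~ left_side u t x ->
  x < z -> u x t < u z t.
Proof.
move=> t0 ox nl xz.
have := @not_right_strict _ _ _ _ _ _ (stair_flow_mirror sf) (- x) (- z) t t0.
rewrite /mirror !opprK; apply=> //; last by rewrite ltrN2.
by rewrite -left_side_mirror mirrorK.
Qed.

Lemma right_point_exists t j e : 0 <= t -> steps n j -> u e t < level j ->
  exists x, [/\ e < x, u x t = level j & right_side u t x].
Proof.
move=> t0 nj ue.
have [|x [xe ux lx]] := @left_point_exists _ _ _ _ _ _ (stair_flow_mirror sf) t j (- e) t0 nj.
  by rewrite /mirror opprK.
by exists (- x); split; [rewrite ltrNr|exact: ux|exact/left_side_mirror].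
Qed.

Lemma right_point_steps x t j : 0 <= t -> u x t = level j -> ~ left_side u t x -> steps n j.
Proof.
move=> t0 ux nl.
apply: (@left_point_steps _ _ _ _ _ _ (stair_flow_mirror sf) (- x) t j t0).
  by rewrite /mirror opprK.
by rewrite -left_side_mirror mirrorK.
Qed.

Lemma left_before_right x y t : 0 <= t -> odd_level (u x t) -> odd_level (u y t) ->
  ~ right_side u t x -> ~ left_side u t y -> x <= y.
Proof.
move=> t0 ox oy nr nl; rewrite leNgt; apply/negP => yx.
have := not_right_strict sf t0 ox nr yx; have := not_left_strict t0 oy nl yx; lra.
Qed.

Lemma left_side_unique x y t : 0 <= t -> odd_level (u x t) -> u x t = u y t ->
  ~ right_side u t x -> ~ right_side u t y -> x = y.
Proof.
move=> t0 ox uxy nx ny; apply: contrapT => /eqP; rewrite neq_lt => /orP[xy|yx].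
  by have := @not_right_strict _ _ _ _ _ _ sf y x t t0; rewrite -uxy => /(_ ox ny xy); lra.
by have := not_right_strict sf t0 ox nx yx; lra.
Qed.

Lemma right_side_unique x y t : 0 <= t -> odd_level (u x t) -> u x t = u y t ->
  ~ left_side u t x -> ~ left_side u t y -> x = y.
Proof.
move=> t0 ox uxy nx ny; apply: contrapT => /eqP; rewrite neq_lt => /orP[xy|yx].
  by have := not_left_strict t0 ox nx xy; lra.
by have := @not_left_strict y x t t0; rewrite -uxy => /(_ ox ny yx); lra.
Qed.

Lemma odd_point_level x t : 0 <= t -> odd_level (u x t) -> exists j, u x t = level j.
Proof. by move=> t0 ox; apply: odd_level_ge0 => //; exact: (sf_nonneg sf). Qed.

End TwoSided.
End Sides.

(** * Counting and following positions *)

Section Counting.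
Context {R : realType}.
Implicit Types (u w : R -> R -> R) (x y z t s c e p q r T : R) (j : nat).

Lemma odd_level_gap c e : odd_level c -> odd_level e -> `|c - e| < pi -> c = e.
Proof.
move=> [k ->] [l ->]; rewrite -mulrBl normrM [`|pi|]gtr0_norm ?pi_gt0//.
rewrite gtr_pMl ?pi_gt0// -intrB -intr_norm.
rewrite -[1]/(1%:~R) ltr_int => kl.
by have -> : k = l by lia.
Qed.

Lemma even_not_odd (k : int) : ~ odd_level ((2 * k)%:~R * pi : R).
Proof.
move=> [l /(mulIf (lt0r_neq0 (pi_gt0 R)))/eqP]; rewrite eqr_int => /eqP; lia.
Qed.

Section Sides.
Variables (C : R) (f : R -> R) (u w : R -> R -> R) (m n : enat).
Hypothesis sf : stair_flow C f u w m n.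

Let fl := sf_flow sf.

(** Nearby positions have the same level by continuity, and a level is attained
    once on either side. *)
Lemma level_isolated x t : 0 <= t -> odd_level (u x t) ->
  exists2 r : R, 0 < r & forall y, `|y - x| < r -> odd_level (u y t) -> y = x.
Proof.
move=> t0 ox; have [r0 r00 hr0] := flow_near fl x t0 (pi_gt0 R).
have near y : `|y - x| < r0 -> odd_level (u y t) -> u y t = u x t.
  move=> yx oy; apply: odd_level_gap => //; apply: hr0 => //.
  by rewrite subrr normr0.
have [[e xe ue]|nl] := EM (left_side u t x).
  exists (Num.min r0 (e - x)); first by rewrite lt_min; lra.
  move=> y; rewrite lt_min => /andP[y1 y2] oy; have uy := near y y1 oy.
  have xr : ~ right_side u t x.
    by apply: (sides_exclusive sf t0); exists e.
  apply: (left_side_unique sf t0 oy uy _ xr); apply: (sides_exclusive sf t0).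
  by exists e; rewrite ?uy//; move: y2; rewrite ltr_norml; lra.
have [[e xe ue]|nr] := EM (right_side u t x).
  exists (Num.min r0 (x - e)); first by rewrite lt_min; lra.
  move=> y; rewrite lt_min => /andP[y1 y2] oy; have uy := near y y1 oy.
  apply: (right_side_unique sf t0 oy uy _ nl) => ly; apply: (sides_exclusive sf t0 ly).
  by exists e; rewrite ?uy//; move: y2; rewrite ltr_norml; lra.
exists r0 => // y yx oy; apply: contrapT => /eqP ne.
have := min_strict sf t0 ox (min_of_no_side nl nr) ne.
by rewrite (near y yx oy) ltxx.
Qed.

Lemma discrete_positions t : 0 <= t -> discrete_set (P (u ^~ t)).
Proof.
move=> t0 x Px; split; first exact/mem_set.
have [r r0 hr] := level_isolated t0 Px.
exists [set y | `|y - x| < r]; first by exists r => // y; rewrite /ball_ /= distrC.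
apply/seteqP; split=> [y [/= yx Py]|y ->]; first exact: hr.
by split=> //=; rewrite subrr normr0.
Qed.

Lemma same_side_unique x y t : 0 <= t -> odd_level (u x t) -> u x t = u y t ->
  (right_side u t x <-> right_side u t y) -> x = y.
Proof.
move=> t0 ox uxy side; have [rx|nx] := EM (right_side u t x).
  have ry := side.1 rx.
  by apply: (right_side_unique sf t0 ox uxy) => l; exact: (sides_exclusive sf t0 l).
by apply: (left_side_unique sf t0 ox uxy nx) => /side.
Qed.

(** A position is determined by its side and its level, and the value at the
    end of the line on its side leaves as many levels as there are steps. *)
Lemma count_positions (m' n' : nat) : m = Fin m' -> n = Fin n' ->
  forall t, 0 <= t -> (P (u ^~ t) #<= `I_(m' + n'))%card.
Proof.
move=> mE nE t t0; apply/pcard_leP/injfunPex.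
pose lv x := xget 0%N [set j | u x t = level j].
have lvE x : odd_level (u x t) -> u x t = level (lv x).
  by move=> ox; apply: (xgetPex 0%N (P := [set j | u x t = level j])); exact: (odd_point_level sf).
pose code x := if `[< right_side u t x >] then (m' + lv x)%N else lv x.
have hleft x : odd_level (u x t) -> ~ right_side u t x -> (lv x < m')%N.
  by move=> /lvE ux nr; have := left_point_steps sf t0 ux nr; rewrite mE.
have hright x : odd_level (u x t) -> right_side u t x -> (lv x < n')%N.
  move=> /lvE ux rx; have := right_point_steps sf t0 ux; rewrite nE; apply => l.
  exact: (sides_exclusive sf t0 l).
exists code.
  move=> x ox /=; rewrite /code; case: asboolP => rx.
    by rewrite ltn_add2l; exact: hright.
  by apply: ltn_addr; exact: hleft.
move=> x y /set_mem ox /set_mem oy; rewrite /code.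
case: asboolP => rx; case: asboolP => ry e.
- apply: (same_side_unique t0 ox) => //; rewrite (lvE _ ox) (lvE _ oy).
  by move/addnI: e => ->.
- by have := hleft _ oy ry; rewrite -e ltnNge leq_addr.
- by have := hleft _ ox rx; rewrite e ltnNge leq_addr.
- by apply: (same_side_unique t0 ox) => //; rewrite (lvE _ ox) (lvE _ oy) e.
Qed.

Section Curve.
Variables (T : R) (a : R -> R).
Hypothesis ca : position_curve u T a.

Lemma curve_odd t : 0 <= t <= T -> odd_level (u (a t) t).
Proof. by move=> tT; exact: (ca.2 t tT). Qed.

Lemma curve_continuous s (eps : R) : 0 <= s <= T -> 0 < eps -> exists2 r : R, 0 < r &
  forall t, 0 <= t <= T -> `|t - s| < r -> `|a t - a s| < eps.
Proof.
move=> sT e0; have /subspace_continuousP/(_ s) := ca.1.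
rewrite /= in_itv/= => /(_ sT)/cvgrPdist_lt/(_ _ e0).
rewrite near_withinE => -[r /= r0 h]; exists r => // q qT qs.
by have := h q; rewrite /= distrC in_itv/= => /(_ qs qT); rewrite distrC.
Qed.

Lemma curve_level_continuous : {within `[0, T], continuous (fun t => u (a t) t)}.
Proof.
apply/subspace_continuousP => s; rewrite /= in_itv/= => sT.
have s0 : 0 <= s by lra.
apply/cvgrPdist_lt => eps e0; rewrite near_withinE.
have [r1 r10 h1] := flow_near fl (a s) s0 e0.
have [r2 r20 h2] := curve_continuous sT r10.
exists (Num.min r1 r2); first by rewrite /= lt_min r10.
move=> t; rewrite /= lt_min distrC => /andP[t1 t2]; rewrite in_itv/= => tT.
by rewrite distrC; apply: h1 => //; [lra|exact: h2].
Qed.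

(** Changing level, a curve would pass an even multiple of [pi] in between. *)
Lemma curve_level s t : 0 <= s -> s <= t -> t <= T -> u (a s) s = u (a t) t.
Proof.
move=> s0 st tT; apply: contrapT => /eqP ne.
have [k hk] : odd_level (u (a s) s) by apply: curve_odd; lra.
have [l hl] : odd_level (u (a t) t) by apply: curve_odd; lra.
have kl : k != l by apply/eqP => kl; rewrite hk hl kl eqxx in ne.
have cu : {within `[s, t], continuous (fun t => u (a t) t)}.
  apply: continuous_subspaceW curve_level_continuous => q; rewrite /= !in_itv/=; lra.
pose p : int := Num.min k l + 1.
have [|q] := @IVT _ _ s t ((2 * p)%:~R * pi) st cu.
  rewrite hk hl ge_min le_max !ler_pM2r ?pi_gt0// !ler_int /p.
  by case: (ltgtP k l) kl; lia.
rewrite in_itv/= => qst uq; apply: (@even_not_odd p); rewrite -uq.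
by apply: curve_odd; lra.
Qed.

(** If the slice had its minimum on the curve, it would lie above an odd level
    and be lifted off it at once. *)
Lemma curve_has_side s t : 0 <= s -> s < t -> t <= T ->
  left_side u s (a s) \/ right_side u s (a s).
Proof.
move=> s0 st tT; have e := curve_level s0 (ltW st) tT.
have [|b ub] := earlier_below sf s0 st (curve_odd (t := t) _) (lexx _); first by lra.
rewrite -e in ub; have [ab|ba|ab] := ltgtP (a s) b.
- by left; exists b.
- by right; exists b.
- by rewrite ab ltxx in ub.
Qed.

Lemma left_side_persists s t : 0 <= s -> s < t -> t <= T ->
  left_side u s (a s) -> exists2 q : R, s < q < t & left_side u q (a q).
Proof.
move=> s0 st tT [e ae ue].
have [r1 r10 h1] := flow_near_lt fl s0 ue.
have sT : 0 <= s <= T by lra.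
have ea : 0 < e - a s by lra.
have [r2 r20 h2] := curve_continuous sT ea.
pose q := s + Num.min (Num.min r1 r2) (t - s) / 2.
have m0 : 0 < Num.min (Num.min r1 r2) (t - s) by rewrite !lt_min; lra.
have [m1 [m2 m3]] : Num.min (Num.min r1 r2) (t - s) <= r1 /\
    Num.min (Num.min r1 r2) (t - s) <= r2 /\ Num.min (Num.min r1 r2) (t - s) <= t - s.
  by rewrite !ge_min !lexx !orbT.
have qs : `|q - s| = Num.min (Num.min r1 r2) (t - s) / 2.
  by rewrite gtr0_norm /q; lra.
exists q; first by rewrite /q; lra.
exists e.
  have : `|a q - a s| < e - a s by apply: h2; rewrite ?qs /q; lra.
  by rewrite ltr_norml; lra.
have [q0 q1] : 0 <= q /\ s <= q by rewrite /q; lra.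
rewrite -(@curve_level s q) ?h1 ?subrr ?normr0 ?qs//; last by rewrite /q; lra.
by lra.
Qed.

(** A position cannot change side: the slope on it would vanish in between,
    although it does not vanish at points that have a side. *)
Lemma right_side_before s t : 0 <= s -> s < t -> t <= T ->
  right_side u t (a t) -> right_side u s (a s).
Proof.
move=> s0 st tT rt; have [ls|//] := curve_has_side s0 st tT.
have [q /andP[sq qt] lq] := left_side_persists s0 st tT ls.
have q0 : 0 < q by lra.
have t0 : 0 < t by lra.
have wq : w (a q) q < 0 by apply: (left_side_slope sf q0) => //; apply: curve_odd; lra.
have wt : 0 < w (a t) t by apply: (right_side_slope sf t0) => //; apply: curve_odd; lra.
have cw : {within `[q, t], continuous (fun r => w (a r) r)}.
  apply/subspace_continuousP => r; rewrite /= in_itv/= => rqt.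
  have r0 : 0 < r by lra.
  have rT : 0 <= r <= T by lra.
  apply/cvgrPdist_lt => eps e0; rewrite near_withinE.
  have k1 : w (a r) r < w (a r) r + eps by lra.
  have k2 : w (a r) r - eps < w (a r) r by lra.
  have [r1 r10 h1] := continuous_near_lt (flow_slope_continuous fl (x := a r) r0) k1.
  have [r2 r20 h2] := continuous_near_gt (flow_slope_continuous fl (x := a r) r0) k2.
  have m0 : 0 < Num.min r1 r2 by rewrite lt_min r10.
  have [r3 r30 h3] := curve_continuous rT m0.
  exists (Num.min r3 (Num.min r1 r2)); first by rewrite /= !lt_min r30 r10.
  move=> p; rewrite /= distrC in_itv/= !lt_min => /and3P[p3 p1 p2] pqt.
  have pT : 0 <= p <= T by lra.
  have := h3 p pT p3; rewrite lt_min => /andP[a1 a2].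
  move: (h1 _ _ a1 p1) (h2 _ _ a2 p2); rewrite /from_subspace/= ltr_norml; lra.
have [|r] := @IVT _ _ q t 0 (ltW qt) cw.
  by rewrite ge_min le_max (ltW wq) (ltW wt) orbT.
rewrite in_itv/= => rqt wr.
have rt' : r < t.
  by rewrite lt_neqAle; apply/andP; split; [apply/eqP => e; rewrite e in wr; lra|lra].
have r0 : 0 < r by lra.
have [l|l] := curve_has_side (ltW r0) rt' tT.
  have : w (a r) r < 0 by apply: (left_side_slope sf r0) => //; apply: curve_odd; lra.
  by lra.
have : 0 < w (a r) r by apply: (right_side_slope sf r0) => //; apply: curve_odd; lra.
by lra.
Qed.

End Curve.

End Sides.
End Counting.

(** * Positions between two curves, and differentiability of curves *)

Section Between.
Context {R : realType}.
Implicit Types (u w : R -> R -> R) (x y z t s c e p q r T : R) (j : nat).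

Lemma position_curve_mirror u T (a : R -> R) : position_curve u T a ->
  position_curve (mirror u) T (fun t => - a t).
Proof.
move=> [ca Pa]; split; first exact: within_continuousN.
by move=> t tT; rewrite /P/= /mirror opprK; exact: Pa.
Qed.

Variables (C : R) (f : R -> R) (u w : R -> R -> R) (m n : enat).
Hypothesis sf : stair_flow C f u w m n.

Lemma left_side_before T (a : R -> R) s t : position_curve u T a ->
  0 <= s -> s < t -> t <= T -> left_side u t (a t) -> left_side u s (a s).
Proof.
move=> ca s0 st tT lt.
have := right_side_before (stair_flow_mirror sf) (position_curve_mirror ca) s0 st tT.
by rewrite -!left_side_mirror mirrorK; apply.
Qed.

(** A point at the later time is sent to the point of the same level and the
    same side at the earlier time, which exists because the level is reached by
    the values at the end of the line and missed in the valley; a minimum is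
    treated as a point on the left side.  This is injective, and it respects the
    order with respect to both curves since these keep level and side. *)
Lemma points_between_nonincreasing T (a b : R -> R) :
  position_curve u T a -> position_curve u T b ->
  forall s t, 0 <= s -> s <= t -> t <= T ->
  ((P (u ^~ t) `&` `]a t, b t[) #<= (P (u ^~ s) `&` `]a s, b s[))%card.
Proof.
move=> ca cb s t s0; rewrite le_eqVlt => /predU1P[->//|st] tT.
have t0 : 0 <= t by lra.
have sT : 0 <= s <= T by lra.
have tT' : 0 <= t <= T by lra.
apply/pcard_leP/injfunPex.
pose g x := if `[< right_side u t x >]
  then xget 0 [set y | u y s = u x t /\ right_side u s y]
  else xget 0 [set y | u y s = u x t /\ left_side u s y].
have gR x : odd_level (u x t) -> right_side u t x ->
    u (g x) s = u x t /\ right_side u s (g x).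
  move=> ox rx; rewrite /g asboolT//.
  apply: (xgetPex 0 (P := [set y | u y s = u x t /\ right_side u s y])).
  have [j uj] := odd_point_level sf t0 ox.
  have nj : steps n j.
    apply: (right_point_steps sf t0 uj) => l; exact: (sides_exclusive sf t0 l).
  have [e ue] := earlier_below sf s0 st ox (lexx _); rewrite uj in ue.
  have [y [_ uy ry]] := right_point_exists sf s0 nj ue.
  by exists y; rewrite uj.
have gL x : odd_level (u x t) -> ~ right_side u t x ->
    u (g x) s = u x t /\ left_side u s (g x).
  move=> ox nx; rewrite /g asboolF//.
  apply: (xgetPex 0 (P := [set y | u y s = u x t /\ left_side u s y])).
  have [j uj] := odd_point_level sf t0 ox.
  have mj := left_point_steps sf t0 uj nx.
  have [e ue] := earlier_below sf s0 st ox (lexx _); rewrite uj in ue.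
  have [y [_ uy ly]] := left_point_exists sf s0 mj ue.
  by exists y; rewrite uj.
have gE x : odd_level (u x t) -> u (g x) s = u x t.
  by move=> ox; have [/(gR _ ox)[]|/(gL _ ox)[]] := EM (right_side u t x).
have gO x : odd_level (u x t) -> odd_level (u (g x) s) by move=> ox; rewrite gE.
have excl x : left_side u s x -> right_side u s x -> False := @sides_exclusive _ _ _ _ _ _ _ sf x s s0.
have exclt x : left_side u t x -> right_side u t x -> False := @sides_exclusive _ _ _ _ _ _ _ sf x t t0.
have oa := curve_odd ca tT'; have ob := curve_odd cb tT'.
have oas := curve_odd ca sT; have obs := curve_odd cb sT.
have ea := curve_level sf ca s0 (ltW st) tT; have eb := curve_level sf cb s0 (ltW st) tT.
exists g; last first.
  move=> x y /set_mem[ox _] /set_mem[oy _] e.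
  have uxy : u x t = u y t by rewrite -gE// -[in RHS]gE// e.
  apply: (same_side_unique sf t0 ox uxy); split=> [rx|ry]; apply: contrapT.
    by move=> /(gL _ oy)[_ ly]; have [_] := gR _ ox rx; rewrite e; exact: excl.
  by move=> /(gL _ ox)[_ lx]; have [_] := gR _ oy ry; rewrite -e; exact: excl.
(* the order with respect to [a], then to [b], by cases on the sides *)
move=> x [ox]; rewrite /= in_itv/= => /andP[ax xb].
split; first exact: gO.
rewrite in_itv/=; apply/andP; split.
  rewrite ltNge; apply/negP => gxa.
  have [las|ras] := curve_has_side sf ca s0 st tT.
    have nas : ~ right_side u s (a s) by move/(excl _ las).
    have nat : ~ right_side u t (a t).
      by move=> /(right_side_before sf ca s0 st tT).
    have [rx|nx] := EM (right_side u t x).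
      have [_ rg] := gR _ ox rx.
      have ng : ~ left_side u s (g x) by move=> /excl; exact.
      have ag := left_before_right sf s0 oas (gO _ ox) nas ng.
      have e : g x = a s by apply/eqP; rewrite eq_le gxa.
      by rewrite e in rg.
    have [_ lg] := gL _ ox nx.
    have h1 := not_right_strict sf t0 ox nx ax.
    move: gxa; rewrite le_eqVlt => /predU1P[e|gxa].
      by have := gE _ ox; rewrite e; lra.
    by have := not_right_strict sf s0 oas nas gxa; rewrite (gE _ ox); lra.
  have nas : ~ left_side u s (a s) by move/excl; exact.
  have nat : ~ left_side u t (a t) by move=> /(left_side_before ca s0 st tT).
  have [rx|nx] := EM (right_side u t x); last first.
    by have := left_before_right sf t0 ox oa nx nat; lra.
  have [_ rg] := gR _ ox rx.
  have ng : ~ left_side u s (g x) by move=> /excl; exact.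
  have h1 := not_left_strict sf t0 oa nat ax.
  move: gxa; rewrite le_eqVlt => /predU1P[e|gxa].
    by have := gE _ ox; rewrite e; lra.
  by have := not_left_strict sf s0 (gO _ ox) ng gxa; rewrite (gE _ ox); lra.
rewrite ltNge; apply/negP => bgx.
have [lbs|rbs] := curve_has_side sf cb s0 st tT.
  have nbs : ~ right_side u s (b s) by move/(excl _ lbs).
  have nbt : ~ right_side u t (b t) by move=> /(right_side_before sf cb s0 st tT).
  have [rx|nx] := EM (right_side u t x).
    have nlx : ~ left_side u t x by move=> /exclt; exact.
    by have := left_before_right sf t0 ob ox nbt nlx; lra.
  have [_ lg] := gL _ ox nx.
  have ng : ~ right_side u s (g x) by move/(excl _ lg).
  have h1 := not_right_strict sf t0 ob nbt xb.
  move: bgx; rewrite le_eqVlt => /predU1P[e|bgx].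
    by have := gE _ ox; rewrite -e; lra.
  by have := not_right_strict sf s0 (gO _ ox) ng bgx; rewrite (gE _ ox); lra.
have nbs : ~ left_side u s (b s) by move/excl; exact.
have [rx|nx] := EM (right_side u t x).
  have nlx : ~ left_side u t x by move=> /exclt; exact.
  have h1 := not_left_strict sf t0 ox nlx xb.
  move: bgx; rewrite le_eqVlt => /predU1P[e|bgx].
    by have := gE _ ox; rewrite -e; lra.
  by have := not_left_strict sf s0 obs nbs bgx; rewrite (gE _ ox); lra.
have [_ lg] := gL _ ox nx.
have ng : ~ right_side u s (g x) by move/(excl _ lg).
have gb := left_before_right sf s0 (gO _ ox) obs ng nbs.
have e : g x = b s by apply/eqP; rewrite eq_le bgx gb.
by rewrite e in lg; exact: excl rbs.
Qed.

End Between.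

Section Curves.
Context {R : realType}.
Implicit Types (u w : R -> R -> R) (x y z t s c e p q r T : R) (i j : nat).
Local Notation level := (@level R).

Definition left_point u t j x : Prop := u x t = level j /\ left_side u t x.

(** For the level of a step the default value is not met as long as the valley
    is below that level. *)
Definition left_curve u j t : R := xget 0 (left_point u t j).

(** Uniform in the space variable, since it will be used at the moving
    position. *)
Definition initial_rate u x (l : R) : Prop := forall eps : R, 0 < eps ->
  exists2 r : R, 0 < r & forall y s, `|y - x| < r -> 0 < s -> s < r ->
    `|(u y s - u y 0) / s - l| < eps.

Section Curve.
Variables (C : R) (f : R -> R) (u w : R -> R -> R) (m n : enat).
Hypothesis sf : stair_flow C f u w m n.

Let fl := sf_flow sf.

Lemma left_point_unique t j x y : 0 <= t -> left_point u t j x -> left_point u t j y -> x = y.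
Proof.
move=> t0 [ux lx] [uy ly]; apply: (left_side_unique sf t0).
- by rewrite ux; exact: odd_level_level.
- by rewrite ux.
- exact: (sides_exclusive sf t0 lx).
- exact: (sides_exclusive sf t0 ly).
Qed.

Lemma left_curveE t j x : 0 <= t -> left_point u t j x -> left_curve u j t = x.
Proof.
move=> t0 px; have p : left_point u t j (left_curve u j t).
  by apply: (xgetPex 0 (P := left_point u t j)); exists x.
exact: (left_point_unique t0 p px).
Qed.

Lemma left_curveP t j e : 0 <= t -> steps m j -> u e t < level j ->
  left_curve u j t < e /\ left_point u t j (left_curve u j t).
Proof.
move=> t0 mj ue; have [x [xe ux lx]] := left_point_exists sf t0 mj ue.
by rewrite (@left_curveE t j x).
Qed.

(** The slice takes values on both sides of the level immediately left and right
    of the point, and continues to do so at nearby times. *)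
Lemma left_curve_near (A : set R) t j (eps : R) : (forall s, A s -> 0 <= s) ->
  A t -> left_point u t j (left_curve u j t) -> 0 < eps ->
  exists2 r : R, 0 < r & forall s, A s -> `|s - t| < r ->
    `|left_curve u j s - left_curve u j t| < eps /\ left_point u s j (left_curve u j s).
Proof.
move=> A0 At; set x := left_curve u j t => -[ux [e xe ue]] e0.
have t0 := A0 _ At.
have ox : odd_level (u x t) by rewrite ux; exact: odd_level_level.
pose h := Num.min eps (e - x) / 2.
have m0 : 0 < Num.min eps (e - x) by rewrite lt_min; lra.
have m1 : Num.min eps (e - x) <= eps by rewrite ge_min lexx.
have m2 : Num.min eps (e - x) <= e - x by rewrite ge_min lexx orbT.
have h0 : 0 < h by rewrite /h; lra.
have h1 : h < eps by rewrite /h; lra.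
have h2 : h < e - x by rewrite /h; lra.
have k1 : u (x + h) t < level j.
  by rewrite -ux; apply: (left_side_ends_below sf t0 ox xe ue); lra.
have k2 : level j < u (x - h) t.
  by rewrite -ux; apply: (left_side_strict sf t0 ox); [exists e|lra].
have [r1 r10 hr1] := flow_near_lt fl t0 k1.
have [r2 r20 hr2] := flow_near_gt fl t0 k2.
exists (Num.min r1 r2); first by rewrite lt_min r10.
move=> s As; rewrite lt_min => /andP[s1 s2]; have s0 := A0 _ As.
have q1 : u (x + h) s < level j by apply: hr1; rewrite ?subrr ?normr0.
have q2 : level j < u (x - h) s by apply: hr2; rewrite ?subrr ?normr0.
have xh : x - h <= x + h by lra.
have [||y] := @IVT _ (u ^~ s) (x - h) (x + h) (level j) xh.
- exact/continuous_subspaceT/(slice_continuous sf).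
- by rewrite ge_min le_max (ltW q1) (ltW q2) orbT.
rewrite in_itv/= => yh uy.
have yh1 : y < x + h.
  by rewrite lt_neqAle; apply/andP; split; [apply/eqP => E; rewrite E in uy; lra|lra].
have py : left_point u s j y by split=> //; exists (x + h); rewrite ?uy.
rewrite (left_curveE s0 py); split=> //.
by rewrite ltr_norml; lra.
Qed.

(** Along a curve of constant level the difference quotient [Q] of the position,
    times the slope [om] of a chord in space, is minus a difference quotient [q]
    in time.  The slope does not vanish close to [t] because [om0 != 0]. *)
Lemma cvg_quotient (A : set R) t (Q om q : R -> R) (om0 q0 : R) : om0 != 0 ->
  (forall eps : R, 0 < eps -> exists2 r : R, 0 < r &
    forall s, A s -> s != t -> `|s - t| < r ->
    [/\ Q s * om s = - q s, `|om s - om0| < eps & `|q s - q0| < eps]) ->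
  cvg (Q @ within A t^').
Proof.
move=> o0 h.
have near (P : R -> Prop) : (exists2 r : R, 0 < r & forall s, A s -> s != t -> `|s - t| < r -> P s) ->
    \forall s \near within A t^', P s.
  move=> [r r0 hr]; rewrite !near_withinE; exists r => // s /=; rewrite distrC => sr st As.
  exact: hr.
have co : om @ within A t^' --> om0.
  apply/cvgrPdist_lt => eps e0; apply: near; have [r r0 hr] := h eps e0.
  by exists r => // s As st sr; have [_ + _] := hr s As st sr; rewrite distrC.
have cq : q @ within A t^' --> q0.
  apply/cvgrPdist_lt => eps e0; apply: near; have [r r0 hr] := h eps e0.
  by exists r => // s As st sr; have [_ _] := hr s As st sr; rewrite distrC.
have c : (fun s => - q s / om s) @ within A t^' --> - q0 / om0.
  by apply: cvgM; [exact: cvgN|exact: cvgV].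
apply/cvg_ex; exists (- q0 / om0); apply: cvg_trans c; apply: near_eq_cvg.
apply: near; have o0' : 0 < `|om0| by rewrite normr_gt0.
have [r r0 hr] := h _ o0'; exists r => // s As st sr.
have [e + _] := hr s As st sr.
have [->|os _] := eqVneq (om s) 0; first by rewrite sub0r normrN ltxx.
by rewrite -e mulfK.
Qed.

(** At positive times the slope of the slice at the point is nonzero and this is
    the implicit function theorem.  At the initial time the solution is only
    continuous, and the time derivative is replaced by the initial rate. *)
Lemma left_curve_derivable (A : set R) j : (forall s, A s -> 0 <= s) ->
  (forall s, A s -> left_point u s j (left_curve u j s)) ->
  (A 0 -> exists l v, [/\ initial_rate u (left_curve u j 0) l,
     is_derive (left_curve u j 0) 1 (u ^~ 0) v & v != 0]) ->
  derivable_in A (left_curve u j).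
Proof.
move=> A0 pA init t At; have t0 := A0 _ At.
set X := left_curve u j; have [uX lX] := pA t At; rewrite -/X in uX lX.
have oX : odd_level (u (X t) t) by rewrite uX; exact: odd_level_level.
have uXs s : A s -> u (X s) s = u (X t) t by move=> As; rewrite uX; have [] := pA s As.
have near (eps : R) : 0 < eps -> exists2 r : R, 0 < r & forall s, A s -> `|s - t| < r ->
    `|X s - X t| < eps.
  move=> e0; have [r r0 hr] := left_curve_near A0 At (pA t At) e0.
  by exists r => // s As st; have [] := hr s As st.
move: t0; rewrite le_eqVlt => /predU1P[t0|t0].
  subst t; have [l [v [rate dv v0]]] := init At.
  (* slope of the chord of the initial slice, with its limit as default *)
  pose om s := if X s == X 0 then v else (u (X s) 0 - u (X 0) 0) / (X s - X 0).
  apply: (@cvg_quotient A 0 _ om (fun s => (u (X s) s - u (X s) 0) / s) v l v0).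
  move=> eps e0; have [r1 r10 h1] := rate eps e0.
  have [r2 r20 h2] := is_derive_quotient dv e0.
  have m0 : 0 < Num.min r1 r2 by rewrite lt_min r10.
  have [r3 r30 h3] := near _ m0.
  exists (Num.min r1 r3); first by rewrite lt_min r10.
  move=> s As s0; rewrite lt_min => /andP[s1 s3].
  have sp : 0 < s by rewrite lt_neqAle eq_sym s0 A0.
  have := h3 s As s3; rewrite lt_min => /andP[x1 x2].
  rewrite subr0 gtr0_norm// in s1.
  split.
  - rewrite /= subr0 /om (uXs s As); case: eqP => [->|/eqP XsX].
      by rewrite !subrr !mul0r oppr0.
    by field; rewrite gt_eqF//= subr_eq0.
  - rewrite /om; case: eqP => [_|/eqP XsX]; first by rewrite subrr normr0.
    exact: h2.
  - exact: h1.
have wX := left_side_slope sf t0 oX lX.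
have [a [b [[ut _] _]]] := flow_equation fl (X t) t0.
pose Q s := (X s - X t) / (s - t).
pose q s := (u (X t) s - u (X t) t) / (s - t).
(* the mean value theorem supplies the slope of the chord of the slice at time [s] *)
have ex s : exists o, 0 < s -> s != t -> u (X s) s = u (X t) t ->
    Q s * o = - q s /\ exists2 c : R, `|c - X t| <= `|X s - X t| & o = w c s.
  have [s0|s0] := leP s 0; first by exists 0; lra.
  have [st|st] := eqVneq s t; first by exists 0; rewrite st.
  have d0 : s - t != 0 by rewrite subr_eq0.
  have fin c : u (X s) s - u (X t) s = w c s * (X s - X t) -> u (X s) s = u (X t) t ->
      Q s * w c s = - q s.
    move=> e1 e2; rewrite /Q /q; apply: (mulIf d0).
    rewrite mulrAC divfK// mulNr divfK// mulrC -e1 e2; ring.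
  have [XX|XX|XX] := ltgtP (X s) (X t).
  - have [c /andP[c1 c2] e] := flow_slope_MVT fl s0 XX.
    exists (w c s) => _ _ us; split; first by apply: fin => //; lra.
    by exists c => //; rewrite !ler0_norm; lra.
  - have [c /andP[c1 c2] e] := flow_slope_MVT fl s0 XX.
    exists (w c s) => _ _ us; split; first by apply: fin => //; lra.
    by exists c => //; rewrite !ger0_norm; lra.
  - exists (w (X t) s) => _ _ us; split; last by exists (X t) => //; rewrite subrr normr0.
    by apply: fin => //; rewrite XX !subrr mulr0.
have [om hom] := choice ex.
apply: (@cvg_quotient A t Q om q (w (X t) t) a); first by rewrite lt_eqF.
move=> eps e0.
have k1 : w (X t) t < w (X t) t + eps by lra.
have k2 : w (X t) t - eps < w (X t) t by lra.
have [r1 r10 h1] := continuous_near_lt (flow_slope_continuous fl (x := X t) t0) k1.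
have [r2 r20 h2] := continuous_near_gt (flow_slope_continuous fl (x := X t) t0) k2.
have m0 : 0 < Num.min r1 r2 by rewrite lt_min r10.
have [r3 r30 h3] := near _ m0.
have [r4 r40 h4] := is_derive_quotient ut e0.
exists (Num.min (Num.min t r4) (Num.min r3 (Num.min r1 r2))).
  by rewrite !lt_min t0 r40 r30 r10.
move=> s As st; rewrite !lt_min => /andP[/andP[st0 s4] /and3P[s3 s1 s2]].
have s0 : 0 < s by move: st0; rewrite ltr_norml; lra.
have [e [c cX oc]] := hom s s0 st (uXs s As).
have := h3 s As s3; rewrite lt_min => /andP[x1 x2].
split=> //; last exact: h4.
have c1 := h1 c s (le_lt_trans cX x1) s1; have c2 := h2 c s (le_lt_trans cX x2) s2.
by rewrite oc ltr_norml; lra.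
Qed.

End Curve.
End Curves.

(** * Smoothened steps *)

Section Kinks.
Context {R : realType}.
Local Notation mu := (@lebesgue_measure R).
Implicit Types (x y z t s c e p q r xi eps : R).

(** Both a kink and a reflected antikink are of this kind.  The two derivatives
    serve to differentiate the positions at the initial time. *)
Record downstep (S : R -> R) (xi eps : R) : Prop := Downstep {
  downstep_smooth : exists S1 S2 : R -> R,
    [/\ forall x, is_derive x 1 S (S1 x), forall x, is_derive x 1 S1 (S2 x),
        continuous S2, forall x, S1 x <= 0 & forall x, `|x - xi| < eps -> S1 x < 0] ;
  downstep_left : forall x, x <= xi - eps -> S x = 2 * pi ;
  downstep_right : forall x, xi + eps <= x -> S x = 0 ;
  downstep_mid : S xi = pi }.

Section Mollifier.
Variables (eps : R) (rho : R -> R).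
Hypothesis eps0 : 0 < eps.
Hypothesis mrho : mollifier eps rho.

Lemma mollifier_derivable k x : derivable (derive1n k rho) x 1.
Proof. by have [h _ _ _ _] := mrho; exact: h. Qed.

Lemma mollifier_is_derive k x :
  is_derive x 1 (derive1n k rho) (derive1n k.+1 rho x).
Proof. by rewrite derive1nS derive1E; exact/derivableP/mollifier_derivable. Qed.

Lemma derive_continuous (g : R -> R) (dg : R -> R) :
  (forall x, is_derive x 1 g (dg x)) -> continuous g.
Proof.
by move=> h x; apply/differentiable_continuous/derivable1_diffP; have [] := h x.
Qed.

Lemma mollifier_continuous : continuous rho.
Proof. exact: (derive_continuous (mollifier_is_derive 0)). Qed.

(** The boundary of the support is included by continuity. *)
Lemma mollifier_zero x : eps <= `|x| -> rho x = 0.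
Proof.
have [_ even out pos _] := mrho; have e0 := eps0.
rewrite le_eqVlt => /predU1P[e|]; last exact: out.
wlog x0 : x e / 0 <= x.
  move=> H; have [|x0] := leP 0 x; first exact: H.
  by rewrite -even; apply: H; [rewrite normrN|lra].
rewrite ger0_norm// in e; subst x.
apply: contrapT => /eqP r0.
have n0 : 0 < `|rho eps| by rewrite normr_gt0.
have /cvgrPdist_lt/(_ _ n0)[r /= rp h] := mollifier_continuous (x := eps).
have z0 : rho (eps + r / 2) = 0 by apply: out; rewrite gtr0_norm; lra.
have b : `|eps - (eps + r / 2)| < r by rewrite ltr0_norm; lra.
by have := h _ b; rewrite /= z0 subr0 ltxx.
Qed.

Lemma mollifier_ge0 x : 0 <= rho x.
Proof.
have [_ _ _ pos _] := mrho; have [/pos/ltW//|/mollifier_zero->//] := ltP `|x| eps.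
Qed.

(** A nonnegative function that is not integrable would have integral [0] as a
    real number, not [1]. *)
Lemma mollifier_integrable (D : set R) : measurable D -> mu.-integrable D (EFin \o rho).
Proof.
move=> mD; apply: (@integrableS _ _ _ _ setT) => //.
apply/integrableP; split.
  apply/measurable_EFinP; apply: continuous_measurable_fun; exact: mollifier_continuous.
under eq_integral do rewrite /= ger0_norm ?mollifier_ge0//.
have [_ _ _ _] := mrho; rewrite /Rintegral.
have : (0 <= \int[mu]_x (rho x)%:E)%E.
  by apply: integral_ge0 => x _; rewrite lee_fin mollifier_ge0.
by case: (\int[mu]_x _)%E => //= [r|] _ h; [rewrite ltry|move/eqP: h; rewrite eq_sym oner_eq0].
Qed.

Definition mollifier_cdf (z : R) : R := (\int[mu]_(y in `]-oo, z]) rho y)%R.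

Lemma mollifier_cdf_derive z : is_derive z 1 mollifier_cdf (rho z).
Proof.
have [||||h1 h2] := @continuous_FTC1 R rho -oo%O z (z + 1).
- by rewrite ltrDl.
- exact: mollifier_integrable.
- exact: ltNyr.
- exact: mollifier_continuous.
- exact: DeriveDef h1 (etrans (esym (derive1E _ _)) h2).
Qed.

Lemma mollifier_tail z :
  (\int[mu]_(y in `]z, +oo[) rho y)%R = 1 - mollifier_cdf z.
Proof.
have [_ _ _ _ tot] := mrho.
rewrite -(@Rintegral_itvB R rho -oo%O +oo%O z)//; last exact: mollifier_integrable.
by congr (_ - _); rewrite set_itvNyy.
Qed.

Lemma mollifier_cdf_left z : z <= - eps -> mollifier_cdf z = 0.
Proof.
have e0 := eps0.
move=> ze; rewrite /mollifier_cdf (@eq_Rintegral _ _ _ _ _ (fun=> 0)).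
  by rewrite Rintegral_cst// mul0r.
move=> y; rewrite inE/= in_itv/= => yz; apply: mollifier_zero.
by rewrite ler0_norm; lra.
Qed.

Lemma mollifier_cdf_right z : eps <= z -> mollifier_cdf z = 1.
Proof.
have e0 := eps0.
move=> ez; suff : 1 - mollifier_cdf z = 0 by lra.
rewrite -mollifier_tail (@eq_Rintegral _ _ _ _ _ (fun=> 0)).
  by rewrite Rintegral_cst// mul0r.
move=> y; rewrite inE/= in_itv/= andbT => yz; apply: mollifier_zero.
by rewrite ger0_norm; lra.
Qed.

(** The sum of both sides has derivative zero since the mollifier is even. *)
Lemma mollifier_cdfN z : mollifier_cdf (- z) = 1 - mollifier_cdf z.
Proof.
have e0 := eps0.
have [_ even _ _ _] := mrho.
pose G z := mollifier_cdf z + mollifier_cdf (- z).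
have dG (x : R) : is_derive x 1 G 0.
  have h2 : is_derive x 1 (fun z : R => - z) (- 1) by exact: is_deriveNid.
  have h3 := @is_derive1_comp R mollifier_cdf (fun z => - z) x _ _
    (mollifier_cdf_derive (- x)) h2.
  apply: (is_derive_congr (is_deriveD (mollifier_cdf_derive x) h3)).
  by rewrite even mulrN1 subrr.
have := is_derive_0_is_cst z eps dG; rewrite /G.
rewrite (@mollifier_cdf_right eps)// (@mollifier_cdf_left (- eps))//; lra.
Qed.

Lemma integrable_patch (f : R -> R) (D : set R) : measurable D ->
  mu.-integrable D (EFin \o f) -> mu.-integrable setT (EFin \o (f \_ D)).
Proof.
by move=> mD iD; rewrite -restrict_EFin; apply/integrable_restrict => //=; rewrite setTI.
Qed.

(** Writing the step, including its middle value [pi], as [pi] times the sum of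
    an open and a closed half line; both have the same integral. *)
Lemma convolution_two_sets (H : R -> R) (A B : set R) x :
  measurable A -> measurable B ->
  (forall y, H (x - y) = pi * ((y \in A)%:R + (y \in B)%:R)) ->
  convolution rho H x =
  pi * ((\int[mu]_(y in A) rho y) + (\int[mu]_(y in B) rho y))%R.
Proof.
move=> mA mB hH.
have iA := integrable_patch mA (mollifier_integrable mA).
have iB := integrable_patch mB (mollifier_integrable mB).
rewrite [in RHS]Rintegral_mkcond [X in _ = _ * (_ + X)]Rintegral_mkcond.
rewrite -RintegralD// -RintegralZl//; last first.
  by have := integrableD measurableT iA iB; apply: eq_integrable => // y _.
apply: eq_Rintegral => y _; rewrite hH !patchE.
have p0 : (point : R) = 0 by []. 
case: (y \in A); case: (y \in B) => /=; rewrite ?p0; ring.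
Qed.

Lemma smooth_kinkE xi x :
  convolution rho (fun x => Hminus (x - xi)) x = 2 * pi * (1 - mollifier_cdf (x - xi)).
Proof.
rewrite (@convolution_two_sets _ `]x - xi, +oo[ `[x - xi, +oo[)//.
  rewrite -Rintegral_itv_obnd_cbnd; last exact: mollifier_integrable.
  by rewrite mollifier_tail; ring.
move=> y; rewrite /Hminus.
rewrite !(@mem_setE R) !in_itv/= !andbT.
by case: (ltgtP (x - y - xi) 0) => h; case: (ltgtP (x - xi) y) => k /=; lra.
Qed.

Lemma smooth_antikinkE xi x :
  convolution rho (fun x => Hplus (x - xi)) x = 2 * pi * mollifier_cdf (x - xi).
Proof.
rewrite (@convolution_two_sets _ `]-oo, x - xi[ `]-oo, x - xi])//.
  rewrite Rintegral_itv_bndo_bndc; last exact: mollifier_integrable.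
  by rewrite -/(mollifier_cdf _); ring.
move=> y; rewrite /Hplus /Hminus.
rewrite !(@mem_setE R) !in_itv/=.
by case: (ltgtP (- (x - y - xi)) 0) => h; case: (ltgtP y (x - xi)) => k /=; lra.
Qed.

Lemma downstep_cdf xi : downstep (fun x => 2 * pi * (1 - mollifier_cdf (x - xi))) xi eps.
Proof.
have e0 := eps0.
have [_ _ _ pos _] := mrho; have pi0 := pi_gt0 R.
have sh (g : R -> R) (x c : R) : is_derive (x - xi) 1 g c ->
    is_derive x 1 (fun z => g (z - xi)) c.
  move=> h; have h2 : is_derive x 1 (fun z : R => z - xi) 1.
    by apply: (is_derive_congr (is_deriveB (is_derive_id x 1) (is_derive_cst xi x 1))); rewrite subr0.
  by have := @is_derive1_comp R g (fun z : R => z - xi) x c _ h h2; rewrite mulr1.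
split.
- exists (fun x => - (2 * pi) * rho (x - xi)), (fun x => - (2 * pi) * derive1n 1 rho (x - xi)).
  split.
  + move=> x; have h := sh _ _ _ (mollifier_cdf_derive (x - xi)).
    have h1 : is_derive x 1 (fun z => 1 - mollifier_cdf (z - xi)) (0 - rho (x - xi)).
      exact: (is_deriveB (is_derive_cst (1 : R) x 1) h).
    apply: (is_derive_congr (is_deriveZ (2 * pi) h1)).
    by rewrite /GRing.scale/=; ring.
  + by move=> x; have h := sh _ _ _ (mollifier_is_derive 0 (x - xi)); exact: (is_deriveZ (- (2 * pi)) h).
  + move=> x; apply: cvgM; first exact: cvg_cst.
    have c1 := derive_continuous (mollifier_is_derive 1).
    apply: (continuous_comp (f := fun x => x - xi)); last exact: c1.
    by apply: cvgB; [exact: cvg_id|exact: cvg_cst].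
  + by move=> x; rewrite mulNr oppr_le0 mulr_ge0 ?mollifier_ge0// mulr_ge0// ltW.
  + by move=> x xe; rewrite mulNr oppr_lt0 mulr_gt0 ?pos// mulr_gt0.
- by move=> x xe; rewrite mollifier_cdf_left; [ring|lra].
- by move=> x xe; rewrite mollifier_cdf_right; [ring|lra].
- have := mollifier_cdfN 0; rewrite oppr0 subrr => h.
  by have -> : mollifier_cdf 0 = 1 / 2 by [lra]; field.
Qed.

End Mollifier.

Lemma downstep_smooth_kink (rho : R -> R -> R) eps xi : 0 < eps -> mollifier eps (rho eps) ->
  downstep (smooth_kink rho eps xi) xi eps.
Proof.
move=> e0 mr; have -> : smooth_kink rho eps xi = fun x => 2 * pi * (1 - mollifier_cdf (rho eps) (x - xi)).
  by apply/funext => x; exact: (smooth_kinkE e0 mr).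
exact: downstep_cdf.
Qed.

Lemma downstep_smooth_antikink (rho : R -> R -> R) eps xi : 0 < eps -> mollifier eps (rho eps) ->
  downstep (fun x => smooth_antikink rho eps xi (- x)) (- xi) eps.
Proof.
move=> e0 mr; have -> : (fun x => smooth_antikink rho eps xi (- x)) =
    fun x => 2 * pi * (1 - mollifier_cdf (rho eps) (x - - xi)).
  apply/funext => x; rewrite /smooth_antikink (smooth_antikinkE e0 mr).
  by rewrite -(mollifier_cdfN e0 mr); congr (_ * mollifier_cdf _ _); ring.
exact: downstep_cdf.
Qed.

End Kinks.

(** * Sums of steps *)

Section StairSum.
Context {R : realType}.
Implicit Types (x y z t s c e p q r xi eps : R) (i j : nat).

Lemma downstep_nonincreasing (S : R -> R) xi eps x y : downstep S xi eps -> x <= y -> S y <= S x.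
Proof.
move=> dS; rewrite le_eqVlt => /predU1P[->//|xy].
have [[S1 [S2 [d1 _ _ n1 _]]] _ _ _] := dS.
have [c _ e] := MVT_derive d1 xy.
by rewrite -subr_le0 e mulr_le0_ge0// subr_ge0 ltW.
Qed.

Lemma downstep_ge0 (S : R -> R) xi eps x : downstep S xi eps -> 0 <= S x.
Proof.
move=> dS; pose y := Num.max x (xi + eps).
have <- : S y = 0 by apply: (downstep_right dS); rewrite le_max lexx orbT.
by apply: (downstep_nonincreasing dS); rewrite le_max lexx.
Qed.

Lemma downstep_le2pi (S : R -> R) xi eps x : downstep S xi eps -> S x <= 2 * pi.
Proof.
move=> dS; pose y := Num.min x (xi - eps).
have <- : S y = 2 * pi by apply: (downstep_left dS); rewrite ge_min lexx orbT.
by apply: (downstep_nonincreasing dS); rewrite ge_min lexx.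
Qed.

Lemma downstep_strict (S : R -> R) xi eps x y : downstep S xi eps -> x < y ->
  `|x - xi| <= eps -> `|y - xi| <= eps -> S y < S x.
Proof.
move=> dS xy; rewrite !ler_norml => hx hy.
have [[S1 [S2 [d1 _ _ _ neg]]] _ _ _] := dS.
have [c /andP[c1 c2] e] := MVT_derive d1 xy.
rewrite -subr_lt0 e nmulr_rlt0 ?subr_gt0//; apply: neg.
by rewrite ltr_norml; lra.
Qed.

Lemma downstep_eq_pi (S : R -> R) xi eps x : downstep S xi eps ->
  `|x - xi| <= eps -> S x = pi -> x = xi.
Proof.
move=> dS hx Sx; apply: contrapT => /eqP; rewrite neq_lt.
have h0 : `|xi - xi| <= eps by rewrite subrr normr0; apply: le_trans hx.
by move=> /orP[xl|xl]; have := downstep_strict dS xl; rewrite Sx (downstep_mid dS) ltxx;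
  [move=> /(_ hx h0)|move=> /(_ h0 hx)].
Qed.

Lemma steps_le (m : enat) i j : steps m j -> (i <= j)%N -> steps m i.
Proof. by case: m => //= k jk ij; exact: leq_ltn_trans jk. Qed.

Section Sum.
Variables (m : enat) (A : nat -> R -> R) (xm em : nat -> R).
Hypothesis em0 : forall j, steps m j -> 0 < em j.
Hypothesis dA : forall j, steps m j -> downstep (A j) (xm j) (em j).
Hypothesis sep : forall j, steps m j.+1 -> xm j.+1 + em j.+1 < xm j - em j.
Hypothesis fin : locally_finite_sum (steps m) A.

Definition stair_sum x : R := \sum_(j \in steps m) A j x.

Lemma steps_separated i j : steps m j -> (i < j)%N -> xm j + em j < xm i - em i.
Proof.
elim: j => [//|j IH] mj; rewrite ltnS leq_eqVlt => /predU1P[->|ij]; first exact: sep.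
have mj' : steps m j by apply: steps_le mj _.
by have := IH mj' ij; have := sep mj; have := em0 mj'; lra.
Qed.

Lemma stair_sum_cut N x : (forall j, (j < N)%N -> steps m j) ->
  (forall j, steps m j -> (N <= j)%N -> A j x = 0) ->
  stair_sum x = \sum_(j < N) A j x.
Proof.
move=> h1 h2; rewrite /stair_sum (@fsbig_ord _ _ _ N (fun j => A j x)); apply/esym/fsbig_widen => [j /h1//|].
by move=> j [mj /negP]; rewrite -leqNgt => /(h2 _ mj).
Qed.

(** Local finiteness makes only finitely many terms nonzero at [x], and since
    the steps are ordered, these are the terms of an initial segment of the
    indices: a term that vanishes at [x] lies on its left. *)
Lemma stair_sum_range x : exists N, [/\ forall j, (j < N)%N -> steps m j,
  forall j, (j < N)%N -> x < xm j + em j & forall j, steps m j -> (N <= j)%N -> A j x = 0].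
Proof.
pose D := [set j | steps m j /\ A j x != 0].
have fD : finite_set D.
  have [V Vx fV] := fin x; apply: sub_finite_set fV => j [mj Aj]; split=> //.
  by exists x => //; exact: nbhs_singleton.
have [k hk] : exists k, ~ D k.
  apply: contrapT => nk; apply: infinite_nat; apply: sub_finite_set fD => k _.
  by apply: contrapT => nDk; apply: nk; exists k.
pose Q := fun k => ~~ `[< D k >].
have exQ : exists k, Q k by exists k; apply/asboolPn.
case: (ex_minnP exQ) => N /asboolPn nDN minN.
have lt j : (j < N)%N -> D j.
  move=> jN; apply: contrapT => nDj; have : Q j by apply/asboolPn.
  by move=> /minN; rewrite leqNgt jN.
have Dx j : D j -> x < xm j + em j.
  move=> [mj Aj]; rewrite ltNge; apply/negP => /(downstep_right (dA mj)) e.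
  by rewrite e eqxx in Aj.
exists N; split=> [j /lt[]//|j /lt/Dx//|j mj].
rewrite leq_eqVlt => /predU1P[Nj|Nj].
  by apply: contrapT => /eqP Aj; apply: nDN; rewrite Nj.
apply: contrapT => /eqP Aj; apply: nDN.
have mN : steps m N by apply: steps_le mj (ltnW Nj).
split=> //; have xj : x < xm j + em j by apply: Dx.
have sj := steps_separated mj Nj.
rewrite (downstep_left (dA mN)); last by lra.
by rewrite mulf_neq0// ?gt_eqF// pi_gt0.
Qed.

Lemma stair_sum_nonincreasing x y : x <= y -> stair_sum y <= stair_sum x.
Proof.
move=> xy; have [N [h1 _ h3]] := stair_sum_range x.
rewrite (stair_sum_cut h1 h3) (stair_sum_cut h1); last first.
  move=> j mj Nj; apply/eqP; rewrite eq_le (downstep_ge0 _ (dA mj)) andbT -(h3 j mj Nj).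
  exact: downstep_nonincreasing (dA mj) xy.
by apply: ler_sum => j _; apply: downstep_nonincreasing (dA _) xy; exact: h1.
Qed.

Lemma stair_sum_ge0 x : 0 <= stair_sum x.
Proof.
have [N [h1 _ h3]] := stair_sum_range x; rewrite (stair_sum_cut h1 h3).
by apply: sumr_ge0 => j _; apply: downstep_ge0 (dA _); exact: h1.
Qed.

Lemma sum_full i x : (forall j, (j < i)%N -> A j x = 2 * pi) ->
  \sum_(j < i) A j x = (2 * i)%:R * pi.
Proof.
move=> h; rewrite (eq_bigr (fun=> 2 * pi)); last by move=> j _; exact: h.
by rewrite sumr_const card_ord -mulr_natl natrM; ring.
Qed.

(** In the window of one step all steps on its right contribute [2 * pi] and
    those on its left nothing, as the windows are disjoint. *)
Lemma stair_sum_window i x : steps m i -> `|x - xm i| <= em i ->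
  stair_sum x = (2 * i)%:R * pi + A i x.
Proof.
move=> mi; rewrite ler_norml => hx.
have h1 j : (j < i.+1)%N -> steps m j by rewrite ltnS; exact: steps_le.
rewrite (@stair_sum_cut i.+1)//; last first.
  move=> j mj ij; apply: (downstep_right (dA mj)).
  by have := steps_separated mj ij; lra.
rewrite big_ord_recr/= sum_full// => j ji.
have mj : steps m j by apply: steps_le mi (ltnW ji).
by apply: (downstep_left (dA mj)); have := steps_separated mi ji; lra.
Qed.

(** Outside the windows the sum is an even multiple of [pi]; in a window it
    takes an odd multiple only where the step has the value [pi]. *)
Lemma stair_sum_odd x : odd_level (stair_sum x) -> exists2 i, steps m i & x = xm i.
Proof.
move=> ox; have pi0 := pi_gt0 R.
have [[|i] [h1 h2 h3]] := stair_sum_range x.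
  exfalso; apply: (@even_not_odd R 0); rewrite mulr0 mul0r.
  by move: ox; rewrite (stair_sum_cut h1 h3) big_ord0.
have mi : steps m i by apply: h1.
have full j : (j < i)%N -> A j x = 2 * pi.
  move=> ji; have mj := h1 j (ltnW ji); apply: (downstep_left (dA mj)).
  by have := steps_separated mi ji; have := h2 i (ltnSn i); lra.
exists i => //; move: ox; rewrite (stair_sum_cut h1 h3) big_ord_recr/= sum_full//.
have [xl|xl] := leP x (xm i - em i).
  rewrite (downstep_left (dA mi))// => ox; exfalso; apply: (@even_not_odd R (i%:Z + 1)).
  have E : (2 * (i%:Z + 1))%:~R = (2 * i)%:R + 2 :> R.
    by rewrite mulrDr mulr1 intrD -PoszM -pmulrn.
  by rewrite E mulrDl.
have hx : `|x - xm i| <= em i by rewrite ler_norml; have := h2 i (ltnSn i); lra.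
have hx' : xm i - em i < x < xm i + em i by have := h2 i (ltnSn i); lra.
move=> [k hk].
apply: (downstep_eq_pi (dA mi) hx).
have e0 := em0 mi.
have l0 : `|xm i - em i - xm i| <= em i by rewrite ler0_norm; lra.
have l1 : `|xm i + em i - xm i| <= em i by rewrite ger0_norm; lra.
have a1 : A i x < 2 * pi.
  rewrite -(downstep_left (dA mi) (lexx _)); apply: (downstep_strict (dA mi)) => //; lra.
have a0 : 0 < A i x.
  rewrite -(downstep_right (dA mi) (lexx _)); apply: (downstep_strict (dA mi)) => //; lra.
have e : A i x = (2 * k + 1 - 2 * i%:Z)%:~R * pi.
  rewrite intrB mulrBl -hk; rewrite (_ : (2 * i%:Z)%:~R = (2 * i)%:R :> R); first by ring.
  by rewrite -PoszM -pmulrn.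
move: a0 a1; rewrite e pmulr_lgt0// ltr_pM2r// ltr0z (_ : 2 = 2%:~R :> R)// ltr_int => b0 b1.
by rewrite (_ : 2 * k + 1 - 2 * i%:Z = 1) ?mul1r//; lia.
Qed.

Lemma stair_sum_far_left j x : steps m j -> x <= xm j - em j ->
  (2 * j + 2)%:R * pi <= stair_sum x.
Proof.
move=> mj xj; apply: le_trans (stair_sum_nonincreasing xj).
have e0 := em0 mj.
rewrite (stair_sum_window mj); last by rewrite ler0_norm; lra.
by rewrite (downstep_left (dA mj))// natrD mulrDl.
Qed.

Lemma stair_sum_bounded j x : ~ steps m j -> stair_sum x <= (2 * j)%:R * pi.
Proof.
move=> nj; have [N [h1 _ h3]] := stair_sum_range x.
have Nj : (N <= j)%N by rewrite leqNgt; apply/negP => /h1.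
rewrite (stair_sum_cut h1 h3); apply: (@le_trans _ _ (\sum_(i < N) 2 * pi)).
  by apply: ler_sum => i _; apply: downstep_le2pi (dA _); exact: h1.
rewrite sumr_const card_ord -[_ *+ N]mulr_natl natrM.
rewrite (_ : 2%:R * j%:R * pi = j%:R * (2 * pi)); last by ring.
by rewrite ler_wpM2r ?ler_nat// mulr_ge0// ltW// pi_gt0.
Qed.

End Sum.
End StairSum.

(** * The initial staircase and the curves issuing from it *)

Section InitialData.
Context {R : realType}.
Implicit Types (u w : R -> R -> R) (v : R -> R) (x y z t s c e p q r xs : R) (i j : nat).
Local Notation level := (@level R).

(** What the part of the staircase to the left of [xs] looks like; the part to
    the right is described by the same properties of its reflection. *)
Record left_data v (m : enat) (xm : nat -> R) xs : Prop := LeftData {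
  ld_nonincreasing : forall x y, x <= y -> y <= xs -> v y <= v x ;
  ld_odd : forall x, x <= xs -> odd_level (v x) -> exists2 i, steps m i & x = xm i ;
  ld_level : forall j, steps m j -> xm j < xs /\ v (xm j) = level j ;
  ld_jet : forall j, steps m j -> exists g g1 g2 : R -> R, [/\
    exists2 r : R, 0 < r & forall x, `|x - xm j| < r -> v x = g x,
    forall x, is_derive x 1 g (g1 x), forall x, is_derive x 1 g1 (g2 x),
    continuous g2 & g1 (xm j) < 0] ;
  ld_far : forall j, steps m j -> exists X : R, forall x, x <= X -> (2 * j + 2)%:R * pi <= v x ;
  ld_bound : forall j, ~ steps m j -> exists X : R, forall x, x <= X -> v x <= (2 * j)%:R * pi ;
  ld_valley : v xs < level 0 }.

Section Staircase.
Variables (m n : enat) (A B : nat -> R -> R) (xm xq em eq : nat -> R) (xs : R).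
Hypothesis em0 : forall j, steps m j -> 0 < em j.
Hypothesis dA : forall j, steps m j -> downstep (A j) (xm j) (em j).
Hypothesis sepA : forall j, steps m j.+1 -> xm j.+1 + em j.+1 < xm j - em j.
Hypothesis finA : locally_finite_sum (steps m) A.
Hypothesis leA : forall j, steps m j -> xm j + em j <= xs.
Hypothesis dB : forall j, steps n j -> downstep (B j) (xq j) (eq j).
Hypothesis leB : forall j, steps n j -> xq j + eq j <= - xs.

Lemma staircase_leftE x : x <= xs -> stair_sum m A x + stair_sum n B (- x) = stair_sum m A x.
Proof.
move=> xl; rewrite [X in _ + X](@stair_sum_cut _ n B 0)//.
  by rewrite big_ord0 addr0.
by move=> j nj _; apply: (downstep_right (dB nj)); have := leB nj; lra.
Qed.

Lemma left_data_staircase v : (forall x, v x = stair_sum m A x + stair_sum n B (- x)) ->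
  left_data v m xm xs.
Proof.
move=> vE; have vl x : x <= xs -> v x = stair_sum m A x.
  by move=> xl; rewrite vE staircase_leftE.
split.
- move=> x y xy yl; rewrite !vl//; last exact: le_trans yl.
  exact: (stair_sum_nonincreasing em0 dA sepA finA).
- by move=> x xl; rewrite vl//; exact: (stair_sum_odd em0 dA sepA finA).
- move=> j mj; have h1 := em0 mj; have h2 := leA mj.
  split; first by lra.
  rewrite vl; last by lra.
  rewrite (stair_sum_window em0 dA sepA mj) ?subrr ?normr0 ?(ltW h1)//.
  by rewrite (downstep_mid (dA mj)) /level natrD mulrDl mul1r.
- move=> j mj; have h1 := em0 mj; have h2 := leA mj.
  have [[g1 [g2 [d1 d2 c2 _ neg]]] _ _ _] := dA mj.
  exists (fun x => (2 * j)%:R * pi + A j x), g1, g2; split => //.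
  + exists (em j) => // x xj; rewrite vl; last by move: xj; rewrite ltr_norml; lra.
    by rewrite (stair_sum_window em0 dA sepA mj)// ltW.
  + move=> x; apply: (is_derive_congr (is_deriveD (is_derive_cst ((2 * j)%:R * pi : R) x 1) (d1 x))).
    by rewrite add0r.
  + by apply: neg; rewrite subrr normr0.
- move=> j mj; exists (Num.min xs (xm j - em j)) => x; rewrite le_min => /andP[xl xj].
  by rewrite vl//; exact: (stair_sum_far_left em0 dA sepA finA).
- move=> j nj; exists xs => x xl; rewrite vl//; exact: (stair_sum_bounded em0 dA sepA finA).
- rewrite vl// (@stair_sum_cut _ m A 0)// ?big_ord0.
    by rewrite /level mulr_gt0 ?pi_gt0 ?ltr0n.
  by move=> j mj _; apply: (downstep_right (dA mj)); exact: leA.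
Qed.

End Staircase.

Lemma ld_is_derive v m xm xs j : left_data v m xm xs -> steps m j ->
  exists2 a : R, is_derive (xm j) 1 v a & a < 0.
Proof.
move=> ld mj; have [g [g1 [g2 [[r r0 hr] d1 _ _ neg]]]] := ld_jet ld mj.
exists (g1 (xm j)) => //; apply: (near_eq_is_derive _ (d1 (xm j))).
by exists r => //= x; rewrite /ball_/= distrC => /hr.
Qed.

Section Flow.
Variables (C : R) (f : R -> R) (u w : R -> R -> R) (m n : enat) (xm xq : nat -> R) (xs : R).
Hypothesis fl : flow C f u w.
Hypothesis f2 : forall j, f ((2 * j)%:R * pi) = 0.
Hypothesis u0 : forall x, 0 <= u x 0.
Hypothesis ldl : left_data (u ^~ 0) m xm xs.
Hypothesis ldr : left_data (mirror u ^~ 0) n xq (- xs).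

Lemma nondecreasing_right x y : xs <= x -> x <= y -> u x 0 <= u y 0.
Proof.
move=> h1 h2; have := ld_nonincreasing ldr (x := - y) (y := - x).
by rewrite /mirror !opprK; apply; lra.
Qed.

Lemma initial_strict_left x y z : odd_level (u x 0) -> x < y -> u y 0 < u x 0 ->
  z < x -> u x 0 < u z 0.
Proof.
move=> ox xy uyx zx; have [xl|xl] := ltP x xs; last first.
  by have := nondecreasing_right xl (ltW xy); lra.
have [i mi e] := ld_odd ldl (ltW xl) ox.
have [a da a0] := ld_is_derive ldl mi; rewrite -e in da.
have [r r0 [_ h]] := derive_lt0_decreases da a0.
pose z' := Num.max z (x - r / 2).
have z1 : z <= z' by rewrite le_max lexx.
have z2 : x - r / 2 <= z' by rewrite le_max lexx orbT.
have z3 : z' < x by rewrite gt_max; lra.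
have : u x 0 < u z' 0 by apply: h; lra.
have : u z' 0 <= u z 0 by apply: (ld_nonincreasing ldl) => //; lra.
by lra.
Qed.

Lemma initial_no_min_left x : odd_level (u x 0) -> x <= xs ->
  exists y, u y 0 < u x 0.
Proof.
move=> ox xl; have [i mi e] := ld_odd ldl xl ox.
have [a da a0] := ld_is_derive ldl mi; rewrite -e in da.
have [r r0 [h _]] := derive_lt0_decreases da a0.
by exists (x + r / 2); apply: h; lra.
Qed.

End Flow.

Lemma stair_flow_of_initial C f u w m n xm xq xs : flow C f u w ->
  (forall j, f ((2 * j)%:R * pi) = 0) -> (forall x, 0 <= u x 0) ->
  left_data (u ^~ 0) m xm xs -> left_data (mirror u ^~ 0) n xq (- xs) ->
  stair_flow C f u w m n.
Proof.
move=> fl f2 u0 ldl ldr.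
have u0' x : 0 <= mirror u x 0 by exact: u0.
have ldl' : left_data (mirror (mirror u) ^~ 0) m xm (- - xs) by rewrite mirrorK opprK.
have f00 : f 0 = 0 by have := f2 0%N; rewrite muln0 mul0r.
split=> //.
- exists xs; split; first exact: ld_nonincreasing ldl.
  by move=> x y; exact: (nondecreasing_right ldr).
- exact: flow_nonneg fl f00 u0.
- exact: (left_end_of_initial fl f2 u0 (ld_far ldl) (ld_bound ldl)).
- exact: (left_end_of_initial (flow_mirror fl) f2 u0' (ld_far ldr) (ld_bound ldr)).
- exact: (initial_strict_left ldl ldr).
- move=> x y z ox yx uyx xz.
  have := @initial_strict_left (mirror u) n m xq xm (- xs) ldr ldl' (- x) (- y) (- z).
  by rewrite /mirror !opprK !ltrN2; apply.
- move=> x y ox hm _; exfalso; have [xl|xl] := leP x xs.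
    by have [e] := initial_no_min_left ldl ox xl; have := hm e; lra.
  have := @initial_no_min_left (mirror u) n xq (- xs) ldr (- x).
  rewrite /mirror opprK => /(_ ox)[|e]; first by lra.
  by have := hm (- e); lra.
Qed.

Lemma derivable_inN (A : set R) (g : R -> R) : derivable_in A g ->
  derivable_in A (fun t => - g t).
Proof.
move=> h t At; have /cvg_ex[l hl] := h t At; apply/cvg_ex; exists (- l).
rewrite (_ : (fun s => _) = (fun s => - ((g s - g t) / (s - t)))); first exact: cvgN.
by apply/funext => s; rewrite -mulNr opprB opprK addrC.
Qed.

Section Curves.
Variables (C : R) (f : R -> R) (u w : R -> R -> R) (m n : enat) (xm xq : nat -> R) (xs : R).
Hypothesis sf : stair_flow C f u w m n.
Hypothesis ldl : left_data (u ^~ 0) m xm xs.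
Hypothesis rate : forall j, steps m j -> exists l : R, initial_rate u (xm j) l.

Lemma initial_left_point j : steps m j -> left_point u 0 j (xm j).
Proof.
move=> mj; have [_ e] := ld_level ldl mj; split=> //.
have [a da a0] := ld_is_derive ldl mj.
have [r r0 [h _]] := derive_lt0_decreases da a0.
by exists (xm j + r / 2); [lra|apply: h; lra].
Qed.

Lemma left_curve0 j : steps m j -> left_curve u j 0 = xm j.
Proof. by move=> mj; apply: (left_curveE sf) => //; exact: initial_left_point. Qed.

Variable A : set R.
Hypothesis A0 : forall t, A t -> 0 <= t.
Hypothesis below : forall t, A t -> exists e, u e t < level 0.

Lemma left_curve_point j t : steps m j -> A t -> left_point u t j (left_curve u j t).
Proof.
move=> mj At; have [e ue] := below At.
have [|_ //] := left_curveP sf (A0 At) mj (e := e).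
by apply: lt_le_trans ue _; rewrite level_le.
Qed.

Lemma left_curve_lt j t e : steps m j -> A t -> u e t < level 0 -> left_curve u j t < e.
Proof.
move=> mj At ue; have [|//] := left_curveP sf (A0 At) mj (e := e).
by apply: lt_le_trans ue _; rewrite level_le.
Qed.

Lemma left_curve_derivable_in j : steps m j -> derivable_in A (left_curve u j).
Proof.
move=> mj; apply: (left_curve_derivable sf) => //.
  by move=> s As; exact: left_curve_point.
move=> _; have [l hl] := rate mj; have [a da a0] := ld_is_derive ldl mj.
by exists l, a; rewrite left_curve0//; split=> //; rewrite lt_eqF.
Qed.

Lemma left_curves_ordered j t : steps m j.+1 -> A t -> left_curve u j.+1 t < left_curve u j t.
Proof.
move=> mj At; have t0 := A0 At; have mj' : steps m j by apply: steps_le mj _.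
have [u1 l1] := left_curve_point mj At; have [u2 l2] := left_curve_point mj' At.
set X := left_curve u j.+1 t in u1 l1 *; set Y := left_curve u j t in u2 l2 *.
have lv : level j < level j.+1 by rewrite level_lt.
rewrite ltNge le_eqVlt; apply/negP => /predU1P[e|YX].
  by move: lv; rewrite -u1 -u2 e ltxx.
have ox : odd_level (u X t) by rewrite u1; exact: odd_level_level.
have := left_side_strict sf t0 ox l1 YX; rewrite u1 u2; lra.
Qed.

Lemma left_position x e t : A t -> u e t < level 0 -> odd_level (u x t) -> x < e ->
  exists2 j, steps m j & x = left_curve u j t.
Proof.
move=> At ue ox xe; have t0 := A0 At; have [j uj] := odd_point_level sf t0 ox.
have lx : left_side u t x by exists e => //; rewrite uj; apply: lt_le_trans ue _; rewrite level_le.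
exists j; last by rewrite (left_curveE sf t0 (x := x)).
by apply: (left_point_steps sf t0 uj); exact: (sides_exclusive sf t0 lx).
Qed.

End Curves.

(** The time [t1] is the supremum of those at which the valley is below the
    lowest odd level [pi].  It is infinite if there are only kinks or only
    antikinks, because the slice is then below [pi] near one end.  Before [t1] no
    position is a minimum, and each step owns the one point of its level on its
    side. *)
Lemma positions_are_curves C f u w m n (xm xp : nat -> R) xs :
  stair_flow C f u w m n -> left_data (u ^~ 0) m xm xs ->
  left_data (mirror u ^~ 0) n (fun j => - xp j) (- xs) ->
  (forall j, steps m j -> exists l : R, initial_rate u (xm j) l) ->
  (forall j, steps n j -> exists l : R, initial_rate (mirror u) (- xp j) l) ->
  exists t1 : \bar R,
    [/\ (0 < t1)%E,
        (m = Fin 0 \/ n = Fin 0 -> t1 = +oo%E) &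
        exists Xm Xp : nat -> R -> R,
          [/\ forall t : R, 0 <= t -> (t%:E < t1)%E ->
                P (u ^~ t) = positions m n (Xm ^~ t) (Xp ^~ t),
              forall t : R, 0 <= t -> (t%:E < t1)%E ->
                ordered m n (Xm ^~ t) (Xp ^~ t),
              forall j, steps m j ->
                derivable_in [set t : R | 0 <= t /\ (t%:E < t1)%E] (Xm j) /\
                Xm j 0 = xm j &
              forall j, steps n j ->
                derivable_in [set t : R | 0 <= t /\ (t%:E < t1)%E] (Xp j) /\
                Xp j 0 = xp j]].
Proof.
move=> sf ldl ldr ratel rater; have pi0 := pi_gt0 R.
have sfr := stair_flow_mirror sf; have fl := sf_flow sf.
have l0 : 0 < level 0 by rewrite /level mulr_gt0// ltr0n.
pose Q := [set t%:E | t in [set t : R | 0 <= t /\ exists e, u e t < level 0]].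
pose t1 : \bar R := ereal_sup Q.
pose A := [set t : R | 0 <= t /\ (t%:E < t1)%E].
have A0 t : A t -> 0 <= t by case.
have below t : A t -> exists e, u e t < level 0.
  move=> [t0 /ereal_sup_gt[_ [s [s0 [e ue]] <-]]]; rewrite lte_fin => ts.
  exact: (earlier_below sf t0 ts (odd_level_level 0) (ltW ue)).
have belowr t : A t -> exists e, mirror u e t < level 0.
  by move=> /below[e ue]; exists (- e); rewrite /mirror opprK.
have e0 := ld_valley ldl.
exists t1; split.
- have [r r0 h] := flow_near_lt fl (lexx 0) e0.
  have : ((r / 2)%:E <= t1)%E.
    apply: ereal_sup_ubound; exists (r / 2) => //; split; first by lra.
    by exists xs; apply: h; rewrite ?subrr ?normr0 ?subr0 ?gtr0_norm//; lra.
  by apply: lt_le_trans; rewrite lte_fin; lra.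
- move=> mn; suff ex t : 0 <= t -> exists e, u e t < level 0.
    apply: eq_infty => x.
    apply: (@le_trans _ _ (Num.max x 0)%:E); first by rewrite lee_fin le_max lexx.
    by apply: ereal_sup_ubound; exists (Num.max x 0) => //; split;
      [|apply: ex]; rewrite le_max lexx orbT.
  move=> t0; case: mn => e.
    have [_ h] := sf_left_end sf 0%N t0; have [|X hX] := h; first by rewrite e.
    by exists X; exact: hX.
  have [_ h] := sf_right_end sf 0%N t0; have [|X hX] := h; first by rewrite e.
  by exists (- X); exact: (hX X).
exists (left_curve u), (fun j t => - left_curve (mirror u) j t); split.
- move=> t t0 tt1; have At : A t by split.
  have [e ue] := below t At; apply/seteqP; split=> x.
    move=> ox; have [xe|ex|xe] := ltgtP x e.
    + by left; have [j mj ->] := left_position sf A0 At ue ox xe; exists j.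
    + right; have uer : mirror u (- e) t < level 0 by rewrite /mirror opprK.
      have oxr : odd_level (mirror u (- x) t) by rewrite /mirror opprK.
      have xer : - x < - e by rewrite ltrN2.
      have [j nj E] := left_position sfr A0 At uer oxr xer.
      by exists j => //; rewrite -E opprK.
    + exfalso; have [j uj] := odd_point_level sf t0 ox.
      have : level 0 <= level j by rewrite level_le.
      by rewrite -uj xe leNgt ue.
  move=> [[j mj <-]|[j nj <-]]; rewrite /P/=.
    by have [-> _] := left_curve_point sf A0 below mj At; exact: odd_level_level.
  by have [E _] := left_curve_point sfr A0 belowr nj At; rewrite /mirror in E;
    rewrite E; exact: odd_level_level.
- move=> t t0 tt1; have At : A t by split.
  split.
  + by move=> j mj; exact: (left_curves_ordered sf A0 below mj At).
  + by move=> j nj; rewrite ltrN2; exact: (left_curves_ordered sfr A0 belowr nj At).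
  + move=> m0 n0; have [e ue] := below t At.
    have uer : mirror u (- e) t < level 0 by rewrite /mirror opprK.
    have := left_curve_lt sf A0 m0 At ue; have := left_curve_lt sfr A0 n0 At uer; lra.
- move=> j mj; split; last exact: (left_curve0 sf ldl mj).
  exact: (left_curve_derivable_in sf ldl ratel A0 below mj).
- move=> j nj; split; last by rewrite (left_curve0 sfr ldr nj) opprK.
  apply: derivable_inN; exact: (left_curve_derivable_in sfr ldr rater A0 belowr nj).
Qed.

End InitialData.

(** * The heat kernel *)

Section HeatSemigroup.
Context {R : realType}.
Local Notation mu := (@lebesgue_measure R).
Implicit Types (x y z t s c e p q r a : R).

(** The integral of a nonnegative function is a supremum, hence monotone
    without any measurability.  It bounds the source term of the integral equation
    without a discussion of its measurability. *)
Lemma ge0_integral_mono (D : set R) (f g : R -> \bar R) :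
  (forall x, D x -> (0 <= f x)%E) -> (forall x, D x -> (f x <= g x)%E) ->
  (\int[mu]_(x in D) f x <= \int[mu]_(x in D) g x)%E.
Proof.
move=> f0 fg; have g0 x : D x -> (0 <= g x)%E.
  by move=> Dx; apply: le_trans (fg x Dx); exact: f0.
rewrite !ge0_integralE//; apply: le_ereal_sup => _ [h hf <-]; exists h => // x.
apply: le_trans (hf x) _; rewrite !patchE; case: ifPn => // /set_mem; exact: fg.
Qed.

Lemma Rintegral_bound (D : set R) (f g : R -> R) :
  mu.-integrable D (EFin \o g) -> (forall x, D x -> `|f x| <= g x) ->
  `|\int[mu]_(x in D) f x|%R <= \int[mu]_(x in D) g x.
Proof.
move=> ig fg.
have g0 x : D x -> 0 <= g x by move=> Dx; apply: le_trans (fg x Dx).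
have g0' : (0 <= \int[mu]_(x in D) (g x)%:E)%E by apply: integral_ge0 => x /g0; rewrite lee_fin.
have gfin : (\int[mu]_(x in D) (g x)%:E < +oo)%E.
  case/integrableP: ig => _; apply: le_lt_trans; apply: ge0_integral_mono.
    by move=> x /g0; rewrite lee_fin.
  by move=> x _; rewrite /= lee_fin ler_norm.
rewrite /Rintegral integralE.
set P := integral _ _ _; set N := integral _ _ _.
have P0 : (0 <= P)%E by apply: integral_ge0 => x _.
have N0 : (0 <= N)%E by apply: integral_ge0 => x _.
have Pg : (P <= \int[mu]_(x in D) (g x)%:E)%E.
  apply: ge0_integral_mono => // x Dx; rewrite funeposE ge_max !lee_fin g0// andbT.
  by apply: le_trans (fg x Dx); exact: ler_norm.
have Ng : (N <= \int[mu]_(x in D) (g x)%:E)%E.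
  apply: ge0_integral_mono => // x Dx; rewrite funenegE ge_max !lee_fin g0// andbT.
  by apply: le_trans (fg x Dx); rewrite -normrN; exact: ler_norm.
move: P0 N0 Pg Ng gfin g0'; case: (\int[mu]_(x in D) (g x)%:E)%E => //= i.
case: P => // p; case: N => // q; rewrite !lee_fin => p0 q0 pi qi _ i0 /=.
by rewrite ler_norml; lra.
Qed.

(** Completing the square: the exponential tilts the Gaussian of variance
    [2 * t], which yields its moment generating function. *)
Lemma heat_kernel_pdf t a y : 0 < t ->
  heat_kernel t y * expR (a * y) =
  expR (a ^+ 2 * t) * normal_pdf (2 * a * t) (Num.sqrt (2 * t)) y.
Proof.
move=> t0; have t20 : 0 < 2 * t by lra.
have s0 : Num.sqrt (2 * t) != 0 by rewrite gt_eqF// sqrtr_gt0.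
rewrite normal_pdfE// /normal_peak /normal_fun /heat_kernel sqr_sqrtr ?(ltW t20)//.
rewrite (_ : 2 * t * pi *+ 2 = 4 * pi * t); last by ring.
rewrite (_ : 2 * t *+ 2 = 4 * t); last by ring.
rewrite -[LHS]mulrA [RHS]mulrCA -!expRD; congr (_ * expR _).
by field; lra.
Qed.

Lemma heat_kernel_integrable t a : 0 < t ->
  mu.-integrable setT (EFin \o (fun y => heat_kernel t y * expR (a * y))).
Proof.
move=> t0; have := integrableZl measurableT (expR (a ^+ 2 * t))
  (@integrable_normal_pdf R (2 * a * t) (Num.sqrt (2 * t))).
by apply: eq_integrable => // y _; rewrite /= heat_kernel_pdf.
Qed.

Lemma heat_kernel_expR t a : 0 < t ->
  (\int[mu]_y (heat_kernel t y * expR (a * y)))%R = expR (a ^+ 2 * t).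
Proof.
move=> t0; under eq_Rintegral do rewrite heat_kernel_pdf//.
rewrite RintegralZl//; last exact: integrable_normal_pdf.
by rewrite /Rintegral integral_normal_pdf mulr1.
Qed.

Lemma heat_kernel_ge0 t y : 0 <= heat_kernel t y.
Proof. by rewrite mulr_ge0 ?expR_ge0// invr_ge0. Qed.

Lemma heat_kernel_integrable1 t : 0 < t -> mu.-integrable setT (EFin \o heat_kernel t).
Proof.
move=> t0; have := heat_kernel_integrable 0 t0.
by apply: eq_integrable => // y _; rewrite /= mul0r expR0 mulr1.
Qed.

Lemma heat_kernel_mass t : 0 < t -> (\int[mu]_y heat_kernel t y)%R = 1.
Proof.
move=> t0; have := heat_kernel_expR 0 t0; rewrite expr0n mul0r expR0 => <-.
by apply: eq_Rintegral => y _; rewrite mul0r expR0 mulr1.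
Qed.

(** [cosh_excess] measures how far a Gaussian spreads: its mean vanishes with
    the variance, while away from the origin it dominates exponentials. *)
Definition cosh_excess C y : R := expR (C * y) + expR (- C * y) - 2.

Lemma heat_kernel_excess_integrable C t eps K : 0 < t ->
  mu.-integrable setT (EFin \o (fun y => heat_kernel t y * (eps + K * cosh_excess C y))).
Proof.
move=> t0; have i1 := heat_kernel_integrable C t0; have i2 := heat_kernel_integrable (- C) t0.
have i3 := heat_kernel_integrable1 t0.
have := integrableD measurableT (integrableZl measurableT (eps - 2 * K) i3)
  (integrableZl measurableT K (integrableD measurableT i1 i2)).
by apply: eq_integrable => // y _; rewrite /= -!EFinM -!EFinD; congr EFin; rewrite /cosh_excess; ring.
Qed.

Lemma heat_kernel_excess C t eps K : 0 < t ->
  (\int[mu]_y (heat_kernel t y * (eps + K * cosh_excess C y)))%R =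
  eps + K * (2 * expR (C ^+ 2 * t) - 2).
Proof.
move=> t0; have i1 := heat_kernel_integrable C t0; have i2 := heat_kernel_integrable (- C) t0.
have i3 := heat_kernel_integrable1 t0.
have i12 : mu.-integrable setT (EFin \o
    (fun y => heat_kernel t y * expR (C * y) + heat_kernel t y * expR (- C * y))).
  exact: (integrableD measurableT i1 i2).
transitivity (\int[mu]_y ((eps - 2 * K) * heat_kernel t y +
  K * (heat_kernel t y * expR (C * y) + heat_kernel t y * expR (- C * y))))%R.
  by apply: eq_Rintegral => y _; rewrite /cosh_excess; ring.
rewrite RintegralD//; first last.
- exact: (integrableZl measurableT K i12).
- exact: (integrableZl measurableT (eps - 2 * K) i3).
rewrite (RintegralZl _ measurableT i3) (RintegralZl _ measurableT i12).
rewrite (RintegralD measurableT i1 i2) !heat_kernel_expR// heat_kernel_mass// sqrrN.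
by ring.
Qed.

(** The excess vanishes at the origin only and grows like the exponential, so
    that the quotient of the exponential by the excess is bounded outside any
    neighbourhood of the origin. *)
Lemma excess_dominates C (delta : R) : 0 < C -> 0 < delta -> exists2 K : R, 0 <= K &
  (forall y, 0 <= cosh_excess C y) /\
  forall y, delta <= `|y| -> expR (C * `|y|) <= K * cosh_excess C y.
Proof.
move=> C0 d0; pose E (y : R) := expR (C * y) + expR (- C * y).
have prod y : expR (C * y) * expR (- C * y) = 1.
  by rewrite -expRD mulNr subrr expR0.
have E2 y : 0 < expR (C * y) by exact: expR_gt0.
have E2' y : 0 < expR (- C * y) by exact: expR_gt0.
have ge y : 0 <= cosh_excess C y.
  have : 0 <= (expR (C * y) - expR (- C * y)) ^+ 2 by exact: sqr_ge0.
  have -> : (expR (C * y) - expR (- C * y)) ^+ 2 = cosh_excess C y * (E y + 2).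
    rewrite /cosh_excess /E; set a := expR (C * y); set b := expR (- C * y).
    have -> : (a - b) ^+ 2 = (a + b - 2) * (a + b + 2) - 4 * (a * b - 1) by ring.
    by rewrite prod; ring.
  by rewrite pmulr_lge0// /E !addr_gt0.
have gt : 0 < cosh_excess C delta.
  have : expR (- C * delta) < expR (C * delta) by rewrite ltr_expR mulNr; have := mulr_gt0 C0 d0; lra.
  move=> lt; rewrite lt_neqAle ge andbT; apply/eqP => e0.
  have ab1 := prod delta; move: lt e0 ab1; rewrite /cosh_excess.
  set a := expR (C * delta); set b := expR (- C * delta) => ab e ab1.
  have e1 : (a - b) ^+ 2 = (a + b - 2) * (a + b + 2) - 4 * (a * b - 1) by ring.
  have : 0 < (a - b) ^+ 2 by rewrite exprn_gt0//; lra.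
  by rewrite e1 ab1 -e; lra.
have mono y : delta <= y -> cosh_excess C delta <= cosh_excess C y.
  move=> dy; have e1 : expR (C * delta) <= expR (C * y) by rewrite ler_expR ler_pM2l.
  have g1 : 1 <= expR (C * delta) by rewrite -expR0 ler_expR mulr_ge0 ?ltW.
  have : 0 <= (expR (C * y) - expR (C * delta)) * (1 - expR (- C * y) * expR (- C * delta)).
    rewrite mulr_ge0 ?subr_ge0// -expRD -expR0 ler_expR.
    by have : 0 <= C * y /\ 0 <= C * delta; [split; rewrite mulr_ge0//; lra|lra].
  have := prod y; have := prod delta; rewrite /cosh_excess.
  move: (expR (C * y)) (expR (- C * y)) (expR (C * delta)) (expR (- C * delta)) => a a' b b' bb aa.
  have -> : (a - b) * (1 - a' * b') = (a + a' * (b * b')) - (b + b' * (a * a')) by ring.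
  by rewrite aa bb; lra.
exists ((cosh_excess C delta + 2) / cosh_excess C delta).
  by rewrite divr_ge0 ?ge// addr_ge0.
split=> // y dy.
have sym : cosh_excess C y = cosh_excess C `|y|.
  by have [y0|y0] := ger0P y => //; rewrite /cosh_excess mulrNN mulrN -mulNr [X in X - 2]addrC.
rewrite sym; set z := `|y| in dy *; have m := mono z dy.
rewrite mulrAC ler_pdivlMr//.
have -> : (cosh_excess C delta + 2) * cosh_excess C z =
  (cosh_excess C z + 2) * cosh_excess C delta + 2 * (cosh_excess C z - cosh_excess C delta) by ring.
apply: (@le_trans _ _ ((cosh_excess C z + 2) * cosh_excess C delta)); last by lra.
by rewrite ler_pM2r// /cosh_excess; have := E2' z; lra.
Qed.

End HeatSemigroup.

(** * Continuity of the heat flow, and the nonlinearity *)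

Section Solution.
Context {R : realType}.
Local Notation mu := (@lebesgue_measure R).
Implicit Types (x y z t s c e p q r a eps : R) (j : nat).

Lemma X_omega_bound C (v : R -> R) x : 0 < C -> forall M : R,
  `|omega C x * v x| <= M -> `|v x| <= C * M * expR (C * `|x|).
Proof.
move=> C0 M; rewrite /omega normrM gtr0_norm ?mulr_gt0 ?expR_gt0 ?invr_gt0//.
rewrite mulNr expRN => h; have E0 := expR_gt0 (C * `|x|).
set E := expR (C * `|x|) in h E0 *.
have -> : `|v x| = C * E * (C^-1 * E^-1 * `|v x|) by field; rewrite !gt_eqF.
rewrite [leRHS](_ : _ = C * E * M); last by ring.
by rewrite ler_wpM2l// mulr_ge0// ltW.
Qed.

Section HeatFlow.
Variables (C M : R) (v : R -> R).
Hypothesis C0 : 0 < C.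
Hypothesis cv : continuous v.
Hypothesis vM : forall x, `|v x| <= M * expR (C * `|x|).

Lemma heat_flow_integrable t x : 0 < t ->
  mu.-integrable setT (EFin \o (fun y => heat_kernel t y * v (x - y))).
Proof.
move=> t0; have M0 : 0 <= M.
  by have := vM 0; rewrite normr0 mulr0 expR0 mulr1; apply: le_trans.
have i1 := heat_kernel_integrable C t0; have i2 := heat_kernel_integrable (- C) t0.
have i3 := heat_kernel_integrable1 t0.
have i12 : mu.-integrable setT (EFin \o
    (fun y => heat_kernel t y * expR (C * y) + heat_kernel t y * expR (- C * y))).
  exact: (integrableD measurableT i1 i2).
have i4 : mu.-integrable setT (EFin \o (fun y => M * expR (C * `|x|) *
    (heat_kernel t y * expR (C * y) + heat_kernel t y * expR (- C * y)))).
  exact: (integrableZl measurableT _ i12).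
apply: le_integrable i4 => //.
  apply/measurable_EFinP; apply: measurable_funM.
    by apply/measurable_EFinP; exact: (measurable_int mu i3).
  apply: continuous_measurable_fun => y; apply: (continuous_comp (f := fun y => x - y)).
    by apply: cvgB; [exact: cvg_cst|exact: cvg_id].
  exact: cv.
move=> y _ /=; rewrite lee_fin normrM (ger0_norm (heat_kernel_ge0 _ _)).
rewrite -mulrDr [leRHS]ger0_norm; last first.
  by rewrite !mulr_ge0 ?expR_ge0 ?heat_kernel_ge0// addr_ge0 ?expR_ge0.
rewrite [leRHS]mulrCA ler_wpM2l ?heat_kernel_ge0//.
apply: (le_trans (vM _)); rewrite -mulrA ler_wpM2l//.
apply: (@le_trans _ _ (expR (C * `|x|) * expR (C * `|y|))).
  by rewrite -expRD ler_expR -mulrDr ler_pM2l// ler_normB.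
rewrite ler_wpM2l ?expR_ge0//; have [y0|y0] := ger0P y.
  by rewrite lerDl expR_ge0.
by rewrite mulrN -mulNr lerDr expR_ge0.
Qed.

(** Where [y] is small the continuity of [v] bounds the integrand, elsewhere
    its growth does, by a multiple of the excess, the mean of which tends to [0]
    with the time. *)
Lemma heat_flow_near x0 eps : 0 < eps -> exists2 r : R, 0 < r & forall x t,
  `|x - x0| < r -> 0 < t -> t < r -> `|convolution (heat_kernel t) v x - v x| < eps.
Proof.
move=> e0; have c0 := C0; have e4 : 0 < eps / 4 by lra.
have /cvgrPdist_lt/(_ _ e4)[d /= d0 hd] := cv (x := x0).
have M0 : 0 <= M.
  by have := vM 0; rewrite normr0 mulr0 expR0 mulr1; apply: le_trans.
have d20 : 0 < d / 2 by lra.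
have [K K0 [ge0 dom]] := excess_dominates C0 d20.
pose M1 := 2 * M * expR (C * (`|x0| + 1)).
have M10 : 0 <= M1 by rewrite !mulr_ge0 ?expR_ge0.
pose K1 := M1 * K.
have K10 : 0 <= K1 by rewrite mulr_ge0.
have [r1 r10 hr1] : exists2 r : R, 0 < r & forall t, 0 < t -> t < r ->
    K1 * (2 * expR (C ^+ 2 * t) - 2) < eps / 2.
  have e' : 0 < eps / 2 / (2 * (K1 + 1)) by rewrite !divr_gt0// mulr_gt0//; lra.
  have /cvgrPdist_lt/(_ _ e')[r /= r0 hr] := @continuous_expR R 0.
  have C20 : 0 < C ^+ 2 by rewrite exprn_gt0.
  exists (r / C ^+ 2) => [|t t0 tr]; first by rewrite divr_gt0.
  have := hr (C ^+ 2 * t); rewrite /= sub0r normrN expR0.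
  have Ct0 : 0 < C ^+ 2 * t by rewrite mulr_gt0.
  rewrite gtr0_norm// [_ * t]mulrC -ltr_pdivlMr// => /(_ tr).
  rewrite ltr_norml ltr_pdivlMr; last by lra.
  rewrite [t * _]mulrC => /andP[h _].
  have g1 : 1 <= expR (C ^+ 2 * t) by rewrite -expR0 ler_expR ltW.
  have : (K1 + 1) * (expR (C ^+ 2 * t) - 1) < (K1 + 1) * (eps / 2 / (2 * (K1 + 1))).
    rewrite ltr_pM2l; last by lra.
    by move: h; rewrite ltrNl; lra.
  have -> : (K1 + 1) * (eps / 2 / (2 * (K1 + 1))) = eps / 4 by field; lra.
  by lra.
exists (Num.min (Num.min (d / 2) 1) r1); first by rewrite !lt_min r10 ltr01 d20.
move=> x t; rewrite !lt_min => /andP[/andP[xd x1] _] t0 /andP[_ tr].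
have bound y : `|v (x - y) - v x| <= eps / 2 + K1 * cosh_excess C y.
  have [yd|yd] := ltP `|y| (d / 2).
    have h1 := hd x; have h2 := hd (x - y).
    have : `|v x0 - v x| < eps / 4 by apply: h1; rewrite /= distrC; lra.
    have : `|v x0 - v (x - y)| < eps / 4.
      apply: h2; rewrite /= (_ : x0 - _ = (x0 - x) + y); last by ring.
      by apply: (le_lt_trans (ler_normD _ _)); rewrite [`|x0 - x|]distrC; lra.
    have : 0 <= K1 * cosh_excess C y by rewrite mulr_ge0.
    by rewrite !ltr_norml ler_norml; lra.
  apply: (le_trans (ler_normB _ _)).
  have xx : `|x| <= `|x0| + 1.
    by have := ler_normD (x - x0) x0; rewrite subrK; lra.
  have E (z : R) : 0 <= z -> z <= `|x0| + 1 + `|y| -> M * expR (C * z) <=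
      M * expR (C * (`|x0| + 1)) * expR (C * `|y|).
    move=> z0 zy; rewrite -mulrA ler_wpM2l// -expRD ler_expR -mulrDr.
    by rewrite ler_pM2l.
  have b1 : `|v (x - y)| <= M * expR (C * (`|x0| + 1)) * expR (C * `|y|).
    by apply: (le_trans (vM _)); apply: E => //; have := ler_normB x y; lra.
  have b2 : `|v x| <= M * expR (C * (`|x0| + 1)) * expR (C * `|y|).
    by apply: (le_trans (vM _)); apply: E => //; have := normr_ge0 y; lra.
  have : M1 * expR (C * `|y|) <= M1 * (K * cosh_excess C y) by rewrite ler_wpM2l// dom.
  rewrite [X in X <= _](_ : _ = M * expR (C * (`|x0| + 1)) * expR (C * `|y|) +
    M * expR (C * (`|x0| + 1)) * expR (C * `|y|)); last by rewrite /M1; ring.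
  by rewrite /K1 mulrA; lra.
have i1 := heat_flow_integrable x t0; have i2 := heat_kernel_integrable1 t0.
have i3 : mu.-integrable setT (EFin \o (fun y => heat_kernel t y * v x)).
  by have := integrableZr measurableT (v x) i2; apply: eq_integrable => // y _.
have -> : convolution (heat_kernel t) v x - v x =
    (\int[mu]_y (heat_kernel t y * (v (x - y) - v x)))%R.
  rewrite /convolution -[X in _ - X]mul1r -(heat_kernel_mass t0).
  rewrite -RintegralZr// -RintegralB//.
  by apply: eq_Rintegral => y _; ring.
have : `|\int[mu]_y (heat_kernel t y * (v (x - y) - v x))|%R <=
    eps / 2 + K1 * (2 * expR (C ^+ 2 * t) - 2).
  rewrite -heat_kernel_excess//; apply: Rintegral_bound.
    exact: heat_kernel_excess_integrable.
  by move=> y _; rewrite normrM (ger0_norm (heat_kernel_ge0 _ _)) ler_wpM2l ?heat_kernel_ge0.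
by have := hr1 t t0 tr; lra.
Qed.

End HeatFlow.

Lemma nonlinearity_is_derive f0 Theta0 x :
  is_derive x 1 (nonlinearity f0 Theta0) (- sin (x + Theta0)).
Proof.
have h : is_derive x 1 (fun z : R => z + Theta0) 1.
  by apply: (is_derive_congr (is_deriveD (is_derive_id x 1) (is_derive_cst Theta0 x 1))); rewrite addr0.
have h1 := @is_derive1_comp R cos (fun z : R => z + Theta0) x _ _ (is_derive_cos _) h.
by apply: (is_derive_congr (is_deriveD h1 (is_derive_cst f0 x 1))); rewrite mulr1 addr0.
Qed.

Lemma nonlinearity_lipschitz f0 Theta0 a b :
  `|nonlinearity f0 Theta0 a - nonlinearity f0 Theta0 b| <= `|a - b|.
Proof.
wlog ab : a b / a < b.
  move=> H; have [ab|ba|->] := ltgtP a b; first exact: H.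
    by rewrite distrC [leRHS]distrC; exact: H.
  by rewrite !subrr.
have [c _ e] := MVT_derive (nonlinearity_is_derive f0 Theta0) ab.
rewrite distrC e [leRHS]distrC normrM ler_piMl// normrN.
by rewrite ler_norml sin_geN1 sin_le1.
Qed.

Lemma cos_nat_period x j : cos (x + (2 * j)%:R * pi) = cos x.
Proof.
elim: j => [|j IH]; first by rewrite muln0 mul0r addr0.
rewrite (_ : x + _ = x + (2 * j)%:R * pi + pi + pi).
  by rewrite !cosDpi opprK.
by rewrite !mulnS natrD; ring.
Qed.

Lemma cos_int_period x (k : int) : cos (x + (2 * k)%:~R * pi) = cos x.
Proof.
have [|j|j] := intP k; first by rewrite mulr0 mulr0z mul0r addr0.
  by rewrite -PoszM -pmulrn cos_nat_period.
rewrite -[LHS](cos_nat_period _ j.+1); congr cos.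
by rewrite mulrN mulrNz -PoszM -pmulrn; ring.
Qed.

End Solution.

(** * The solution of the initial value problem *)

Section Duhamel.
Context {R : realType}.
Local Notation mu := (@lebesgue_measure R).
Implicit Types (x y z t s c e p q r a eps : R) (j : nat).

Lemma convolution_bounded t (h : R -> R) x K : 0 < t -> (forall y, `|h y| <= K) ->
  `|convolution (heat_kernel t) h x| <= K.
Proof.
move=> t0 hK; have i := heat_kernel_integrable1 t0.
have -> : K = (\int[mu]_y (heat_kernel t y * K))%R.
  by rewrite (RintegralZr _ measurableT i) heat_kernel_mass// mul1r.
apply: Rintegral_bound.
  by have := integrableZr measurableT K i; apply: eq_integrable => // y _.
by move=> y _; rewrite normrM (ger0_norm (heat_kernel_ge0 _ _)) ler_wpM2l ?heat_kernel_ge0.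
Qed.

Lemma source_term_bounded (g : R -> R) t K : 0 < t -> (forall s, 0 < s < t -> `|g s| <= K) ->
  `|\int[mu]_(s in `]0, t[) g s|%R <= K * t.
Proof.
move=> t0 hg.
have -> : K * t = (\int[mu]_(s in `]0, t[) K)%R.
  by rewrite Rintegral_cst//= lebesgue_measure_itv/= lte_fin t0 oppr0 adde0.
apply: Rintegral_bound; last by move=> s; rewrite /= in_itv/=; exact: hg.
apply/integrableP; split; first exact: measurable_cst.
rewrite /= integral_cst//= lebesgue_measure_itv/= lte_fin t0 oppr0 adde0.
by rewrite -EFinM ltry.
Qed.

Section FlowOfSolution.
Variables (C f0 Theta0 : R) (v : R -> R) (u : R -> R -> R).
Hypothesis C0 : 0 < C.
Hypothesis hf0 : 0 < f0 < 1.
Hypothesis hf : nonlinearity f0 Theta0 0 = 0.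
Hypothesis hv : X_omega C v.
Hypothesis hu : global_solution C (nonlinearity f0 Theta0) v u.

Local Notation f := (nonlinearity f0 Theta0).

Lemma nonlinearity_bounded x : `|f x| <= 2.
Proof.
have h := hf0; have := cos_geN1 (x + Theta0); have := cos_le1 (x + Theta0).
by rewrite /nonlinearity ler_norml; lra.
Qed.

Lemma nonlinearity_even j : f ((2 * j)%:R * pi) = 0.
Proof. by rewrite -hf /nonlinearity add0r [_ * pi + Theta0]addrC cos_nat_period. Qed.

Lemma nonlinearity_odd c : odd_level c -> 0 < f c.
Proof.
move=> [k ->]; have h0 := hf0; have := hf; rewrite /nonlinearity add0r.
have -> : (2 * k + 1)%:~R * pi + Theta0 = Theta0 + (2 * k)%:~R * pi + pi.
  by rewrite intrD mulrDl mul1r; ring.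
by rewrite cosDpi cos_int_period; lra.
Qed.

(** In the integral equation the first term is close to the initial datum, and
    the second one is at most [2 * t]. *)
Lemma solution_near_initial x0 eps : 0 < eps -> exists2 r : R, 0 < r &
  forall x t, `|x - x0| < r -> 0 <= t -> t < r -> `|u x t - v x0| < eps.
Proof.
move=> e0; have [cv [M hM]] := hv; have [_ _ [ui ud] _ _] := hu.
have e3 : 0 < eps / 3 by lra.
have vM x := X_omega_bound C0 (hM x).
have [r1 r10 h1] := heat_flow_near C0 cv vM x0 e3.
have /cvgrPdist_lt/(_ _ e3)[r2 /= r20 h2] := cv x0.
exists (Num.min (Num.min r1 r2) (eps / 6)).
  by rewrite !lt_min r10 r20; lra.
move=> x t; rewrite !lt_min => /andP[/andP[x1 x2] _] t0 /andP[/andP[t1 _] t3].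
have vx : `|v x0 - v x| < eps / 3 by apply: h2; rewrite /= distrC.
move: t0; rewrite le_eqVlt => /predU1P[<-|t0].
  by rewrite ui distrC; lra.
rewrite ud//; have := h1 x t x1 t0 t1.
set I := (\int[mu]_(s in _) _)%R; set H := convolution _ _ _ => hH.
have : `|I| <= 2 * t.
  apply: source_term_bounded => // s /andP[s0 st]; apply: convolution_bounded.
    by lra.
  by move=> y; exact: nonlinearity_bounded.
by move: hH vx; rewrite !ltr_norml ler_norml; lra.
Qed.

(** The equation of the slope is the space derivative of the equation: the third
    space derivative is obtained from the mixed one, [u_tx = u_xxx + f'(u) * u_x].
    The integral equation enters only through continuity at the initial time. *)
Theorem flow_of_solution : exists w, flow C f u w.
Proof.
have [_ growth [ui ud] [D [D0 Ds]] pde] := hu.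
have uD t : 0 < t -> u ^~ t = D 0%N 0%N ^~ t.
  by move=> t0; apply/funext => x; rewrite D0.
have ut x t : 0 < t -> is_derive t 1 (u x) (D 0%N 1%N x t).
  move=> t0; have [_ d _] := Ds 0%N 0%N x t t0; apply: near_eq_is_derive d.
  near=> s; apply: D0; near: s; exact: lt_nbhsr.
have ux x t : 0 < t -> is_derive x 1 (u ^~ t) (D 1%N 0%N x t).
  by move=> t0; rewrite uD//; have [d _ _] := Ds 0%N 0%N x t t0.
have eqn x t : 0 < t -> D 0%N 1%N x t = D 2%N 0%N x t + f (u x t).
  move=> t0; have := pde x t t0.
  have -> : derive1 (u x) t = D 0%N 1%N x t.
    by rewrite derive1E; have h := ut x t t0; exact: derive_val.
  have -> : derive1n 2 (u ^~ t) x = D 2%N 0%N x t.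
    rewrite derive1nS derive1n1 (_ : derive1 (u ^~ t) = D 1%N 0%N ^~ t); last first.
      by apply/funext => y; rewrite derive1E; have h := ux y t t0; exact: derive_val.
    by rewrite derive1E; have [h _ _] := Ds 1%N 0%N x t t0; exact: derive_val.
  by [].
have near0 (x0 : R) eps : 0 < eps -> exists2 r : R, 0 < r &
    forall x t, `|x - x0| < r -> 0 <= t -> t < r -> `|u x t - u x0 0| < eps.
  by rewrite ui; exact: solution_near_initial.
exists (D 1%N 0%N); split.
- exact: C0.
- exact: nonlinearity_lipschitz.
- exact: nonlinearity_odd.
- apply/subspace_continuousP => -[x t] /= t0.
  move: t0; rewrite le_eqVlt => /predU1P[<-|t0].
    apply/cvgrPdist_lt => eps e0; have [r r0 h] := near0 x eps e0.
    rewrite near_withinE; exists (ball x r, ball (0 : R) r) => /=.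
      by split; exact: nbhsx_ballx.
    move=> [y s] [/= y1 s1] s0; rewrite /from_subspace/= distrC; apply: h => //.
      by rewrite distrC.
    by move: s1; rewrite /ball/= sub0r normrN ger0_norm.
  apply: cvg_within_filter; have [_ _ c] := Ds 0%N 0%N x t t0.
  move: c; rewrite /prop_for /continuous_at D0// => c; apply: cvg_trans c.
  apply: near_eq_cvg; near=> z; rewrite /from_subspace D0//.
  near: z; have : \forall s \near t, 0 < s by exact: lt_nbhsr.
  by move/(cvg_snd (FF := nbhs_filter x)).
- move=> T; have [M hM] := growth T; exists (C * M) => x t tT.
  exact: (X_omega_bound (v := u ^~ t) C0 (hM t x tT)).
- exact: ux.
- by move=> x t t0; have [_ _] := Ds 1%N 0%N x t t0.
- move=> x t t0; exists (D 0%N 1%N x t), (D 2%N 0%N x t); split; last exact: eqn.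
  split; first exact: ut.
  exists (D 1%N 0%N ^~ t); split; first by move=> y; exact: ux.
  by have [d _ _] := Ds 1%N 0%N x t t0.
- move=> x t t0; exists (D 1%N 1%N x t), (D 3%N 0%N x t); split.
    split; first by have [_ d _] := Ds 1%N 0%N x t t0.
    exists (D 2%N 0%N ^~ t); split; first by move=> y; have [d _ _] := Ds 1%N 0%N y t t0.
    by have [d _ _] := Ds 2%N 0%N x t t0.
  have [d1 _ _] := Ds 0%N 1%N x t t0; have [d3 _ _] := Ds 2%N 0%N x t t0.
  have df := @is_derive1_comp R f (u ^~ t) x _ _ (nonlinearity_is_derive _ _ _) (ux x t t0).
  have d4 := is_deriveD d3 df.
  have E : D 2%N 0%N ^~ t + (f \o u ^~ t) = D 0%N 1%N ^~ t.
    by apply/funext => y; rewrite (eqn y t t0).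
  rewrite E in d4.
  have -> : D 1%N 1%N x t = D 3%N 0%N x t + - sin (u x t + Theta0) * D 1%N 0%N x t.
    by rewrite -(@derive_val _ _ _ _ _ _ _ d1) (@derive_val _ _ _ _ _ _ _ d4).
  rewrite addrC addKr normrM ler_piMl// normrN.
  by rewrite ler_norml sin_geN1 sin_le1.
Unshelve. all: by end_near.
Qed.

End FlowOfSolution.

End Duhamel.

(** * Differentiability at the initial time *)

Section InitialRate.
Context {R : realType}.
Implicit Types (x y z t s c e p q r a eps : R) (j : nat).

(** The solution of the heat equation with initial datum [(x - y) ^+ 4]. *)
Definition heat_quartic (y x t : R) : R :=
  (x - y) ^+ 4 + 12 * (x - y) ^+ 2 * t + 12 * t ^+ 2.

Lemma heat_quartic_ge y x t : 0 <= t -> (x - y) ^+ 4 <= heat_quartic y x t.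
Proof.
move=> t0; have p2 := sqr_ge0 (x - y); have p3 := sqr_ge0 t.
have p4 : 0 <= 12 * (x - y) ^+ 2 * t by apply: mulr_ge0 => //; lra.
by rewrite /heat_quartic; lra.
Qed.

Lemma heat_jet_quartic y x t :
  heat_jet (heat_quartic y) x t (12 * (x - y) ^+ 2 + 24 * t) (12 * (x - y) ^+ 2 + 24 * t).
Proof.
split.
  have h1 := is_deriveZ (12 * (x - y) ^+ 2) (is_derive_id t 1).
  have h2 := is_deriveZ 12 (is_deriveX 2 (is_derive_id t 1)).
  apply: (is_derive_congr (is_deriveD (is_deriveD (is_derive_cst ((x - y) ^+ 4) t 1) h1) h2)).
  by rewrite /GRing.scale/=; ring.
pose X z := z - y.
have D1 (z : R) : is_derive z 1 X 1.
  by apply: (is_derive_congr (is_deriveB (is_derive_id z 1) (is_derive_cst y z 1))); rewrite subr0.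
exists (fun z => 4 * X z ^+ 3 + 24 * t * X z); split=> [z|].
  have h := is_deriveD (is_deriveX 4 (D1 z)) (is_deriveZ (12 * t) (is_deriveX 2 (D1 z))).
  have e : heat_quartic y ^~ t = fun z => X z ^+ 4 + 12 * t * X z ^+ 2 + 12 * t ^+ 2.
    by apply/funext => q; rewrite /heat_quartic /X; ring.
  rewrite e; apply: (is_derive_congr (is_deriveD h (is_derive_cst (12 * t ^+ 2) z 1))).
  by rewrite /GRing.scale/=; ring.
have h := is_deriveD (is_deriveZ 4 (is_deriveX 3 (D1 x))) (is_deriveZ (24 * t) (D1 x)).
by apply: (is_derive_congr h); rewrite /GRing.scale/= /X; ring.
Qed.

(** On a small box around [y] the increment [u x t - u x 0] minus [l * t] solves
    the heat equation with a source less than [eta].  A multiple of the caloric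
    quartic centred at [y] dominates it on the sides of the box but is only of
    second order in time at [y] itself, with constants that do not depend on
    [y]. *)
Lemma short_time_increment C (f : R -> R) (u w : R -> R -> R) (g g1 g2 : R -> R)
    (y b s l eta M sigma : R) :
  flow C f u w -> 0 < b -> 0 < s -> s <= 1 -> 0 < eta -> 0 <= M -> M * b ^+ 4 = 1 + `|l| ->
  `|sigma| = 1 -> (forall x, is_derive x 1 g (g1 x)) -> (forall x, is_derive x 1 g1 (g2 x)) ->
  (forall x, `|x - y| <= b -> u x 0 = g x) ->
  (forall x t, `|x - y| <= b -> 0 <= t <= s ->
     `|u x t - g x| <= 1 /\ `|f (u x t) + g2 x - l| < eta) ->
  0 <= sigma * (u y s - u y 0 - l * s) + eta * s + 12 * M * s ^+ 2.
Proof.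
move=> fl b0 s0 s1 e0 M0 Mb sigma1 dg dg1 ug near.
have cg := derive_continuous dg.
have sig1 (z : R) : - `|z| <= sigma * z.
  by rewrite -[`|z|]mul1r -sigma1 -normrM lerNl -normrN ler_norm.
pose d x t := sigma * (u x t - g x - l * t) + eta * t + M * heat_quartic y x t.
have Q0 x t : 0 <= t -> 0 <= M * heat_quartic y x t.
  move=> t0; apply: mulr_ge0 => //.
  by apply: le_trans (heat_quartic_ge y x t0); rewrite exprn_even_ge0.
have : 0 <= d y s.
  pose Q : set (R * R) := `[y - b, y + b] `*` `[0, s].
  apply: (@max_principle _ Q d 1).
  - by apply: compact_setX; exact: segment_compact.
  - have c1 (k : R) : {within Q, continuous (fun _ : R * R => k)}.
      by move=> z; exact: cst_continuous.
    have ct : {within Q, continuous (fun z : R * R => z.2)}.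
      by apply: continuous_subspaceT => z; exact: cvg_snd.
    have cx : {within Q, continuous (fun z : R * R => z.1 - y)}.
      apply: continuous_subspaceT => z.
      by apply: cvgB; [exact: cvg_fst|exact: cvg_cst].
    have cX n (h : R * R -> R) : {within Q, continuous h} ->
        {within Q, continuous (fun z : R * R => h z ^+ n)}.
      move=> ch; elim: n => [|n IH]; first exact: (c1 1).
      have -> : (fun z : R * R => h z ^+ n.+1) = (fun z : R * R => h z * h z ^+ n).
        by apply/funext => z; rewrite exprS.
      exact: within_continuousM.
    apply: within_continuousD; last first.
      apply: within_continuousM => //; apply: within_continuousD.
        apply: within_continuousD; first exact: (cX 4 _ cx).
        apply: within_continuousM => //; apply: within_continuousM => //; exact: (cX 2 _ cx).
      by apply: within_continuousM => //; exact: (cX 2 _ ct).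
    apply: within_continuousD; last exact: within_continuousM.
    apply: within_continuousM => //; apply: within_continuousD.
      apply: within_continuousD.
        apply: continuous_subspaceW (flow_continuous fl) => -[x t] [_].
        by rewrite /= in_itv/= => /andP[].
      apply: within_continuousN; apply: continuous_subspaceT => z.
      apply: (continuous_comp (f := fst) (g := g)); first exact: cvg_fst.
      exact: cg.
    by apply: within_continuousN; exact: within_continuousM.
  - move=> x t []; rewrite /= !in_itv/= => hx ht dneg.
    have [t0 ts] := andP ht.
    have xb : `|x - y| <= b by clear -hx; rewrite ler_norml; lra.
    have [n1 n2] := near x t xb ht.
    have t00 : 0 < t.
      rewrite lt_neqAle t0 andbT; apply/eqP => e; subst t.
      move: dneg; rewrite /d mulr0 subr0 ug// subrr !mulr0 !add0r.
      by have := Q0 x 0 (lexx 0); clear; lra.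
    have hx' : y - b < x < y + b.
      suff ne : `|x - y| != b.
        have : `|x - y| < b by rewrite lt_neqAle ne.
        by clear; rewrite ltr_norml; lra.
      apply/eqP => e; move: dneg; rewrite /d.
      have : M * b ^+ 4 <= M * heat_quartic y x t.
        rewrite ler_wpM2l// -e -normrX ger0_norm ?exprn_even_ge0//.
        exact: heat_quartic_ge.
      have : `|u x t - g x - l * t| <= 1 + `|l|.
        apply: (le_trans (ler_normB _ _)); rewrite lerD// normrM ler_piMr//.
        by rewrite ger0_norm// (le_trans ts).
      have := sig1 (u x t - g x - l * t).
      have : 0 <= eta * t by rewrite mulr_ge0// ltW.
      by rewrite Mb; clear; lra.
    split; first by apply: past_interior_box => //; rewrite t00.
    have [a [bb [J ea]]] := flow_equation fl x t00.
    have Jg : heat_jet (fun x _ => g x) x t 0 (g2 x).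
      split; first exact: is_derive_cst.
      by exists g1.
    have Jl (k : R) : heat_jet (fun _ t => k * t) x t k 0.
      split.
        apply: (is_derive_congr (is_deriveZ k (is_derive_id t 1))).
        by rewrite /GRing.scale/= mulr1.
      by exists (fun=> 0); split=> [q|]; exact: is_derive_cst.
    have J' := heat_jetD (heat_jetD (heat_jetZ sigma (heat_jetB (heat_jetB J Jg) (Jl l)))
      (Jl eta)) (heat_jetZ M (heat_jet_quartic y x t)).
    do 2 eexists; split; first exact: J'.
    rewrite ea mul1r.
    have := sig1 (f (u x t) + g2 x - l); move: dneg n2; clear; lra.
  - by rewrite /Q/= !in_itv/=; clear -b0 s0; split; lra.
rewrite /d /heat_quartic subrr expr0n/= expr0n/= mulr0 mul0r !add0r -ug; last first.
  by rewrite subrr normr0 ltW.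
by rewrite mulrA [M * 12]mulrC.
Qed.

(** Both signs of the barrier enclose the increment up to [eps / 2] times the
    time and a quadratic error. *)
Lemma initial_rate_of_jet C (f : R -> R) (u w : R -> R -> R) x0 (g g1 g2 : R -> R) (r : R) :
  flow C f u w -> 0 < r -> (forall x, `|x - x0| < r -> u x 0 = g x) ->
  (forall x, is_derive x 1 g (g1 x)) -> (forall x, is_derive x 1 g1 (g2 x)) ->
  continuous g2 -> initial_rate u x0 (g2 x0 + f (u x0 0)).
Proof.
move=> fl r0 ug dg dg1 cg2 eps e0.
set l := g2 x0 + f (u x0 0).
have cg := derive_continuous dg.
have e4 : 0 < eps / 4 by clear -e0; lra.
have e2 : 0 < eps / 2 by clear -e0; lra.
have half : 0 < 1 / 2 :> R by clear; lra.
have m0 : 0 < Num.min (eps / 4) (1 / 2) by rewrite lt_min e4.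
have [r1 r10 h1] := flow_near fl x0 (lexx 0) m0.
have /cvgrPdist_lt/(_ _ e4)[r2 /= r20 h2] := cg2 x0.
have /cvgrPdist_lt/(_ _ half)[r3 /= r30 h3] := cg x0.
pose b : R := Num.min (Num.min r r1) (Num.min r2 r3) / 3.
have b0 : 0 < b by rewrite divr_gt0// !lt_min r0 r10 r20 r30.
have [b1 [b2 [b3 b4]]] : 3 * b <= r /\ 3 * b <= r1 /\ 3 * b <= r2 /\ 3 * b <= r3.
  by rewrite /b mulrC divfK// !ge_min !lexx !orbT.
pose sg := Num.min b 1.
have sg0 : 0 < sg by rewrite lt_min b0 ltr01.
have [sg1 sg2] : sg <= b /\ sg <= 1 by rewrite /sg !ge_min !lexx orbT.
pose M : R := (1 + `|l|) / b ^+ 4.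
have b40 : 0 < b ^+ 4 by rewrite exprn_gt0.
have M0 : 0 <= M by rewrite divr_ge0// ?ltW// addr_ge0.
have Mb : M * b ^+ 4 = 1 + `|l| by rewrite /M divfK// gt_eqF.
(* for [s < eps / 2 / K] the quadratic error is less than [eps / 2 * s] *)
pose K : R := 24 * M + 1.
have K0 : 0 < K by clear -M0; rewrite /K; lra.
exists (Num.min sg (eps / 2 / K)); first by rewrite lt_min sg0 divr_gt0.
move=> y s; rewrite lt_min => /andP[y1 _] s0; rewrite lt_min => /andP[s1 s2].
have close x : `|x - y| <= b -> `|x - x0| < 3 * b.
  move=> xy; rewrite (_ : x - x0 = (x - y) + (y - x0)); last by ring.
  by apply: (le_lt_trans (ler_normD _ _)); clear -xy y1 sg1 b0; lra.
have ini x : `|x - y| <= b -> u x 0 = g x.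
  by move=> /close xy; apply: ug; exact: lt_le_trans b1.
have near x t : `|x - y| <= b -> 0 <= t <= s ->
    `|u x t - g x| <= 1 /\ `|f (u x t) + g2 x - l| < eps / 2.
  move=> /close xx0 /andP[t0 ts].
  have t1 : `|t - 0| < r1.
    by rewrite subr0 ger0_norm//; clear -ts s1 sg1 b2 b0; lra.
  have := h1 x t t0 (lt_le_trans xx0 b2) t1; rewrite lt_min => /andP[k1 k2].
  have k3 : `|g2 x0 - g2 x| < eps / 4.
    by apply: h2; rewrite /= distrC; exact: lt_le_trans b3.
  have k4 : `|g x0 - g x| < 1 / 2.
    by apply: h3; rewrite /= distrC; exact: lt_le_trans b4.
  have k5 := le_lt_trans (flow_lipschitz fl (u x t) (u x0 0)) k1.
  have ug0 : u x0 0 = g x0 by rewrite ug// subrr normr0.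
  clear -k2 k3 k4 k5 ug0; split.
    by move: k2 k4; rewrite ug0 !ltr_norml ler_norml; lra.
  by move: k5 k3; rewrite /l !ltr_norml; lra.
have sle1 : s <= 1 by apply: le_trans sg2; exact: ltW.
have main sigma : `|sigma| = 1 -> 0 <= sigma * (u y s - u y 0 - l * s) + eps / 2 * s + 12 * M * s ^+ 2.
  move=> sigma1.
  exact: (short_time_increment fl b0 s0 sle1 e2 M0 Mb sigma1 dg dg1 ini near).
have m1 := main 1 (normr1 R); have m2 := main (-1) (normrN1 R).
rewrite mul1r in m1; rewrite mulN1r in m2.
have -> : (u y s - u y 0) / s - l = (u y s - u y 0 - l * s) / s by field; rewrite gt_eqF.
rewrite normrM normfV [`|s|]gtr0_norm// ltr_pdivrMr//.
have : 12 * M * s ^+ 2 < eps / 2 * s.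
  rewrite expr2 mulrA ltr_pM2r//.
  have : s * K < eps / 2 by rewrite -ltr_pdivlMr.
  have : 0 <= s * M by rewrite mulr_ge0// ltW.
  by rewrite /K; clear -s0 e0; lra.
by move: m1 m2; clear; rewrite ltr_norml; lra.
Qed.

End InitialRate.

Theorem proposition2 (R : realType) (f0 Theta0 C : R) (rho : R -> R -> R)
    (m n : enat) (xm xp em ep : nat -> R) (u : R -> R -> R)
    (hf0 : 0 < f0 < 1)
    (hTheta0 : 0 < Theta0 < pi)
    (hf : nonlinearity f0 Theta0 0 = 0)
    (hC : 0 < C)
    (hrho : forall eps : R, 0 < eps -> mollifier eps (rho eps))
    (hmn : ~ (m = Fin 0 /\ n = Fin 0))
    (hpos : ordered m n xm xp)
    (hwidth : admissible_widths m n xm xp em ep)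
    (hfinm : locally_finite_sum (steps m)
               (fun j => smooth_kink rho (em j) (xm j)))
    (hfinn : locally_finite_sum (steps n)
               (fun j => smooth_antikink rho (ep j) (xp j)))
    (hu0 : X_omega C (staircase rho m n xm xp em ep))
    (hu : global_solution C (nonlinearity f0 Theta0)
            (staircase rho m n xm xp em ep) u) :
  [/\ forall t : R, 0 <= t -> discrete_set (P (u ^~ t)),
      forall m' n' : nat, m = Fin m' -> n = Fin n' ->
        forall t : R, 0 <= t -> (P (u ^~ t) #<= `I_(m' + n'))%card,
      exists t1 : \bar R,
        [/\ (0 < t1)%E,
            (m = Fin 0 \/ n = Fin 0 -> t1 = +oo%E) &
            exists Xm Xp : nat -> R -> R,
              [/\ forall t : R, 0 <= t -> (t%:E < t1)%E ->
                    P (u ^~ t) = positions m n (Xm ^~ t) (Xp ^~ t),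
                  forall t : R, 0 <= t -> (t%:E < t1)%E ->
                    ordered m n (Xm ^~ t) (Xp ^~ t),
                  forall j, steps m j ->
                    derivable_in [set t : R | 0 <= t /\ (t%:E < t1)%E] (Xm j) /\
                    Xm j 0 = xm j &
                  forall j, steps n j ->
                    derivable_in [set t : R | 0 <= t /\ (t%:E < t1)%E] (Xp j) /\
                    Xp j 0 = xp j]] &
      forall (T : R) (a b : R -> R),
        position_curve u T a -> position_curve u T b -> a 0 < b 0 ->
        forall s t : R, 0 <= s -> s <= t -> t <= T ->
          ((P (u ^~ t) `&` `]a t, b t[) #<= (P (u ^~ s) `&` `]a s, b s[))%card].
Proof.
have [w fl] := flow_of_solution hC hf0 hf hu0 hu.
have [ordm ordp ordmp] := hpos; have [[em0 ep0] wm wp wmp] := hwidth.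
(* the antikinks are treated as the kinks of the reflected solution *)
pose A j := smooth_kink rho (em j) (xm j).
pose B j := fun x => smooth_antikink rho (ep j) (xp j) (- x).
pose xq j := - xp j.
have dA j : steps m j -> downstep (A j) (xm j) (em j).
  by move=> mj; apply: downstep_smooth_kink; [exact: em0|apply: hrho; exact: em0].
have dB j : steps n j -> downstep (B j) (xq j) (ep j).
  by move=> nj; apply: downstep_smooth_antikink; [exact: ep0|apply: hrho; exact: ep0].
have sepA j : steps m j.+1 -> xm j.+1 + em j.+1 < xm j - em j.
  move=> mj; have := ordm j mj; have := wm j mj => -[] + + h.
  by rewrite gtr0_norm; lra.
have sepB j : steps n j.+1 -> xq j.+1 + ep j.+1 < xq j - ep j.
  move=> nj; have := ordp j nj; have := wp j nj => -[] + + h.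
  by rewrite /xq ltr0_norm; lra.
have finB : locally_finite_sum (steps n) B.
  move=> x; have [V Vx fV] := hfinn (- x); exists (-%R @^-1` V).
    exact: (opp_continuous x).
  by apply: sub_finite_set fV => j [nj [y Vy By]]; split=> //; exists (- y).
have firstA j : steps m j -> xm j + em j <= xm 0%N + em 0%N.
  case: j => [//|j] mj; have := steps_separated em0 sepA mj (ltn0Sn j).
  by have := em0 0%N (steps_le mj (leq0n _)); lra.
have firstB j : steps n j -> xq j + ep j <= xq 0%N + ep 0%N.
  case: j => [//|j] nj; have := steps_separated ep0 sepB nj (ltn0Sn j).
  by have := ep0 0%N (steps_le nj (leq0n _)); lra.
(* a point of the initial valley, between the last kink and the first antikink *)
have [xs [leA leB]] : exists xs, (forall j, steps m j -> xm j + em j <= xs) /\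
    (forall j, steps n j -> xq j + ep j <= - xs).
  have [m0|nm0] := pselect (steps m 0%N).
    exists (xm 0%N + em 0%N); split=> // j nj; apply: le_trans (firstB j nj) _.
    have n0 : steps n 0%N := steps_le nj (leq0n _).
    have := wmp m0 n0 => -[]; have := ordmp m0 n0 => h.
    by rewrite /xq ltr0_norm; lra.
  exists (xp 0%N - ep 0%N); split=> j h; first by case: nm0; exact: steps_le h (leq0n _).
  by have := firstB j h; rewrite {2}/xq; lra.
have uE x : u x 0 = stair_sum m A x + stair_sum n B (- x).
  have [_ _ [-> _] _ _] := hu; rewrite /staircase /stair_sum /B.
  by congr (_ + _); apply: eq_fsbigr => j _; rewrite opprK.
have ldl : left_data (u ^~ 0) m xm xs.
  exact: (left_data_staircase em0 dA sepA hfinm leA dB leB uE).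
have ldr : left_data (mirror u ^~ 0) n xq (- xs).
  have leA' j : steps m j -> xm j + em j <= - - xs by rewrite opprK; exact: leA.
  apply: (left_data_staircase ep0 dB sepB finB leB dA leA') => x.
  by rewrite /mirror uE opprK addrC.
have rate v w' k (y : nat -> R) ys : flow C (nonlinearity f0 Theta0) v w' ->
    left_data (v ^~ 0) k y ys -> forall j, steps k j -> exists l : R, initial_rate v (y j) l.
  move=> flv ld j kj; have [g [g1 [g2 [[r r0 hr] d1 d2 c2 _]]]] := ld_jet ld kj.
  by eexists; exact: (initial_rate_of_jet flv r0 hr d1 d2 c2).
have u00 x : 0 <= u x 0.
  by rewrite uE addr_ge0//; [apply: (stair_sum_ge0 em0 dA sepA)|apply: (stair_sum_ge0 ep0 dB sepB)].
have sf := stair_flow_of_initial fl (nonlinearity_even hf) u00 ldl ldr.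
split.
- by move=> t t0; exact: (discrete_positions sf).
- by move=> m' n' mE nE t t0; exact: (count_positions sf mE nE).
- exact: (positions_are_curves sf ldl ldr (rate _ _ _ _ _ fl ldl) (rate _ _ _ _ _ (flow_mirror fl) ldr)).
- move=> T a b ca cb _ s t s0 st tT; exact: (points_between_nonincreasing sf ca cb).
Qed.
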